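(* Let $T$ be a Calder\'on--Zygmund operator with an $s$-dimensional CZ kernel $K$ on $\mathbb{R}^d$ (as in the context). Suppose that the only reflectionless measure for $T$ is the zero measure. Let $\mu$ be an $s$-dimensional measure, i.e. $\mu$ is $\Lambda$-nice for some $\Lambda>0$ and $\mathcal{H}^s(\operatorname{supp}(\mu))<\infty$. If $T_\mu$ is bounded in $L^2(\mu)$ (i.e. $\mu$ is $\Lambda$-good for some $\Lambda>0$), then $\mu$ is the zero measure.
   Context: Fix integers $d\ge 2$, $d'\ge1$, reals $s\in(0,d)$, $\alpha\in(0,1]$. Let $\Omega:\mathbb{R}^d\to\mathbb{C}^{d'}$ satisfy $\Omega(\lambda x)=\lambda\Omega(x)$ for all $\lambda\in\mathbb{R}$, $|\Omega(x)|\le1$ and $|\Omega(x)-\Omega(x')|\le|x-x'|^\alpha$ for $x,x'$ on the unit sphere, and $\Omega(-x)=-\Omega(x)$. The $s$-dimensional CZ kernel is $K(x)=\Omega(x)/|x|^{s+1}$ ($x\neq0$), and for $\delta>0$, $K_\delta(x)=\Omega(x)/\max(\delta,|x|)^{s+1}$. A measure is a nonnegative locally finite Borel measure on $\mathbb{R}^d$. For functions $f,g$ (scalar or $\mathbb{C}^{d'}$-valued), $\langle f,g\rangle_\mu=\int f\cdot g\,d\mu$ (no conjugation). $\mathcal{H}^s$ is $s$-dimensional Hausdorff measure. A measure $\mu$ is $\Lambda$-nice if $\mu(B(x,r))\le\Lambda r^s$ for every ball. For such $\mu$ and $f\in L^2(\mu)$, $T_{\mu,\delta}f(x)=\int K_\delta(x-y)f(y)\,d\mu(y)$.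 $\mu$ is $\Lambda$-good if it is $\Lambda$-nice and $\|T_{\mu,\delta}\|_{L^2(\mu)\to L^2(\mu)}\le\Lambda$ for all $\delta>0$; then $\langle T_\mu f,g\rangle_\mu:=\lim_{\delta\to0}\langle T_{\mu,\delta}f,g\rangle_\mu$ exists for all $f,g\in L^2(\mu)$ and defines a bounded operator $T_\mu$ on $L^2(\mu)$ of norm $\le\Lambda$. For a $\Lambda$-good $\mu$ and a compactly supported Lipschitz $\psi$ with $\int\psi\,d\mu=0$, choose a ball $B\supset\operatorname{supp}\psi$, a point $z\in B$, and $\varphi\in L^2(\mu)$ with $\varphi\equiv1$ on $2B$ (the concentric ball of twice the radius) and $0\le\varphi\le1$, and set $\langle T_\mu(1),\psi\rangle_\mu=\langle T_\mu(\varphi),\psi\rangle_\mu+\int\psi(x)\int(1-\varphi(y))[K(x-y)-K(z-y)]\,d\mu(y)\,d\mu(x)$; this is independent of the choices. A measure $\mu$ is reflectionless (for $T$) if it is $\Lambda$-good for some $\Lambda>0$ and $\langle T_\mu(1),\psi\rangle_\mu=0$ for every compactly supported Lipschitz $\psi$ with $\int\psi\,d\mu=0$. *)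

(* Defs.v *)
From HB Require Import structures.
From mathcomp Require Import all_boot all_algebra.
From mathcomp Require Import all_classical all_reals all_analysis.
From mathcomp Require Import complex.
From mathcomp Require Import order.

Set Implicit Arguments.
Unset Strict Implicit.
Unset Printing Implicit Defensive.

Import Order.TTheory GRing.Theory Num.Theory.
Import numFieldNormedType.Exports.

Local Open Scope classical_set_scope.
Local Open Scope ring_scope.
Local Open Scope complex_scope.

Definition enorm (R : realType) (d : nat) (x : 'rV[R]_d) : R :=
  Num.sqrt (\sum_(i < d) (x ord0 i) ^+ 2).

Definition eball (R : realType) (d : nat) (c : 'rV[R]_d) (r : R) : set 'rV[R]_d :=
  [set y | enorm (y - c) < r].

Definition cabs2 (R : realType) (z : R[i]) : R := (complex.Re z) ^+ 2 + (complex.Im z) ^+ 2.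
Definition cabs (R : realType) (z : R[i]) : R := Num.sqrt (cabs2 z).

Definition cvnorm2 (R : realType) (n : nat) (v : 'rV[R[i]]_n) : R :=
  \sum_(j < n) cabs2 (v ord0 j).
Definition cvnorm (R : realType) (n : nat) (v : 'rV[R[i]]_n) : R :=
  Num.sqrt (cvnorm2 v).

Definition open_sets (R : realType) (d : nat) : set (set 'rV[R]_d) :=
  [set A : set 'rV[R]_d | open A].
Arguments open_sets : clear implicits.
Notation Rd R d := (g_sigma_algebraType (open_sets R d)).

(** A measure: a nonnegative (countably additive) Borel measure on R^d.
    Local finiteness is implied by Lambda-niceness, which is required by
    all the notions below. *)
Notation bmeasure R d := {measure set (Rd R d) -> \bar R}.

Definition is_zero_measure (R : realType) (d : nat) (mu : bmeasure R d) : Prop :=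
  forall A : set (Rd R d), measurable A -> mu A = 0%E.

Definition msupp (R : realType) (d : nat) (mu : bmeasure R d) : set 'rV[R]_d :=
  [set x | forall r : R, 0 < r -> (0 < mu (eball x r))%E].

Definition nice (R : realType) (d : nat) (s : R) (Lam : R) (mu : bmeasure R d) : Prop :=
  forall (x : 'rV[R]_d) (r : R), 0 < r -> (mu (eball x r) <= (Lam * r `^ s)%:E)%E.

Definition cint (R : realType) (d : nat) (mu : bmeasure R d) (f : 'rV[R]_d -> R[i]) : R[i] :=
  (Rintegral mu setT (fun x => complex.Re (f x))) +i* (Rintegral mu setT (fun x => complex.Im (f x))).

Definition cvint (R : realType) (d n : nat) (mu : bmeasure R d)
  (F : 'rV[R]_d -> 'rV[R[i]]_n) : 'rV[R[i]]_n :=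
  \row_(j < n) cint mu (fun x => F x ord0 j).

Definition L2 (R : realType) (d : nat) (mu : bmeasure R d) (f : 'rV[R]_d -> R[i]) : Prop :=
  [/\ measurable_fun setT (fun x : Rd R d => complex.Re (f x)),
      measurable_fun setT (fun x : Rd R d => complex.Im (f x)) &
      (\int[mu]_x ((cabs2 (f x))%:E) < +oo)%E].

Definition CZ_Omega (R : realType) (d d' : nat) (alpha : R)
  (Om : 'rV[R]_d -> 'rV[R[i]]_d') : Prop :=
  [/\ (forall (lam : R) (x : 'rV[R]_d), Om (lam *: x) = (lam%:C) *: Om x),
      (forall x, enorm x = 1 -> cvnorm (Om x) <= 1),
      (forall x x', enorm x = 1 -> enorm x' = 1 ->
          cvnorm (Om x - Om x') <= (enorm (x - x')) `^ alpha) &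
      (forall x, Om (- x) = - Om x)].

(** K(x) = Omega(x)/|x|^{s+1} for x <> 0 (value at 0 irrelevant; set to 0). *)
Definition Kern (R : realType) (d d' : nat) (s : R) (Om : 'rV[R]_d -> 'rV[R[i]]_d')
  (x : 'rV[R]_d) : 'rV[R[i]]_d' :=
  if x == 0 then 0 else ((enorm x `^ (s + 1))^-1)%:C *: Om x.

Definition Kdelta (R : realType) (d d' : nat) (s : R) (Om : 'rV[R]_d -> 'rV[R[i]]_d')
  (delta : R) (x : 'rV[R]_d) : 'rV[R[i]]_d' :=
  ((Num.max delta (enorm x) `^ (s + 1))^-1)%:C *: Om x.

Definition Tdelta (R : realType) (d d' : nat) (s : R) (Om : 'rV[R]_d -> 'rV[R[i]]_d')
  (mu : bmeasure R d) (delta : R) (f : 'rV[R]_d -> R[i]) (x : 'rV[R]_d) : 'rV[R[i]]_d' :=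
  cvint mu (fun y => f y *: Kdelta s Om delta (x - y)).

Definition good (R : realType) (d d' : nat) (s : R) (Om : 'rV[R]_d -> 'rV[R[i]]_d')
  (Lam : R) (mu : bmeasure R d) : Prop :=
  nice s Lam mu /\
  forall (delta : R) (f : 'rV[R]_d -> R[i]), 0 < delta -> L2 mu f ->
    (\int[mu]_x ((cvnorm2 (Tdelta s Om mu delta f x))%:E)
       <= (Lam ^+ 2)%:E * \int[mu]_x ((cabs2 (f x))%:E))%E.

(** <T_{mu,delta} f, g>_mu = \int T_{mu,delta} f . g dmu (no conjugation). *)
Definition pairTdelta (R : realType) (d d' : nat) (s : R) (Om : 'rV[R]_d -> 'rV[R[i]]_d')
  (mu : bmeasure R d) (delta : R) (f g : 'rV[R]_d -> R[i]) : 'rV[R[i]]_d' :=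
  cvint mu (fun x => g x *: Tdelta s Om mu delta f x).

Definition pairT_is (R : realType) (d d' : nat) (s : R) (Om : 'rV[R]_d -> 'rV[R[i]]_d')
  (mu : bmeasure R d) (f g : 'rV[R]_d -> R[i]) (L : 'rV[R[i]]_d') : Prop :=
  forall eps : R, 0 < eps -> exists2 eta : R, 0 < eta &
    forall delta : R, 0 < delta -> delta < eta ->
      cvnorm (pairTdelta s Om mu delta f g - L) < eps.

Definition lip_cs (R : realType) (d : nat) (psi : 'rV[R]_d -> R[i]) : Prop :=
  (exists M : R, forall x y, cabs (psi x - psi y) <= M * enorm (x - y)) /\
  (exists (c : 'rV[R]_d) (r : R), forall x, r <= enorm (x - c) -> psi x = 0).

Definition fsupp (R : realType) (d : nat) (psi : 'rV[R]_d -> R[i]) : set 'rV[R]_d :=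
  closure [set x | psi x != 0].

Definition corr_term (R : realType) (d d' : nat) (s : R) (Om : 'rV[R]_d -> 'rV[R[i]]_d')
  (mu : bmeasure R d) (psi : 'rV[R]_d -> R[i]) (phi : 'rV[R]_d -> R) (z : 'rV[R]_d)
  : 'rV[R[i]]_d' :=
  cvint mu (fun x => psi x *:
    cvint mu (fun y => ((1 - phi y)%:C) *: (Kern s Om (x - y) - Kern s Om (z - y)))).

(** mu is reflectionless: Lambda-good for some Lambda > 0, and
    <T_mu(1), psi>_mu = 0 for every compactly supported Lipschitz psi with
    \int psi dmu = 0, where <T_mu(1),psi>_mu is computed (for any admissible
    choice of B = B(c,r), z, phi) as <T_mu phi, psi>_mu + correction. *)
Definition reflectionless (R : realType) (d d' : nat) (s : R)
  (Om : 'rV[R]_d -> 'rV[R[i]]_d') (mu : bmeasure R d) : Prop :=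
  (exists2 Lam : R, 0 < Lam & good s Om Lam mu) /\
  forall psi : 'rV[R]_d -> R[i], lip_cs psi -> cint mu psi = 0 ->
  forall (c : 'rV[R]_d) (r : R) (z : 'rV[R]_d) (phi : 'rV[R]_d -> R),
    0 < r -> fsupp psi `<=` eball c r -> z \in eball c r ->
    L2 mu (fun y => (phi y)%:C) ->
    (forall y, y \in eball c (2 * r) -> phi y = 1) ->
    (forall y, 0 <= phi y <= 1) ->
    exists L : 'rV[R[i]]_d',
      pairT_is s Om mu (fun y => (phi y)%:C) psi L /\
      L + corr_term s Om mu psi phi z = 0.

Definition ediam (R : realType) (d : nat) (U : set 'rV[R]_d) : R :=
  sup [set t | exists x y, U x /\ U y /\ t = enorm (x - y)].

Definition Hdelta (R : realType) (d : nat) (s delta : R) (E : set 'rV[R]_d) : \bar R :=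
  ereal_inf [set (\sum_(0 <= i <oo) ((ediam (U i)) `^ s)%:E)%E
            | U in [set U : nat -> set 'rV[R]_d |
                     E `<=` \bigcup_i U i /\
                     forall i x y, U i x -> U i y -> enorm (x - y) <= delta]].

Definition hausdorff (R : realType) (d : nat) (s : R) (E : set 'rV[R]_d) : \bar R :=
  ereal_sup [set Hdelta s delta E | delta in [set delta : R | 0 < delta]].

(* Main.v *)
(** Suppose [mu] is nonzero and blow it up at a point [x]: let [mu_j] be the image of
    [r_j^(-s) mu] under [y |-> (y - x) / r_j], with [r_j] tending to 0, and let [nu] be a weak
    limit of the [mu_j].  Finiteness of the Hausdorff measure of the support forces positive
    upper density [mu]-almost everywhere, so [x] and [r_j] can be chosen such that [nu] is
    nonzero; it is nice, and good because the [L^2] bounds pass to the limit.  It remains to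
    see that [nu] is reflectionless, which contradicts the hypothesis.

    For a cutoff [chi] equal to 1 near [x], the functional [l h = lim <T_{mu,eps} chi, h>] is
    bounded on [L^2 mu], hence is given by an [L^2] function.  A Vitali covering argument
    shows that almost every [x] is a Lebesgue point in the sense that [|l psi| = o(r^s)]
    uniformly over the [psi] with mean zero and [|psi| <= 1] supported in [B(x, r)].  After
    rescaling, and because the kernel decays fast enough against functions of mean zero,
    [<T_{nu,delta} phi_M, psi> = O(M^(-alpha)) + O_M(delta)] whenever [psi] is Lipschitz with
    [\int psi dnu = 0] and [phi_M] is the cutoff at scale [M]; the error [O_M(delta)] comes
    from the antisymmetry of the kernel.  Letting [delta] tend to 0 and then [M] to infinity
    gives [<T_nu 1, psi> = 0]. *)
Require Import Defs.
From HB Require Import structures.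
From mathcomp Require Import all_boot all_algebra.
From mathcomp Require Import all_classical all_reals all_analysis.
From mathcomp Require Import complex.
From mathcomp Require Import order.
From mathcomp Require Import measurable_realfun.
From mathcomp Require Import ring lra.
Set Implicit Arguments.
Unset Strict Implicit.
Unset Printing Implicit Defensive.
Import Order.TTheory GRing.Theory Num.Theory.
Import numFieldNormedType.Exports.
Local Open Scope classical_set_scope.
Local Open Scope ring_scope.

(** * Euclidean topology *)

(** Nothing makes [mu] doubling, so smallness is measured against [r ^ s] and not against the mass
    of [B(x, r)]: the growth bound then pays for the threefold dilation in the covering argument,
    and duality bounds the sum of [r ^ s] over disjoint bad balls. The [L^2] representative of [l]
    is replaced by near-minimizers in [Cc]. They are continuous, so differentiation at [x] is plain
    continuity, and only a remainder of small norm needs the covering argument. Limits are taken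
    along ultrafilters on [nat], which give a linear functional on all test functions at once; the
    limit measure is then built from that functional. A function of mean zero for [nu] is only
    almost of mean zero for [mu_j]; it is corrected by a small multiple of a fixed bump, whose mass
    stays bounded below. The complex vector kernel is treated as [2 d'] odd real kernels. *)

Section euclid.
Context (R : realType) (d : nat).
Local Notation V := 'rV[R]_d.
Implicit Types x y z : V.

Lemma enorm_ge0 x : 0 <= enorm x.
Proof. exact: sqrtr_ge0. Qed.

Lemma enorm_sqr x : enorm x ^+ 2 = \sum_(i < d) (x ord0 i) ^+ 2.
Proof. by rewrite sqr_sqrtr// sumr_ge0// => i _; rewrite sqr_ge0. Qed.

Lemma enorm0 : enorm (0 : V) = 0.
Proof. by rewrite /enorm big1 ?sqrtr0// => i _; rewrite mxE expr0n. Qed.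

Lemma coord_le_enorm x i : `|x ord0 i| <= enorm x.
Proof.
rewrite -sqrtr_sqr ler_wsqrtr// (bigD1 i)//= lerDl sumr_ge0// => j _.
by rewrite sqr_ge0.
Qed.

Lemma enorm_eq0 x : enorm x = 0 -> x = 0.
Proof.
move=> x0; apply/rowP => i; rewrite mxE; apply/eqP; rewrite -normr_eq0.
by rewrite eq_le normr_ge0 andbT -x0 coord_le_enorm.
Qed.

Lemma enorm_gt0 x : x != 0 -> 0 < enorm x.
Proof.
move=> x0; rewrite lt_def enorm_ge0 andbT; apply: contra x0 => /eqP h.
exact/eqP/enorm_eq0.
Qed.

Lemma enormZ a x : enorm (a *: x) = `|a| * enorm x.
Proof.
rewrite /enorm -sqrtr_sqr -sqrtrM ?sqr_ge0// mulr_sumr.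
by congr Num.sqrt; apply: eq_bigr => i _; rewrite mxE exprMn.
Qed.

Lemma enormN x : enorm (- x) = enorm x.
Proof. by rewrite -scaleN1r enormZ normrN1 mul1r. Qed.

Lemma enormB x y : enorm (x - y) = enorm (y - x).
Proof. by rewrite -enormN opprB. Qed.

Lemma inner_le_enorm x y :
  \sum_(i < d) x ord0 i * y ord0 i <= enorm x * enorm y.
Proof.
set a := enorm x; set b := enorm y.
have [/eqP a0|a0] := boolP (a == 0).
  by rewrite (enorm_eq0 a0) a0 mul0r big1// => i _; rewrite mxE mul0r.
have [/eqP b0|b0] := boolP (b == 0).
  by rewrite (enorm_eq0 b0) b0 mulr0 big1// => i _; rewrite mxE mulr0.
have ab : 0 < a * b.
  by rewrite mulr_gt0// lt_def ?a0 ?b0 enorm_ge0.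
have : 0 <= \sum_(i < d) (b * x ord0 i - a * y ord0 i) ^+ 2.
  by apply: sumr_ge0 => i _; rewrite sqr_ge0.
under eq_bigr => i _.
  rewrite (_ : _ ^+ 2 = b ^+ 2 * x ord0 i ^+ 2 + a ^+ 2 * y ord0 i ^+ 2
     + (- (2 * (a * b))) * (x ord0 i * y ord0 i)); last by ring.
  over.
rewrite !big_split/= -!mulr_sumr -!enorm_sqr -/a -/b => h.
have {}h : 0 <= (a * b) * (a * b - \sum_(i < d) x ord0 i * y ord0 i) by nra.
by rewrite pmulr_rge0// subr_ge0 in h.
Qed.

Lemma ler_enormD x y : enorm (x + y) <= enorm x + enorm y.
Proof.
rewrite -(@ler_pXn2r _ 2)// ?nnegrE ?addr_ge0 ?enorm_ge0// enorm_sqr.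
under eq_bigr => i _.
  rewrite mxE (_ : _ ^+ 2 = x ord0 i ^+ 2 + y ord0 i ^+ 2
     + 2 * (x ord0 i * y ord0 i)); last by ring.
  over.
rewrite !big_split/= -!mulr_sumr -!enorm_sqr.
have := inner_le_enorm x y; nra.
Qed.

Lemma enorm_triangle z x y : enorm (x - y) <= enorm (x - z) + enorm (z - y).
Proof. by rewrite -[x - y](subrKA z) ler_enormD. Qed.

Lemma enorm_dist x y : `|enorm x - enorm y| <= enorm (x - y).
Proof.
rewrite ler_norml; have h1 := ler_enormD (x - y) y.
have h2 := ler_enormD (y - x) x; rewrite !subrK (enormB y x) in h1 h2.
by lra.
Qed.

Lemma enorm_le_sum x : enorm x <= \sum_(i < d) `|x ord0 i|.
Proof.
rewrite -(@ler_pXn2r _ 2)// ?nnegrE ?enorm_ge0 ?sumr_ge0// enorm_sqr.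
suff: 0 <= \sum_(i < d) `|x ord0 i| /\
    \sum_(i < d) x ord0 i ^+ 2 <= (\sum_(i < d) `|x ord0 i|) ^+ 2 by case.
elim/big_ind2 : _ => [|b b' a a' [h1 h2] [h3 h4]|i _].
- by rewrite expr0n.
- by rewrite addr_ge0//; split=> //; rewrite sqrrD; nra.
- by rewrite real_normK// num_real.
Qed.

(** The topology of ['rV[R]_d] comes from the sup norm; this equivalence lets the later arguments
    work with Euclidean balls. *)
Lemma nbhs_eballP x (A : set V) :
  nbhs x A <-> exists2 r : R, 0 < r & eball x r `<=` A.
Proof.
split=> [/nbhs_ballP[e /= e0 eA]|[r r0 rA]].
  exists e => // y xy; apply: eA => //=; split=> // i j; rewrite (ord1 i).
  rewrite /ball/= distrC.
  have := coord_le_enorm (y - x) j; rewrite !mxE => /le_lt_trans; exact.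
(* Dividing by [d.+1], and not by [d], makes the sum of the [d] coordinates strictly smaller than
   [r] and covers [d = 0]. *)
apply/nbhs_ballP; exists (r / (d.+1)%:R) => /=; first by rewrite divr_gt0.
move=> y xy; apply: rA => /=.
apply: (le_lt_trans (enorm_le_sum _)).
apply: (@le_lt_trans _ _ (\sum_(i < d) (r / d.+1%:R))).
  apply: ler_sum => i _; rewrite !mxE distrC ltW//.
  by case: xy => [_] /(_ ord0 i).
rewrite sumr_const card_ord -[ltLHS]mulr_natr -mulrA.
rewrite -[ltRHS]mulr1 ltr_pM2l// mulrC ltr_pdivrMr// mul1r ltr_nat.
exact: ltnSn.
Qed.

Lemma open_eball x (r : R) : open (eball x r).
Proof.
suff h y : enorm (y - x) < r -> nbhs y (eball x r).
  by rewrite openE => y; exact: h.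
move=> yr.
apply/nbhs_eballP; exists (r - enorm (y - x)); first by rewrite subr_gt0.
move=> z; rewrite /eball/= => zy; have := enorm_triangle y z x; lra.
Qed.

Lemma continuous_enormP (f : V -> R) : continuous f <->
  forall x (e : R), 0 < e -> exists2 r : R, 0 < r &
    forall y, enorm (y - x) < r -> `|f y - f x| < e.
Proof.
split=> [cf x e e0|h]; last suff : forall x : V, f @ x --> f x by []; last move=> x.
  have /cvgrPdist_lt/(_ _ e0)/nbhs_eballP[r r0 rA] := cf x.
  by exists r => // y /rA /=; rewrite distrC.
apply/(@cvgrPdist_lt _ _ _ _ (nbhs_filter x)) => e e0; apply/nbhs_eballP.
have [r r0 rh] := h x e e0; exists r => // y /rh; by rewrite distrC.
Qed.

Lemma contD (f g : V -> R) : continuous f -> continuous g ->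
  continuous (fun x => f x + g x).
Proof.
by move=> cf cg x; exact: (@cvgD R R V (nbhs x) (nbhs_filter x) f g _ _ (cf x) (cg x)).
Qed.

Lemma contN (f : V -> R) : continuous f -> continuous (fun x => - f x).
Proof.
by move=> cf x; exact: (@cvgN R R V (nbhs x) (nbhs_filter x) f _ (cf x)).
Qed.

Lemma contB (f g : V -> R) : continuous f -> continuous g ->
  continuous (fun x => f x - g x).
Proof. by move=> cf cg; apply: contD => //; exact: contN. Qed.

Lemma contM (f g : V -> R) : continuous f -> continuous g ->
  continuous (fun x => f x * g x).
Proof.
by move=> cf cg x; exact: (@cvgM R V (nbhs x) (nbhs_filter x) f g _ _ (cf x) (cg x)).
Qed.

Lemma cont_cst (a : R) : continuous (fun _ : V => a).
Proof.
by apply/continuous_enormP => x e e0; exists 1 => // y _; rewrite subrr normr0.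
Qed.

Lemma contZ (a : R) (f : V -> R) : continuous f -> continuous (fun x => a * f x).
Proof. by apply: contM; exact: cont_cst. Qed.

Lemma cont_norm (f : V -> R) : continuous f -> continuous (fun x => `|f x|).
Proof.
move=> /continuous_enormP cf; apply/continuous_enormP => x e e0.
have [r r0 h] := cf x e e0; exists r => // y /h; apply: le_lt_trans.
exact: ler_dist_dist.
Qed.

Lemma cont_max (f g : V -> R) : continuous f -> continuous g ->
  continuous (fun x => Num.max (f x) (g x)).
Proof.
move=> cf cg.
rewrite (_ : (fun x => _) = fun x => 2^-1 * ((f x + g x) + `|f x - g x|)).
  by apply: contZ; apply: contD; [exact: contD|apply: cont_norm; exact: contB].
apply/funext => x; rewrite maxEle; case: leP => h.
  by rewrite ler0_norm ?subr_le0//; field.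
by rewrite gtr0_norm ?subr_gt0//; field.
Qed.

Lemma cont_min (f g : V -> R) : continuous f -> continuous g ->
  continuous (fun x => Num.min (f x) (g x)).
Proof.
move=> cf cg.
rewrite (_ : (fun x => _) = fun x => - Num.max (- f x) (- g x)).
  by apply/contN/cont_max; exact: contN.
by apply/funext => x; rewrite -oppr_min opprK.
Qed.

Lemma cont_sum (I : Type) (r : seq I) (F : I -> V -> R) :
  (forall i, continuous (F i)) -> continuous (fun x => \sum_(i <- r) F i x).
Proof.
move=> cF; elim: r => [|i r ih].
  by under eq_fun do rewrite big_nil; exact: cont_cst.
by under eq_fun do rewrite big_cons; exact: contD.
Qed.

Lemma cont_comp (g : R -> R) (f : V -> R) : continuous f ->
  (forall x, {for f x, continuous g}) -> continuous (fun x => g (f x)).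
Proof. by move=> cf cg x; apply: (@continuous_comp V R R f g x); [exact: cf|exact: cg]. Qed.

Lemma continuous_enormB z : continuous (fun x : V => enorm (x - z)).
Proof.
apply/continuous_enormP => x e e0; exists e => // y ye.
apply: le_lt_trans ye; apply: (le_trans (enorm_dist _ _)).
by rewrite opprB addrA subrK.
Qed.

Lemma continuous_enorm : continuous (@enorm R d).
Proof.
apply/continuous_enormP => x e e0; exists e => // y ye.
exact: le_lt_trans (enorm_dist _ _) ye.
Qed.

Lemma compact_eball_closed (N : R) (A : set V) : closed A ->
  (forall x, A x -> enorm x <= N) -> compact A.
Proof.
move=> cA AN; apply: bounded_closed_compact => //.
exists N; split; first exact: num_real.
move=> M NM x Ax; apply: le_trans (ltW NM); apply: le_trans (AN x Ax).
rewrite [leLHS]mx_normrE; apply/bigmax_leP; split; first exact: enorm_ge0.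
by move=> [i j] _ /=; rewrite (ord1 i); exact: coord_le_enorm.
Qed.

Definition ratvec (q : 'rV[rat]_d) : V := map_mx (@ratr R) q.

Lemma ratvec_dense x (e : R) : 0 < e -> exists q, enorm (x - ratvec q) < e.
Proof.
move=> e0.
have h i : exists q : rat, `|x ord0 i - ratr q| < e / d.+1%:R.
  have ed : 0 < e / d.+1%:R by rewrite divr_gt0.
  move: (e / d.+1%:R) ed => b b0.
  have [|q] := @rat_in_itvoo R (x ord0 i - b) (x ord0 i + b); first by lra.
  rewrite in_itv/= => hq; exists q; rewrite ltr_norml; lra.
have {h} [q hq] := choice h.
exists (\row_i q i); apply: (le_lt_trans (enorm_le_sum _)).
apply: (@le_lt_trans _ _ (\sum_(i < d) (e / d.+1%:R))).
  by apply: ler_sum => i _; rewrite !mxE ltW//.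
rewrite sumr_const card_ord -[ltLHS]mulr_natr -mulrA.
rewrite -[ltRHS]mulr1 ltr_pM2l// mulrC ltr_pdivrMr// mul1r ltr_nat.
exact: ltnSn.
Qed.

End euclid.

(** * Borel sets and real integrals *)

Section borel.
Context (R : realType) (d : nat).
Local Notation V := 'rV[R]_d.
Local Notation X := (Rd R d).

Lemma open_measurable_Rd (A : set V) : open A -> measurable (A : set X).
Proof. by move=> oA; apply: sub_sigma_algebra. Qed.

Lemma measurable_eball (x : V) (r : R) : measurable (eball x r : set X).
Proof. by apply: open_measurable_Rd; exact: open_eball. Qed.

Lemma continuous_measurable_Rd (f : V -> R) :
  continuous f -> measurable_fun setT (f : X -> R).
Proof.
move=> /continuousP cf; apply: (measurability _ (RGenOpens.measurableE R)).
move=> _ [_ [a [b ->] <-]]; rewrite setTI; apply: open_measurable_Rd.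
exact/cf/interval_open.
Qed.

Lemma continuous_measurable_RdRd (f : V -> V) :
  continuous f -> measurable_fun setT (f : X -> X).
Proof.
move=> /continuousP cf.
apply: (@measurability _ _ X X setT f (open_sets R d) erefl).
move=> _ [A oA <-]; rewrite setTI; apply: open_measurable_Rd; exact: cf.
Qed.

Lemma rational_ball_nbhs (x : V) (r : R) : 0 < r ->
  exists (q : 'rV[rat]_d) (m : nat), eball (ratvec R q) m.+1%:R^-1 x /\
    eball (ratvec R q) m.+1%:R^-1 `<=` eball x r.
Proof.
move=> r0; have r20 : 0 < r / 2 by rewrite divr_gt0.
have [m hm] : exists m : nat, m.+1%:R^-1 < r / 2.
  exists (Num.truncn (2 / r)); rewrite invf_plt ?posrE//.
  by rewrite invf_div truncnS_gt.
have m0 : 0 < m.+1%:R^-1 :> R by rewrite invr_gt0.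
suff [q [h1 h2]] : exists q, eball (ratvec R q) m.+1%:R^-1 x /\
    eball (ratvec R q) m.+1%:R^-1 `<=` eball x r by exists q, m.
move: m.+1%:R^-1 hm m0 => t hm m0.
have [q hq] := ratvec_dense x m0.
exists q; split; first by [].
move=> y; rewrite /eball/= => yq.
have := enorm_triangle (ratvec R q) y x; rewrite (enormB (ratvec R q) x); lra.
Qed.

(* The open sets in question are unions of rational balls; picking one member of
   the family above each rational ball contained in it gives a countable subfamily. *)
Lemma lindelof (I : Type) (D : set I) (O : I -> set V) :
  (forall i, D i -> open (O i)) ->
  exists E : nat -> set V,
    (forall n, E n = set0 \/ exists2 i, D i & E n = O i) /\
    \bigcup_(i in D) O i = \bigcup_n E n.
Proof.
move=> oO.
pose P (q : 'rV[rat]_d) (m : nat) i :=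
  D i /\ eball (ratvec R q) m.+1%:R^-1 `<=` O i.
pose E n := if (unpickle n : option ('rV[rat]_d * nat)%type) is Some qm then
    if pselect (exists i, P qm.1 qm.2 i) is left h then O (projT1 (cid h))
    else set0 else set0.
exists E; split.
  move=> n; rewrite /E; case: unpickle => [qm|]; last by left.
  case: pselect => [h|]; last by left.
  by right; exists (projT1 (cid h)) => //; case: (cid h) => i [].
apply/seteqP; split=> x.
  move=> [i Di Oix].
  have /nbhs_eballP[r r0 rO] : nbhs x (O i) by apply: open_nbhs_nbhs; split=> //; exact: oO.
  have [q [m [xq qr]]] := rational_ball_nbhs x r0.
  exists (pickle (q, m)) => //; rewrite /E pickleK/=.
  case: pselect => [h|h].
    by case: (cid h) => j [/= _]; apply.
  by exfalso; apply: h; exists i; split=> // y /qr /rO.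
move=> [n _]; rewrite /E; case: unpickle => [qm|//].
by case: pselect => [h|//]; case: (cid h) => i [/= Di _] Oi; exists i.
Qed.

(** An open subset of the product is a union of rational rectangles [C], and there are only
    countably many of these. *)
Lemma open_prod_measurable (A : set (V * V)) :
  (forall p, A p -> exists2 r : R, 0 < r &
     forall x y, enorm (x - p.1) < r -> enorm (y - p.2) < r -> A (x, y)) ->
  measurable (A : set (X * X)%type).
Proof.
move=> oA.
pose E n : set (X * X) :=
  if (unpickle n : option ('rV[rat]_d * 'rV[rat]_d * (nat * nat))%type)
    is Some (q, q', (m, m')) then
    let C := (eball (ratvec R q) m.+1%:R^-1 `*` eball (ratvec R q') m'.+1%:R^-1) in
    if pselect (C `<=` A) is left _ then C else set0 else set0.
rewrite (_ : A = \bigcup_n E n).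
  apply: bigcup_measurable => n _; rewrite /E.
  case: unpickle => [[[q q'] [m m']]|//] /=; case: pselect => // _.
  by apply: measurableX; exact: measurable_eball.
apply/seteqP; split=> p.
  move=> Ap; have [r r0 rA] := oA p Ap.
  have [q [m [xq qr]]] := rational_ball_nbhs p.1 r0.
  have [q' [m' [yq qr']]] := rational_ball_nbhs p.2 r0.
  exists (pickle ((q, q'), (m, m'))) => //; rewrite /E pickleK/=.
  case: pselect => [h|h]; first by split.
  exfalso; apply: h => -[x y] [/= /qr hx /qr' hy]; exact: rA.
move=> [n _]; rewrite /E; case: unpickle => [[[q q'] [m m']]|//] /=.
by case: pselect => // h hp; exact: h.
Qed.

Lemma joint_continuous_measurable (F : V -> V -> R) :
  (forall x y (e : R), 0 < e -> exists2 r : R, 0 < r &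
     forall x' y', enorm (x' - x) < r -> enorm (y' - y) < r ->
       `|F x' y' - F x y| < e) ->
  measurable_fun setT (fun p : X * X => F p.1 p.2).
Proof.
move=> cF; apply: (measurability _ (RGenOpens.measurableE R)).
move=> _ [_ [a [b ->] <-]]; rewrite setTI.
apply: open_prod_measurable => -[x y] /=; rewrite in_itv/= => /andP[aF Fb].
pose e := Num.min (F x y - a) (b - F x y).
have e0 : 0 < e by rewrite lt_min !subr_gt0 aF.
have [r r0 rF] := cF x y e e0; exists r => // x' y' hx hy.
have := rF x' y' hx hy; rewrite /e lt_min => /andP[].
rewrite !ltr_norml => /andP[h1 _] /andP[_ h2]; rewrite in_itv/=; lra.
Qed.

End borel.

Section real_integral.
Context {dd : measure_display} {T : measurableType dd} {R : realType}.
Variable mu : {measure set T -> \bar R}.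
Implicit Types f g : T -> R.

Definition intg f := mu.-integrable setT (EFin \o f).

Lemma intg_measurable f : intg f -> measurable_fun setT f.
Proof. by move=> /integrableP[/measurable_EFinP]. Qed.

Lemma intg_le f g : measurable_fun setT f -> intg g ->
  (forall x, `|f x| <= g x) -> intg f.
Proof.
move=> mf ig fg; apply: le_integrable ig => //; first exact/measurable_EFinP.
by move=> x _ /=; rewrite lee_fin (le_trans (fg x))// ler_norm.
Qed.

Lemma intgD f g : intg f -> intg g -> intg (fun x => f x + g x).
Proof. by move=> h1 h2; have := integrableD measurableT h1 h2. Qed.

Lemma intgB f g : intg f -> intg g -> intg (fun x => f x - g x).
Proof. by move=> h1 h2; have := integrableB measurableT h1 h2. Qed.

Lemma intgZ (k : R) f : intg f -> intg (fun x => k * f x).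
Proof. by move=> h1; have := integrableZl measurableT k h1. Qed.

Lemma intg_norm f : intg f -> intg (fun x => `|f x|).
Proof. by move=> h1; have := integrable_norm h1. Qed.

Lemma intg_sum (I : Type) (s : seq I) (F : I -> T -> R) :
  (forall i, intg (F i)) -> intg (fun x => \sum_(i <- s) F i x).
Proof.
move=> h; elim: s => [|i s ih].
  rewrite (_ : (fun x => _) = cst 0); first exact: integrable0.
  by apply/funext => x; rewrite big_nil.
rewrite (_ : (fun x => _) = (fun x => F i x + \sum_(i <- s) F i x)).
  exact: intgD.
by apply/funext => x; rewrite big_cons.
Qed.

Lemma Rintegral_sum (I : Type) (s : seq I) (F : I -> T -> R) :
  (forall i, intg (F i)) ->
  \int[mu]_x (\sum_(i <- s) F i x) = \sum_(i <- s) \int[mu]_x F i x.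
Proof.
move=> h; elim: s => [|i s ih].
  under eq_Rintegral do rewrite big_nil.
  by rewrite Rintegral_cst// mul0r big_nil.
under eq_Rintegral do rewrite big_cons.
by rewrite RintegralD ?ih ?big_cons//; [exact: h|have := intg_sum s h].
Qed.

Lemma intg_ge0 f (c : R) : measurable_fun setT f -> (forall x, 0 <= f x) ->
  (\int[mu]_x (f x)%:E <= c%:E)%E -> intg f /\ \int[mu]_x f x <= c.
Proof.
move=> mf f0 fc.
have jf : intg f.
  apply/integrableP; split; first exact/measurable_EFinP.
  apply: le_lt_trans (ltry c); apply: le_trans fc.
  by under eq_integral do rewrite /= ger0_norm//.
split=> //; rewrite -lee_fin /Rintegral fineK//; exact: integrable_fin_num.
Qed.

Lemma EFin_Rintegral f : intg f ->
  (\int[mu]_x f x)%:E = (\int[mu]_x (f x)%:E)%E.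
Proof. by move=> jf; rewrite /Rintegral fineK//; exact: integrable_fin_num. Qed.

End real_integral.

(** * Integrals against nice measures *)

(** The alias takes the proof of sigma-finiteness as an argument, so that the structure needed by
    Fubini can be attached to a measure whose sigma-finiteness is only a hypothesis. *)
Definition sfin_measure {dd : measure_display} {T : measurableType dd}
  {R : realType} (mu : {measure set T -> \bar R})
  of sigma_finite setT mu : set T -> \bar R := mu.

Section fubini_real.
Context {dd : measure_display} {T : measurableType dd} {R : realType}.
Variable mu : {measure set T -> \bar R}.
Hypothesis smu : sigma_finite setT mu.

HB.instance Definition _ := Measure.copy (sfin_measure smu) mu.
HB.instance Definition _ :=
  Measure_isSigmaFinite.Build _ _ _ (sfin_measure smu) smu.

Let m : {sigma_finite_measure set T -> \bar R} := sfin_measure smu.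

Variables (F : T -> T -> R) (G : T -> R).
Hypothesis mF : measurable_fun setT (fun p : T * T => F p.1 p.2).
Hypothesis iF : forall x, intg mu (F x).
Hypothesis iG : intg mu G.
Hypothesis FG : forall x, \int[mu]_y `|F x y| <= G x.

Let f (p : T * T) := (F p.1 p.2)%:E.

Let mf : measurable_fun setT f.
Proof. exact/measurable_EFinP. Qed.

Let int_f : (m \x m)%E.-integrable setT f.
Proof.
apply/(integrable12ltyP m m mf).
have /integrableP[mG /(le_lt_trans _)] := iG; apply.
apply: ge0_le_integral => //.
- by move=> x _; apply: integral_ge0.
- apply: (measurable_fun_fubini_tonelli_F (abse \o f)) => //.
  exact: measurableT_comp.
- by move=> p; exact: abse_ge0.
- exact: measurableT_comp.
- move=> x _ /=; apply: (@le_trans _ _ (G x)%:E); last by rewrite lee_fin ler_norm.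
  apply: (@le_trans _ _ (\int[mu]_y `|F x y|)%:E); last by rewrite lee_fin.
  by rewrite EFin_Rintegral//; exact: intg_norm.
Qed.

Lemma fubini_intg : intg mu (fun x => \int[mu]_y F x y).
Proof.
have := integrable_fubini_F int_f; rewrite /intg => h.
rewrite (_ : _ \o _ = fubini_F m f)//.
by apply/funext => x /=; rewrite EFin_Rintegral.
Qed.

Hypothesis iF' : forall y, intg mu (F^~ y).

Lemma fubini_swap : \int[mu]_x (\int[mu]_y F x y) = \int[mu]_y (\int[mu]_x F x y).
Proof.
have := Fubini int_f; rewrite /Rintegral => h.
congr fine; transitivity (\int[m]_x \int[m]_y f (x, y))%E.
  by apply: eq_integral => x _; rewrite -EFin_Rintegral.
by rewrite h; apply: eq_integral => x _; rewrite -EFin_Rintegral//; exact: iF'.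
Qed.

End fubini_real.

Section dyadic.
Context {R : realType}.

Lemma dyadic_floor (t : R) : 1 <= t -> exists k : nat, 2 ^+ k <= t < 2 ^+ k.+1.
Proof.
move=> t1.
have ex : exists n : nat, t < 2 ^+ n.
  exists (Num.truncn t).+1; apply: (lt_le_trans (truncnS_gt _)).
  by rewrite -natrX ler_nat ltnW// ltn_expl.
case: (ex_minnP ex) => -[|k] tk kmin; first by rewrite expr0 ltNge t1 in tk.
exists k; rewrite tk andbT leNgt; apply/negP => h.
by have := kmin _ h; rewrite ltnn.
Qed.

Lemma geometric_sum_le (c q : R) n : 0 <= c -> 0 <= q < 1 ->
  \sum_(0 <= k < n) c * q ^+ k <= c / (1 - q).
Proof.
move=> c0 /andP[q0 q1]; rewrite -mulr_sumr ler_wpM2l//.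
have q10 : 0 < 1 - q by rewrite subr_gt0.
rewrite -[leRHS]mul1r ler_pdivlMr//.
suff -> : (\sum_(0 <= k < n) q ^+ k) * (1 - q) = 1 - q ^+ n.
  by rewrite lerBlDr lerDl exprn_ge0.
elim: n => [|n ih]; first by rewrite big_geq// mul0r expr0 subrr.
by rewrite big_nat_recr//= mulrDl ih exprS; ring.
Qed.

End dyadic.

Section nice_measure.
Context (R : realType) (d : nat).
Local Notation V := 'rV[R]_d.
Local Notation X := (Rd R d).
Variables (s Lam : R) (mu : bmeasure R d).
Hypothesis Lam0 : 0 < Lam.
Hypothesis nmu : nice s Lam mu.

Lemma nice_lty (x : V) (r : R) : (mu (eball x r) < +oo)%E.
Proof.
have [r0|r0] := ltP 0 r; first exact: le_lt_trans (nmu x r0) (ltry _).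
rewrite (_ : eball x r = set0) ?measure0//.
apply/seteqP; split=> // y; rewrite /eball/= => h.
by have := enorm_ge0 (y - x); rewrite leNgt (lt_le_trans h).
Qed.

Lemma nice_sigma_finite : sigma_finite setT mu.
Proof.
exists (fun n => eball (0 : V) n%:R) => [|n].
  apply/seteqP; split=> // x _; exists (Num.truncn (enorm x)).+1 => //.
  by rewrite /eball/= subr0 truncnS_gt.
by split; [exact: measurable_eball|exact: nice_lty].
Qed.

Lemma intg_bounded (f : V -> R) (M : R) (c : V) (r : R) :
  0 < r -> measurable_fun setT (f : X -> R) ->
  (forall x, `|f x| <= M) -> (forall x, ~ eball c r x -> f x = 0) ->
  intg mu f /\ \int[mu]_x `|f x| <= M * (Lam * r `^ s).
Proof.
move=> r0 mf fM fr.
have M0 : 0 <= M by apply: le_trans (fM 0).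
have h : (\int[mu]_x (`|f x|)%:E <= (M * (Lam * r `^ s))%:E)%E.
  apply: (@le_trans _ _ (\int[mu]_x (M * \1_(eball c r : set X) x)%:E)%E).
    apply: ge0_le_integral => //.
    - by apply/measurable_EFinP/measurableT_comp.
    - apply/measurable_EFinP; apply: measurable_funM => //.
      by apply: measurable_indic; exact: measurable_eball.
    - move=> x _; rewrite lee_fin indicE.
      have [h|h] := boolP (x \in eball c r); first by rewrite mulr1.
      by rewrite mulr0 fr ?normr0//; move/negP: h; rewrite inE.
  under eq_integral do rewrite EFinM.
  rewrite ge0_integralZl//=; last first.
    by apply/measurable_EFinP; apply: measurable_indic; exact: measurable_eball.
  rewrite integral_indic//; last exact: measurable_eball.
  by rewrite setIT EFinM lee_wpmul2l ?lee_fin//; exact: nmu.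
have mnf : measurable_fun setT (fun x : X => `|f x|) by exact: measurableT_comp.
have [inf nf] := intg_ge0 mnf (fun x => normr_ge0 _) h.
by split=> //; apply: intg_le inf _ => //.
Qed.

(** [F] is dominated by the sum of [m k] times the indicator of the ball of radius [rho k]; by the
    growth bound the integrals of these terms form at most a geometric series. The far and the near
    kernel estimates are both instances. *)
Lemma intg_shells (F : V -> R) (x : V) (rho m : nat -> R) (c q : R) :
  measurable_fun setT (F : X -> R) -> (forall k, 0 < rho k) ->
  (forall k, 0 <= m k) -> 0 <= c -> 0 <= q < 1 ->
  (forall k, m k * (Lam * rho k `^ s) <= c * q ^+ k) ->
  (forall y, F y != 0 -> exists k, eball x (rho k) y /\ `|F y| <= m k) ->
  intg mu F /\ \int[mu]_y `|F y| <= c / (1 - q).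
Proof.
move=> mF rho0 m0 c0 q01 mc FE.
have h : (\int[mu]_y (`|F y|)%:E <= (c / (1 - q))%:E)%E.
  pose g k (y : X) := (m k * \1_(eball x (rho k) : set X) y)%:E.
  have g0 k y : (0 <= g k y)%E by rewrite lee_fin mulr_ge0.
  have mg k : measurable_fun setT (g k).
    apply/measurable_EFinP; apply: measurable_funM => //.
    by apply: measurable_indic; exact: measurable_eball.
  apply: (@le_trans _ _ (\int[mu]_y (\sum_(k <oo) g k y))%E).
    apply: ge0_le_integral => //.
    - by apply/measurable_EFinP/measurableT_comp.
    - by apply: ge0_emeasurable_sum => // k y _ _; exact: g0.
    - move=> y _; have [F0|F0] := eqVneq (F y) 0.
        by rewrite F0 normr0; apply: nneseries_ge0 => k _ _; exact: g0.
      have [k [yk Fk]] := FE y F0.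
      apply: (@le_trans _ _ (g k y)).
        by rewrite lee_fin indicE mem_set// mulr1.
      rewrite (@nneseriesD1 _ _ k xpredT)// ?leeDl//.
      by apply: nneseries_ge0 => j _ _; exact: g0.
  rewrite integral_nneseries//.
  apply: lime_le; first by apply: is_cvg_nneseries => k _ _; apply: integral_ge0 => y _; exact: g0.
  apply: nearW => n.
  apply: (@le_trans _ _ (\sum_(0 <= k < n) c * q ^+ k)%:E); last first.
    by rewrite lee_fin; exact: geometric_sum_le.
  rewrite -sumEFin; apply: lee_sum => k _; rewrite /g.
  under eq_integral do rewrite EFinM.
  rewrite ge0_integralZl//=; last 2 first.
  - by apply/measurable_EFinP; apply: measurable_indic; exact: measurable_eball.
  - by rewrite lee_fin.
  rewrite integral_indic//; last exact: measurable_eball.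
  rewrite setIT; apply: (@le_trans _ _ (m k * (Lam * rho k `^ s))%:E); last by rewrite lee_fin.
  by rewrite EFinM lee_wpmul2l ?lee_fin//; exact: nmu.
have mnf : measurable_fun setT (fun x : X => `|F x|) by exact: measurableT_comp.
have [inf nf] := intg_ge0 mnf (fun x => normr_ge0 _) h.
by split=> //; apply: intg_le inf _ => //.
Qed.

Definition Cfar (b : R) := Lam * 2 `^ s / (1 - 2 `^ (- b)).

Lemma Cfar_ge0 b : 0 < b -> 0 <= Cfar b.
Proof.
move=> b0; rewrite divr_ge0 ?mulr_ge0 ?powR_ge0 ?(ltW Lam0)// subr_ge0.
rewrite powRN invf_le1 ?powR_gt0//.
by have := @ler_powR R 2 ltac:(lra) 0 b (ltW b0); rewrite powRr0.
Qed.

(** Dyadic shells going outwards: each step gains a factor [2^(-b)] of decay over the growth of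
    [mu], which produces the denominator of [Cfar]. *)
Lemma intg_far (F : V -> R) (x : V) (A b rho : R) :
  measurable_fun setT (F : X -> R) -> 0 <= A -> 0 < b -> 0 < rho -> 0 < s ->
  (forall y, `|F y| <= A * Num.max rho (enorm (y - x)) `^ (- (s + b))) ->
  intg mu F /\ \int[mu]_y `|F y| <= A * (Cfar b * rho `^ (- b)).
Proof.
move=> mF A0 b0 r0 s0 FA.
have p2 k : 0 < 2 ^+ k * rho by rewrite mulr_gt0// exprn_gt0.
have q1 : 2 `^ (- b) < 1 :> R.
  rewrite powRN invf_lt1 ?powR_gt0//.
  by have := @gt0_ltr_powR R b b0 1 2; rewrite powR1; apply; rewrite ?nnegrE//; lra.
have [|k|||k|y Fy|iF FI] := @intg_shells F x (fun k => 2 ^+ k.+1 * rho)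
    (fun k => A * (2 ^+ k * rho) `^ (- (s + b)))
    (A * (Lam * 2 `^ s * rho `^ (- b))) (2 `^ (- b)) mF.
- by move=> k; exact: p2.
- by rewrite mulr_ge0// powR_ge0.
- by rewrite !mulr_ge0// ?powR_ge0// ltW.
- by rewrite powR_ge0.
- rewrite exprS -(mulrA 2) (@powRM _ 2)// ?(ltW (p2 _))//.
  rewrite opprD powRD; last by rewrite (gt_eqF (p2 k)) implybT.
  rewrite (@powRM _ _ _ (- b))//; last exact: ltW.
  have -> : (2 ^+ k) `^ (- b) = (2 `^ (- b)) ^+ k :> R.
    by rewrite -!powR_mulrn ?powR_ge0// -!powRrM mulrC.
  rewrite (powRN _ s); have := powR_gt0 s (p2 k).
  move: ((2 ^+ k * rho) `^ s) (2 `^ (- b) ^+ k) => z t z0.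
  by rewrite le_eqVlt; apply/orP; left; apply/eqP; field; rewrite gt_eqF.
- have := FA y; set n := Num.max _ _ => {}FA.
  have rn : rho <= n by rewrite le_max lexx.
  have n0 : 0 < n by rewrite (lt_le_trans r0).
  have [|k /andP[k1 k2]] := @dyadic_floor R (n / rho).
    by rewrite ler_pdivlMr// mul1r.
  rewrite ler_pdivlMr// in k1; rewrite ltr_pdivrMr// in k2.
  exists k; split; first by apply: le_lt_trans k2; rewrite le_max lexx orbT.
  apply: (le_trans FA); rewrite ler_wpM2l// !powRN.
  rewrite lef_pV2 ?posrE ?powR_gt0//.
  apply: ge0_ler_powR => //; rewrite ?nnegrE ?(ltW n0) ?(ltW (p2 _))//.
  by rewrite addr_ge0// ltW.
- split=> //; apply: (le_trans FI).
  by rewrite /Cfar le_eqVlt; apply/orP; left; apply/eqP; field; rewrite subr_eq0 gt_eqF.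
Qed.

Definition Cnear := Lam * 4 `^ s * 2.

(** Dyadic shells going inwards: the factor [enorm (y - x)] in front of the critical singularity
    halves the contribution from each shell to the next. The bound is kept as a product of two
    factors, each monotone by itself, because the sign of [1 - s] is not known. *)
Lemma intg_near (F : V -> R) (x : V) (A rho : R) :
  measurable_fun setT (F : X -> R) -> 0 <= A -> 0 < rho -> 0 < s ->
  (forall y, rho <= enorm (y - x) -> F y = 0) -> F x = 0 ->
  (forall y, enorm (y - x) < rho -> 0 < enorm (y - x) ->
     `|F y| <= A * (enorm (y - x) * enorm (y - x) `^ (- s))) ->
  intg mu F /\ \int[mu]_y `|F y| <= A * (Cnear * rho).
Proof.
move=> mF A0 r0 s0 F0 Fx FA.
have p2 k : 0 < 2^-1 ^+ k * rho by rewrite mulr_gt0// exprn_gt0.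
(* The radius is twice the outer radius [2^-k * rho] of the shell, so that the open ball contains
   the shell. *)
have [|k|||k|y Fy|iF FI] := @intg_shells F x (fun k => 4 * (2^-1 ^+ k.+1 * rho))
    (fun k => A * (2^-1 ^+ k * rho * (2^-1 ^+ k.+1 * rho) `^ (- s)))
    (A * (Lam * 4 `^ s * rho)) 2^-1 mF.
- by move=> k; rewrite mulr_gt0.
- by rewrite !mulr_ge0// ?powR_ge0// ?exprn_ge0// ltW.
- by rewrite !mulr_ge0// ?powR_ge0// ltW.
- by lra.
- rewrite powRN (@powRM _ 4)// ?(ltW (p2 _))//.
  have := powR_gt0 s (p2 k.+1); move: ((2^-1 ^+ k.+1 * rho) `^ s) => z z0.
  move: (2^-1 ^+ k) => t.
  by rewrite le_eqVlt; apply/orP; left; apply/eqP; field; rewrite gt_eqF.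
- have [yr|yr] := ltP (enorm (y - x)) rho; last by rewrite F0 ?eqxx in Fy.
  have u0 : 0 < enorm (y - x).
    by apply: enorm_gt0; apply: contra Fy; rewrite subr_eq0 => /eqP ->; rewrite Fx.
  have [|k /andP[k1 k2]] := @dyadic_floor R (rho / enorm (y - x)).
    by rewrite ler_pdivlMr// mul1r ltW.
  rewrite ler_pdivlMr// in k1; rewrite ltr_pdivrMr// in k2.
  have e2 j : 0 < 2 ^+ j :> R by rewrite exprn_gt0.
  have k1' : enorm (y - x) <= 2^-1 ^+ k * rho by rewrite exprVn mulrC ler_pdivlMr// mulrC.
  have k2' : 2^-1 ^+ k.+1 * rho < enorm (y - x) by rewrite exprVn mulrC ltr_pdivrMr// mulrC.
  exists k; split.
    rewrite /eball/=; apply: (le_lt_trans k1'); rewrite exprS.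
    by have := p2 k; move: (2^-1 ^+ k) => t; nra.
  apply: (le_trans (FA y yr u0)); rewrite ler_wpM2l//.
  apply: ler_pM => //; rewrite ?powR_ge0// ?(ltW u0)// !powRN.
  rewrite lef_pV2 ?posrE ?powR_gt0//.
  by apply: ge0_ler_powR => //; rewrite ?nnegrE ?(ltW u0) ?(ltW (p2 _)) ?(ltW s0) ?(ltW k2').
- split=> //; apply: (le_trans FI).
  by rewrite /Cnear le_eqVlt; apply/orP; left; apply/eqP; field.
Qed.

End nice_measure.
Global Opaque Rintegral.

(** * Scalar kernels *)

Section kernel.
Context (R : realType) (d : nat).
Local Notation V := 'rV[R]_d.
Local Notation X := (Rd R d).
Variables (s alpha : R).

Definition kd (om : V -> R) (delta : R) (x : V) : R :=
  (Num.max delta (enorm x) `^ (s + 1))^-1 * om x.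

Definition k0 (om : V -> R) (x : V) : R := (enorm x `^ (s + 1))^-1 * om x.

(** The properties inherited by the real and imaginary parts of every component of the kernel;
    oddness is homogeneity at [l = -1]. *)
Definition real_CZ (om : V -> R) : Prop :=
  [/\ forall l x, om (l *: x) = l * om x, forall x, `|om x| <= enorm x &
      forall x x', enorm x = 1 -> enorm x' = 1 ->
        `|om x - om x'| <= enorm (x - x') `^ alpha].

Variable om : V -> R.
Hypotheses (s0 : 0 < s) (a0 : 0 < alpha) (a1 : alpha <= 1) (omP : real_CZ om).

Let omZ l x : om (l *: x) = l * om x. Proof. by case: omP. Qed.
Let om_le x : `|om x| <= enorm x. Proof. by case: omP. Qed.
Let om_hold x x' : enorm x = 1 -> enorm x' = 1 ->
  `|om x - om x'| <= enorm (x - x') `^ alpha.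
Proof. by case: omP => _ _; apply. Qed.

Lemma omN (x : V) : om (- x) = - om x.
Proof. by rewrite -scaleN1r omZ mulN1r. Qed.

Lemma om0 : om 0 = 0.
Proof. by rewrite -(scale0r 0) omZ mul0r. Qed.

Lemma kdN (delta : R) (x : V) : kd om delta (- x) = - kd om delta x.
Proof. by rewrite /kd enormN omN mulrN. Qed.

Lemma kd0 (delta : R) : kd om delta 0 = 0.
Proof. by rewrite /kd om0 mulr0. Qed.

Lemma kd_far (delta : R) (x : V) : delta <= enorm x -> kd om delta x = k0 om x.
Proof. by move=> h; rewrite /kd max_r. Qed.

Lemma kd_le (delta : R) (x : V) : 0 < delta -> `|kd om delta x| <= Num.max delta (enorm x) `^ (- s).
Proof.
move=> d0; set M := Num.max _ _.
have M0 : 0 < M by rewrite lt_max d0.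
have P0 := powR_gt0 (s + 1) M0.
rewrite /kd normrM (ger0_norm (x := _^-1)) ?invr_ge0 ?powR_ge0// mulrC ler_pdivrMr//.
rewrite -powRD; last by rewrite (gt_eqF M0) implybT.
rewrite addKr powRr1 ?(ltW M0)//; apply: (le_trans (om_le x)).
by rewrite le_max lexx orbT.
Qed.

Lemma powR_Ns_le (a b : R) : 0 < a -> a <= b -> b `^ (- s) <= a `^ (- s).
Proof.
move=> h0 ab; rewrite !powRN lef_pV2 ?posrE ?powR_gt0// ?(lt_le_trans h0)//.
by apply: ge0_ler_powR; rewrite ?nnegrE ?(ltW s0) ?(ltW h0) ?(le_trans (ltW h0)).
Qed.

Lemma kd_le_enorm (delta : R) (x : V) : 0 < delta -> 0 < enorm x ->
  `|kd om delta x| <= enorm x `^ (- s).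
Proof.
move=> d0 x0; apply: (le_trans (kd_le x d0)); apply: powR_Ns_le => //.
by rewrite le_max lexx orbT.
Qed.

(** Truncation level and argument scale together, and the factor [r^(-s)] is the one that normalizes
    the blow-ups; truncated operators therefore scale exactly. *)
Lemma kd_scale (delta r : R) (x : V) : 0 < r -> 0 < delta ->
  kd om (r * delta) (r *: x) = r `^ (- s) * kd om delta x.
Proof.
move=> r0 d0; rewrite /kd enormZ gtr0_norm// -maxr_pMr ?(ltW r0)//.
have M0 : 0 < Num.max delta (enorm x) by rewrite lt_max d0.
rewrite powRM ?(ltW r0) ?(ltW M0)// omZ.
rewrite powRN powRD; last by rewrite (gt_eqF r0) implybT.
rewrite (powRr1 (ltW r0)).
have := powR_gt0 s r0; have := powR_gt0 (s + 1) M0.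
move: (r `^ s) (_ `^ (s + 1)) => u v v0 u0.
by field; rewrite !gt_eqF.
Qed.

Lemma k0_scale (r : R) (x : V) : 0 < r -> k0 om (r *: x) = r `^ (- s) * k0 om x.
Proof.
move=> r0; have [->|x0] := eqVneq x 0.
  by rewrite scaler0 /k0 om0 !mulr0.
have e0 := enorm_gt0 x0.
rewrite -(@kd_far (enorm x) x)// -(kd_scale x r0 e0) kd_far//.
by rewrite enormZ gtr0_norm.
Qed.

(** The Holder bound is known on the sphere only, so [v] is split into its length [t] and its
    direction [v']; the direction is within [2 * enorm (u - v)] of [u], and [2^alpha <= 2]. *)
Lemma om_radial (u v : V) : enorm u = 1 -> enorm (u - v) <= 2^-1 ->
  exists (t : R) (v' : V), [/\ 2^-1 <= t <= 2, `|t - 1| <= enorm (u - v),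
    v = t *: v', enorm v' = 1 & `|om u - om v'| <= 2 * enorm (u - v) `^ alpha].
Proof.
move=> u1 uv; pose t := enorm v.
have t1 : `|t - 1| <= enorm (u - v).
  by rewrite -u1 -enormB; have := enorm_dist v u.
have /andP[h1 h2] : - enorm (u - v) <= t - 1 <= enorm (u - v) by rewrite -ler_norml.
have t0 : 0 < t by lra.
exists t, (t^-1 *: v).
have v1 : enorm (t^-1 *: v) = 1.
  by rewrite enormZ gtr0_norm ?invr_gt0// mulVf// gt_eqF.
split=> //.
- by apply/andP; split; lra.
- by rewrite scalerA mulfV ?scale1r// gt_eqF.
apply: (le_trans (om_hold u1 v1)).
have e0 := enorm_ge0 (u - v).
apply: (@le_trans _ _ ((2 * enorm (u - v)) `^ alpha)).
  apply: ge0_ler_powR; rewrite ?nnegrE ?enorm_ge0 ?(ltW a0) ?mulr_ge0//.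
  apply: (le_trans (enorm_triangle v _ _)).
  rewrite (_ : v - t^-1 *: v = (1 - t^-1) *: v); last by rewrite scalerBl scale1r.
  rewrite enormZ -/t -{2}(gtr0_norm t0) -normrM mulrBl mulVf ?gt_eqF// mul1r; lra.
rewrite powRM// ler_wpM2r ?powR_ge0//.
by apply: ler1_powR => //; lra.
Qed.

Lemma le_powR_alpha (e : R) : 0 <= e <= 1 -> e <= e `^ alpha.
Proof.
move=> /andP[]; rewrite le_eqVlt => /predU1P[<-|e0] e1; first exact: powR_ge0.
by apply: ger1_powR => //; rewrite e0.
Qed.

Lemma om_unit (u v : V) : enorm u = 1 -> enorm (u - v) <= 2^-1 ->
  `|om u - om v| <= 3 * enorm (u - v) `^ alpha.
Proof.
move=> u1 uv; have [t [v' [t12 t1 E v'1 h]]] := om_radial u1 uv.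
have e0 := enorm_ge0 (u - v); set e := enorm (u - v) in uv t1 h e0 *.
have ea : e <= e `^ alpha by apply: le_powR_alpha; lra.
rewrite E omZ (_ : _ - _ = (om u - om v') + (1 - t) * om v'); last by ring.
apply: (le_trans (ler_normD _ _)).
rewrite normrM distrC (distrC 1).
have ov := om_le v'; rewrite v'1 in ov.
have := ler_pM (normr_ge0 _) (normr_ge0 _) t1 ov; rewrite (distrC (om v')); lra.
Qed.

Lemma om_cont : continuous om.
Proof.
apply/continuous_enormP => u e e0.
have [->|u0] := eqVneq u 0.
  exists e => // v; rewrite subr0 om0 subr0; exact: le_lt_trans.
have n0 := enorm_gt0 u0; set n := enorm u in n0.
(* Chosen so that [n * 3 * q^alpha], with the constant 3 of [om_unit], is three quarters of [e]. *)
pose q := (e / (4 * n)) `^ alpha^-1.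
have en0 : 0 < e / (4 * n) by rewrite divr_gt0// mulr_gt0.
have q0 : 0 < q by exact: powR_gt0.
exists (n * Num.min 2^-1 q); first by rewrite mulr_gt0// lt_min q0 andbT.
move=> v; rewrite enormB => uv.
pose u' := n^-1 *: u; pose v' := n^-1 *: v.
have u'1 : enorm u' = 1.
  by rewrite enormZ gtr0_norm ?invr_gt0// mulVf// gt_eqF.
have euv : enorm (u' - v') = enorm (u - v) / n.
  by rewrite -scalerBr enormZ gtr0_norm ?invr_gt0// mulrC.
have : enorm (u' - v') < Num.min 2^-1 q by rewrite euv ltr_pdivrMr// mulrC.
rewrite lt_min => /andP[h1 h2].
have h := om_unit u'1 (ltW h1).
have -> : om v - om u = - (n * (om u' - om v')).
  by rewrite !omZ; field; rewrite gt_eqF.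
rewrite normrN normrM gtr0_norm//.
have : enorm (u' - v') `^ alpha <= q `^ alpha.
  by apply: ge0_ler_powR; rewrite ?nnegrE ?enorm_ge0 ?(ltW a0) ?(ltW q0) ?(ltW h2).
rewrite /q -powRrM mulVf ?gt_eqF// powRr1 ?(ltW en0)// => h3.
apply: (@le_lt_trans _ _ (n * (3 * (e / (4 * n))))).
  by rewrite ler_pM2l//; lra.
rewrite (_ : n * _ = 3 / 4 * e); last by field; rewrite gt_eqF.
by lra.
Qed.

Lemma kd_cont (delta : R) : 0 < delta -> continuous (kd om delta).
Proof.
move=> d0.
pose M (x : V) := Num.max delta (enorm x).
have M0 x : 0 < M x by rewrite lt_max d0.
have cM : continuous M.
  apply/continuous_enormP => x e e0; exists e => // y ye.
  apply: le_lt_trans ye; apply: le_trans (enorm_dist y x).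
  rewrite /M !maxEle; case: (leP delta (enorm y)) => h1; case: (leP delta (enorm x)) => h2 //.
  - by rewrite !ger0_norm; lra.
  - by rewrite !ler0_norm; lra.
  - by rewrite subrr normr0.
have -> : kd om delta = (fun x => expR (- (s + 1) * ln (M x)) * om x).
  by apply/funext => x; rewrite /kd -powRN /powR -/(M x) gt_eqF.
apply: contM; last exact: om_cont.
apply: (@cont_comp _ _ expR); last by move=> x; exact: continuous_expR.
by apply: contZ; apply: (@cont_comp R d (@ln R) M) => // x; exact: continuous_ln.
Qed.

Lemma kd_joint_cont (delta : R) : 0 < delta -> forall (x y : V) (e : R), 0 < e ->
  exists2 r : R, 0 < r & forall x' y', enorm (x' - x) < r -> enorm (y' - y) < r ->
    `|kd om delta (x' - y') - kd om delta (x - y)| < e.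
Proof.
move=> d0 x y e e0.
have /continuous_enormP/(_ (x - y) e e0)[r r0 h] := kd_cont d0.
exists (r / 2); first by rewrite divr_gt0.
move=> x' y' hx hy; apply: h.
rewrite (_ : x' - y' - (x - y) = (x' - x) - (y' - y)); last first.
  by apply/rowP => i; rewrite !mxE; ring.
apply: (le_lt_trans (ler_enormD _ _)); rewrite enormN; lra.
Qed.

Lemma measurable_kdB (delta : R) : 0 < delta ->
  measurable_fun setT (fun p : X * X => kd om delta (p.1 - p.2)).
Proof.
move=> d0.
exact: (joint_continuous_measurable (F := fun x y => kd om delta (x - y)) (kd_joint_cont d0)).
Qed.

(** Comes from [exp u >= 1 + u] and [ln u <= u - 1]. For [t < 1] the difference is factored as
    [t^(-s) * (1 - t^s)] with [t^(-s) <= 2^s]. *)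
Lemma powR_Ns_lip (t : R) : 2^-1 <= t <= 2 -> `|1 - t `^ (- s)| <= 2 `^ s * (2 * s) * `|t - 1|.
Proof.
move=> /andP[t1 t2]; have t0 : 0 < t by lra.
have p2 : 1 <= 2 `^ s.
  have := @ler_powR R 2 ltac:(lra) 0 s (ltW s0); by rewrite powRr0.
have E (x : R) : 0 < x -> x `^ (- s) = expR (- s * ln x) by move=> x0; rewrite /powR gt_eqF.
have ln_le (x : R) : 0 < x -> ln x <= x - 1.
  by move=> x0; have := @le_ln1Dx R (x - 1); rewrite (addrC 1) subrK; apply; lra.
have [t1'|t1'] := leP 1 t.
  have l0 := ln_ge0 t1'.
  rewrite (ger0_norm (x := t - 1)) ?subr_ge0// ger0_norm; last first.
    by rewrite subr_ge0 E// -[leRHS](@expR0 R) ler_expR mulNr oppr_le0 mulr_ge0// ltW.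
  have := expR_ge1Dx (- s * ln t); rewrite -E// => h.
  have h2 := ln_le t t0.
  have h3 : s * ln t <= s * (t - 1) by rewrite ler_wpM2l// ltW.
  have h4 : s * (t - 1) <= 2 `^ s * (2 * s) * (t - 1).
    rewrite ler_wpM2r ?subr_ge0//.
    apply: (@le_trans _ _ (1 * (2 * s))).
      by rewrite mul1r mulr_natl mulr2n lerDl ltW.
    by rewrite ler_wpM2r// mulr_ge0// ltW.
  rewrite mulNr in h; lra.
rewrite (ltr0_norm (x := t - 1)) ?subr_lt0// distrC ger0_norm; last first.
  have l0 : ln t <= 0 by apply: ln_le0; lra.
  by rewrite subr_ge0 E// -[leLHS](@expR0 R) ler_expR mulNr oppr_ge0 mulr_ge0_le0// ltW.
have h : t `^ (- s) <= 2 `^ s.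
  rewrite (_ : 2 `^ s = 2^-1 `^ (- s)); first by apply: powR_Ns_le => //; lra.
  by rewrite -(@powR_inv1 _ 2)// -powRrM mulrNN mul1r.
have ti0 : 0 < t^-1 by rewrite invr_gt0.
have h2 : ln t^-1 <= t^-1 - 1 := ln_le _ ti0.
have h3 : t^-1 <= 2 by rewrite invf_ple ?posrE.
have h4 : t^-1 - 1 = t^-1 * (1 - t) by field; rewrite gt_eqF.
rewrite lnV ?posrE// in h2.
have h5 : 1 - t `^ s <= s * (2 * (1 - t)).
  have := expR_ge1Dx (s * ln t).
  have -> : expR (s * ln t) = t `^ s by rewrite /powR gt_eqF.
  move=> h6; have : - ln t <= 2 * (1 - t).
    apply: (le_trans h2); rewrite h4 ler_wpM2r//; lra.
  by move=> /(ler_wpM2l (ltW s0)); rewrite mulrN; lra.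
have -> : t `^ (- s) - 1 = t `^ (- s) * (1 - t `^ s).
  by rewrite mulrBr mulr1 -powRD ?addNr ?powRr0// eqxx gt_eqF.
rewrite opprB -mulrA; apply: ler_pM => //; first exact: powR_ge0; last by lra.
rewrite subr_ge0; have := @ge0_ler_powR R s (ltW s0) t 1.
by rewrite powR1 !nnegrE; apply; lra.
Qed.

(** In [k0_reg] the summand 2 bounds the change of direction, the other one the change of length. *)
Definition Creg := 2 + 2 `^ s * (2 * s).

Lemma Creg_gt0 : 0 < Creg.
Proof. by rewrite ltr_wpDr// mulr_ge0 ?powR_ge0// mulr_ge0// ltW. Qed.

(** Homogeneity reduces to [u] of norm one. Then [om_radial] separates the angular variation from
    the radial one, which is Lipschitz and so, at distances below 1, also controlled by the power
    [alpha]. *)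
Lemma k0_reg (u v : V) : 0 < enorm u -> enorm (u - v) <= enorm u / 2 ->
  `|k0 om u - k0 om v| <= Creg * (enorm (u - v) `^ alpha * enorm u `^ (- (s + alpha))).
Proof.
set n := enorm u => n0 uv.
pose u' := n^-1 *: u; pose w := n^-1 *: v.
have u'1 : enorm u' = 1.
  by rewrite enormZ gtr0_norm ?invr_gt0// mulVf// gt_eqF.
have euv : enorm (u' - w) = enorm (u - v) / n.
  by rewrite -scalerBr enormZ gtr0_norm ?invr_gt0// mulrC.
have uu : u = n *: u' by rewrite scalerA mulfV ?scale1r// gt_eqF.
have vv : v = n *: w by rewrite scalerA mulfV ?scale1r// gt_eqF.
have e12 : enorm (u' - w) <= 2^-1 by rewrite euv ler_pdivrMr// mulrC.
suff : `|k0 om u' - k0 om w| <= Creg * enorm (u' - w) `^ alpha.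
  have -> : k0 om u - k0 om v = n `^ (- s) * (k0 om u' - k0 om w).
    by rewrite mulrBr -!k0_scale// -uu -vv.
  rewrite normrM (ger0_norm (powR_ge0 _ _)) => h.
  rewrite opprD powRD; last by rewrite (gt_eqF n0) implybT.
  rewrite euv powRM ?enorm_ge0 ?invr_ge0 ?(ltW n0)// in h.
  have -> : n `^ (- alpha) = n^-1 `^ alpha.
    by rewrite -(powR_inv1 (ltW n0)) -powRrM mulN1r.
  rewrite (mulrCA _ (n `^ (- s))) (mulrCA Creg).
  by rewrite ler_wpM2l// powR_ge0.
have [t [v' [t12 t1 E v'1 h]]] := om_radial u'1 e12.
have e0 := enorm_ge0 (u' - w); set e := enorm (u' - w) in e12 t1 h e0 *.
have ea : e <= e `^ alpha by apply: le_powR_alpha; lra.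
have t0 : 0 < t by case/andP: t12 => t12 _; lra.
have k1 z : enorm z = 1 -> k0 om z = om z.
  by move=> z1; rewrite /k0 z1 powR1 invr1 mul1r.
rewrite E k0_scale// !k1//.
rewrite (_ : _ - _ = (om u' - om v') + (1 - t `^ (- s)) * om v'); last by ring.
apply: (le_trans (ler_normD _ _)); rewrite normrM.
have ov := om_le v'; rewrite v'1 in ov.
have h2 := powR_Ns_lip t12.
have h3 : `|1 - t `^ (- s)| * `|om v'| <= 2 `^ s * (2 * s) * e `^ alpha * 1.
  apply: ler_pM => //; apply: (le_trans h2); rewrite ler_wpM2l//.
    by rewrite mulr_ge0 ?powR_ge0// mulr_ge0// ltW.
  exact: le_trans ea.
rewrite /Creg; lra.
Qed.

End kernel.
Lemma kdE (R : realType) (d : nat) (s : R) (om : 'rV[R]_d -> R) (delta : R) (x : 'rV[R]_d) :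
  kd s om delta x = (Num.max delta (enorm x) `^ (s + 1))^-1 * om x.
Proof. by []. Qed.

Lemma k0E (R : realType) (d : nat) (s : R) (om : 'rV[R]_d -> R) (x : 'rV[R]_d) :
  k0 s om x = (enorm x `^ (s + 1))^-1 * om x.
Proof. by []. Qed.

Global Opaque kd k0.

(** * Continuous functions with compact support *)

Section test_functions.
Context (R : realType) (d : nat).
Local Notation V := 'rV[R]_d.
Local Notation X := (Rd R d).

Definition Cc (f : V -> R) : Prop :=
  continuous f /\ exists N : R, forall x, N <= enorm x -> f x = 0.

Lemma Cc_support (f : V -> R) (N0 : R) : Cc f ->
  exists2 N : R, N0 < N /\ 0 < N & forall x, N <= enorm x -> f x = 0.
Proof.
move=> [_ [N fN]]; exists (`|N| + `|N0| + 1).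
  by split; have := normr_ge0 N; have := ler_norm N0; have := normr_ge0 N0; lra.
move=> x Nx; apply: fN; apply: le_trans Nx.
by have := normr_ge0 N0; have := ler_norm N; lra.
Qed.

Lemma compact_cball (N : R) : compact [set x : V | enorm x <= N].
Proof.
apply: (@compact_eball_closed _ _ N) => //.
have := @continuous_enorm R d; rewrite continuous_closedP.
move=> /(_ _ (@closed_le R N)); apply.
Qed.

Lemma Cc_bounded (f : V -> R) : Cc f -> exists2 M : R, 0 < M & forall x, `|f x| <= M.
Proof.
move=> Cf; have [N [_ N0] fN] := Cc_support 0 Cf.
have cnf : continuous (fun x => `|f x|) by apply: cont_norm; case: Cf.
have [|c _ fc] := @compact_EVT_max V R (fun x => `|f x|) [set x | enorm x <= N] _
   (@compact_cball N) (continuous_subspaceT cnf).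
  by exists 0; rewrite /= enorm0 ltW.
exists (`|f c| + 1); first by have := normr_ge0 (f c); lra.
move=> x; have [xN|xN] := leP (enorm x) N.
  by have := fc x (mem_set xN); lra.
by rewrite fN ?normr0 ?(ltW xN)//; have := normr_ge0 (f c); lra.
Qed.

Lemma CcD (f g : V -> R) : Cc f -> Cc g -> Cc (fun x => f x + g x).
Proof.
move=> Cf Cg; split; first by apply: contD; [case: Cf|case: Cg].
have [N _ fN] := Cc_support 0 Cf; have [N' [NN' _] gN] := Cc_support N Cg.
exists N' => x h; rewrite fN ?gN ?addr0//; exact: le_trans (ltW NN') h.
Qed.

Lemma CcMl (g f : V -> R) : continuous g -> Cc f -> Cc (fun x => g x * f x).
Proof.
move=> cg [cf [N fN]]; split; first exact: contM.
by exists N => x /fN ->; rewrite mulr0.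
Qed.

Lemma CcZ (a : R) (f : V -> R) : Cc f -> Cc (fun x => a * f x).
Proof. by apply: CcMl; exact: cont_cst. Qed.

Lemma CcB (f g : V -> R) : Cc f -> Cc g -> Cc (fun x => f x - g x).
Proof.
move=> Cf Cg; rewrite (_ : (fun x => _) = (fun x => f x + -1 * g x)).
  by apply: CcD => //; exact: CcZ.
by apply/funext => x; rewrite mulN1r.
Qed.

Lemma Cc_cst0 : Cc (fun=> 0).
Proof. by split; [exact: cont_cst|exists 0]. Qed.

Lemma Cc_sum (I : Type) (r : seq I) (F : I -> V -> R) :
  (forall i, Cc (F i)) -> Cc (fun x => \sum_(i <- r) F i x).
Proof.
move=> cF; elim: r => [|i r ih].
  by under eq_fun do rewrite big_nil; exact: Cc_cst0.
by under eq_fun do rewrite big_cons; exact: CcD.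
Qed.

Lemma Cc_max (f g : V -> R) : Cc f -> Cc g -> Cc (fun x => Num.max (f x) (g x)).
Proof.
move=> Cf Cg; split; first by apply: cont_max; [case: Cf|case: Cg].
have [N _ fN] := Cc_support 0 Cf; have [N' [NN' _] gN] := Cc_support N Cg.
exists N' => x h; rewrite fN ?gN ?maxxx//; exact: le_trans (ltW NN') h.
Qed.

Lemma Cc_min0 (f g : V -> R) : Cc f -> continuous g -> (forall x, 0 <= g x) ->
  Cc (fun x => Num.min (f x) (g x)).
Proof.
move=> Cf cg g0; split; first by apply: cont_min => //; case: Cf.
have [N _ fN] := Cc_support 0 Cf.
by exists N => x h; rewrite fN// min_l.
Qed.

(** A tent equal to 1 on [B(c, r)] and to 0 off [B(c, 2r)], with Lipschitz constant [1 / r]. *)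
Definition cutoff (c : V) (r : R) (x : V) : R :=
  Num.max 0 (Num.min 1 (2 - enorm (x - c) / r)).

Lemma cutoff_ge0 c r x : 0 <= cutoff c r x.
Proof. by rewrite le_max lexx. Qed.

Lemma cutoff_le1 c r x : cutoff c r x <= 1.
Proof. by rewrite ge_max ler01/= ge_min lexx. Qed.

Lemma cutoff1 (c : V) (r : R) (x : V) : 0 < r -> enorm (x - c) <= r -> cutoff c r x = 1.
Proof.
move=> r0 h; rewrite /cutoff min_l ?max_r//.
have : enorm (x - c) / r <= 1 by rewrite ler_pdivrMr// mul1r.
by lra.
Qed.

Lemma cutoff0 (c : V) (r : R) (x : V) : 0 < r -> 2 * r <= enorm (x - c) -> cutoff c r x = 0.
Proof.
move=> r0 h; rewrite /cutoff max_l//.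
have : 2 <= enorm (x - c) / r by rewrite ler_pdivlMr.
by move=> h2; rewrite ge_min; apply/orP; right; lra.
Qed.

Lemma cutoff_lip (c : V) (r : R) (x y : V) : 0 < r ->
  `|cutoff c r x - cutoff c r y| <= r^-1 * enorm (x - y).
Proof.
move=> r0.
suff h a b : `|Num.max 0 (Num.min 1 a) - Num.max 0 (Num.min 1 b)| <= `|a - b| :> R.
  apply: (le_trans (h _ _)).
  rewrite (_ : _ - _ = - (r^-1 * (enorm (x - c) - enorm (y - c)))); last by field; rewrite gt_eqF.
  rewrite normrN normrM gtr0_norm ?invr_gt0// ler_pM2l ?invr_gt0//.
  by apply: (le_trans (enorm_dist _ _)); rewrite opprB addrA subrK.
wlog ab : a b / a <= b => [hw|].
  by case: (leP a b) => [/hw//|/ltW /hw]; rewrite distrC (distrC b).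
rewrite distrC [leRHS]distrC [leRHS]ger0_norm ?subr_ge0// ger0_norm; last first.
  by rewrite subr_ge0 ge_max le_max lexx/= le_max; apply/orP; right; rewrite le_min !ge_min lexx ab !orbT.
rewrite !maxEle !minEle; case: (leP 1 b) => h1; case: (leP 1 a) => h2;
  rewrite ?ler01; try lra.
  by case: (leP 0 a) => h3; lra.
by case: (leP 0 b) => h3; case: (leP 0 a) => h4; lra.
Qed.

Lemma cutoff_Cc (c : V) (r : R) : 0 < r -> Cc (cutoff c r).
Proof.
move=> r0; split.
  apply/continuous_enormP => x e e0; exists (r * e); first by rewrite mulr_gt0.
  move=> y h; apply: (le_lt_trans (cutoff_lip c _ _ r0)).
  by rewrite ltr_pdivrMl.
exists (2 * r + enorm c) => x h; apply: cutoff0 => //.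
by have := ler_enormD (x - c) c; rewrite subrK; lra.
Qed.

Lemma Cc_intg (s Lam : R) (mu : bmeasure R d) (f : V -> R) :
  nice s Lam mu -> Cc f -> intg mu f.
Proof.
move=> nmu Cf; have [N [_ N0] fN] := Cc_support 0 Cf.
have [M M0 fM] := Cc_bounded Cf.
have mf : measurable_fun setT (f : X -> R) by apply: continuous_measurable_Rd; case: Cf.
have [] // := @intg_bounded _ _ s Lam mu nmu f M 0 N N0 mf fM.
by move=> x /negP; rewrite /eball/= subr0 -leNgt => /fN.
Qed.

Lemma Rintegral_Cc_le (s Lam : R) (mu : bmeasure R d) (f : V -> R) (M N : R) :
  nice s Lam mu -> 0 < N -> Cc f -> (forall x, `|f x| <= M) ->
  (forall x, N <= enorm x -> f x = 0) ->
  `|\int[mu]_x f x| <= M * (Lam * N `^ s).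
Proof.
move=> nmu N0 Cf fM fN.
have mf : measurable_fun setT (f : X -> R) by apply: continuous_measurable_Rd; case: Cf.
have [|i h] := @intg_bounded _ _ s Lam mu nmu f M 0 N N0 mf fM.
  by move=> x /negP; rewrite /eball/= subr0 -leNgt => /fN.
exact: le_trans (le_normr_Rintegral measurableT i) h.
Qed.

(** Tube lemma: compactness of the ball makes the continuity in [x] uniform over [y]. *)
Lemma joint_unif (F : V -> V -> R) (x : V) (N e : R) :
  (forall x y (e : R), 0 < e -> exists2 r : R, 0 < r &
     forall x' y', enorm (x' - x) < r -> enorm (y' - y) < r ->
       `|F x' y' - F x y| < e) -> 0 < e ->
  exists2 r : R, 0 < r & forall x', enorm (x' - x) < r ->
     forall y, enorm y <= N -> `|F x' y - F x y| < e.
Proof.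
move=> cF e0.
have /compact_near_coveringP K := @compact_cball N.
have K2 := K V (nbhs x) (fun x' y => `|F x' y - F x y| < e) (nbhs_filter x).
suff /nbhs_eballP [r r0 h] : nbhs x (fun x' => [set x1 | enorm x1 <= N] `<=`
    (fun y => `|F x' y - F x y| < e)).
  by exists r => // x' hx y hy; exact: (h x' hx y hy).
apply: K2 => y _.
have e20 : 0 < e / 2 by rewrite divr_gt0.
have [r r0 h] := cF x y _ e20.
exists (eball y r, eball x r) => /=; first by split; apply/nbhs_eballP; exists r.
move=> [y' x'] [/= hy hx].
have h1 := h x' y' hx hy; have h2 : `|F x y' - F x y| < e / 2.
  by apply: h => //; rewrite subrr enorm0.
rewrite (_ : _ - _ = (F x' y' - F x y) - (F x y' - F x y)); last by ring.
by apply: (le_lt_trans (ler_normB _ _)); lra.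
Qed.

End test_functions.

Section real_lemmas.
Context {R : realType}.

(** Serves both Cauchy-Schwarz and the near-minimizers. When [C = 0] and [B] is nonzero, the chosen
    [t] makes the expression equal to [-1]. *)
Lemma discriminant (A B C : R) : 0 <= A -> 0 <= C ->
  (forall t, 0 <= A + 2 * t * B + t ^+ 2 * C) -> B ^+ 2 <= A * C.
Proof.
move=> A0 C0 h; have [C00|C1] := eqVneq C 0.
  rewrite C00 mulr0; have [->|B0] := eqVneq B 0; first by rewrite expr0n.
  have := h (- (A + 1) / (2 * B)); rewrite C00 mulr0 addr0.
  rewrite (_ : A + _ = -1); last by field.
  lra.
have Cp : 0 < C by rewrite lt_def C1.
have := h (- B / C); rewrite (_ : _ + _ = (A * C - B ^+ 2) / C); last by field.
by rewrite pmulr_lge0 ?invr_gt0// subr_ge0.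
Qed.

Context {dd : measure_display} {T : measurableType dd}.
Variable mu : {measure set T -> \bar R}.

Lemma intg_mul (f g : T -> R) : measurable_fun setT f -> measurable_fun setT g ->
  intg mu (fun x => f x ^+ 2) -> intg mu (fun x => g x ^+ 2) ->
  intg mu (fun x => f x * g x).
Proof.
move=> mf mg i1 i2; apply: (intg_le _ (intgD i1 i2)).
  exact: measurable_funM.
move=> x; rewrite normrM -(real_normK (num_real (f x))) -(real_normK (num_real (g x))).
have := normr_ge0 (f x); have := normr_ge0 (g x); have := sqr_ge0 (`|f x| - `|g x|).
by nra.
Qed.

Lemma cauchy_schwarz (f g : T -> R) : measurable_fun setT f -> measurable_fun setT g ->
  intg mu (fun x => f x ^+ 2) -> intg mu (fun x => g x ^+ 2) ->
  (\int[mu]_x (f x * g x)) ^+ 2 <= (\int[mu]_x (f x ^+ 2)) * (\int[mu]_x (g x ^+ 2)).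
Proof.
move=> mf mg i1 i2; have i3 := intg_mul mf mg i1 i2.
apply: discriminant.
- by apply: Rintegral_ge0 => x _; exact: sqr_ge0.
- by apply: Rintegral_ge0 => x _; exact: sqr_ge0.
move=> t.
rewrite -(RintegralZl _ measurableT i3) -(RintegralZl _ measurableT i2).
have i4 := intgZ (2 * t) i3; have i5 := intgZ (t ^+ 2) i2.
rewrite -(RintegralD measurableT i1 i4) -(RintegralD measurableT (intgD i1 i4) i5).
apply: Rintegral_ge0 => x _.
by rewrite (_ : _ + _ = (f x + t * g x) ^+ 2) ?sqr_ge0//; ring.
Qed.

End real_lemmas.

(** * The truncated pairing *)

Section pairing.
Context (R : realType) (d : nat).
Local Notation V := 'rV[R]_d.
Local Notation X := (Rd R d).
Variables (s alpha : R).

Definition L2r (mu : bmeasure R d) (f : V -> R) : Prop :=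
  measurable_fun setT (f : X -> R) /\ intg mu (fun x => f x ^+ 2).

Definition Tr (om : V -> R) (mu : bmeasure R d) (delta : R) (f : V -> R) (x : V) : R :=
  \int[mu]_y (f y * kd s om delta (x - y)).

Definition Pr (om : V -> R) (mu : bmeasure R d) (delta : R) (f g : V -> R) : R :=
  \int[mu]_x (g x * Tr om mu delta f x).

(** Only [Cc] functions are tested, because weak convergence gives access to these alone;
    [weak_good] recovers all of [L2r] for the limit measure. *)
Definition rgood (om : V -> R) (Lg : R) (mu : bmeasure R d) : Prop :=
  forall (delta : R) (f : V -> R), 0 < delta -> Cc f ->
    (\int[mu]_x (Tr om mu delta f x ^+ 2)%:E <=
      (Lg ^+ 2)%:E * \int[mu]_x (f x ^+ 2)%:E)%E.

Variables (Lam : R) (mu : bmeasure R d) (om : V -> R).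
Hypotheses (s0 : 0 < s) (a0 : 0 < alpha) (a1 : alpha <= 1).
Hypotheses (omP : real_CZ alpha om) (Lam0 : 0 < Lam) (nmu : nice s Lam mu).

Let smu : sigma_finite setT mu := nice_sigma_finite nmu.

Lemma mulr_le_sqrD (A B D : R) : 0 <= A -> B <= D -> A * B <= A ^+ 2 + D ^+ 2.
Proof.
move=> A0 BD; have : A * B <= A * D by rewrite ler_wpM2l.
by have := sqr_ge0 (A - D); have := sqr_ge0 A; have := sqr_ge0 D; nra.
Qed.

Lemma RintegralB4 (m : bmeasure R d) (A1 A2 A3 A4 : X -> R) :
  intg m A1 -> intg m A2 -> intg m A3 -> intg m A4 ->
  \int[m]_x ((A1 x - A2 x) - (A3 x - A4 x)) =
  (\int[m]_x A1 x - \int[m]_x A2 x) - (\int[m]_x A3 x - \int[m]_x A4 x).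
Proof.
move=> i1 i2 i3 i4.
rewrite (RintegralB measurableT (intgB i1 i2) (intgB i3 i4)).
by rewrite (RintegralB measurableT i1 i2) (RintegralB measurableT i3 i4).
Qed.

Lemma Cc_measurable (f : V -> R) : Cc f -> measurable_fun setT (f : X -> R).
Proof. by case=> cf _; exact: continuous_measurable_Rd. Qed.

Lemma Cc_L2r (f : V -> R) : Cc f -> L2r mu f.
Proof.
move=> Cf; split; first exact: Cc_measurable.
by apply: (Cc_intg nmu); apply: CcMl => //; case: Cf.
Qed.

Lemma measurable_kd (delta : R) (x : V) : 0 < delta ->
  measurable_fun setT (fun y : X => kd s om delta (x - y)).
Proof.
move=> d0; apply: continuous_measurable_Rd.
apply/continuous_enormP => y e e0.
have [r r0 h] := kd_joint_cont s a0 a1 omP d0 x y e0.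
by exists r => // y' hy; apply: h => //; rewrite subrr enorm0.
Qed.

(** A radial majorant of the truncated kernel. Its square decays like the distance to the power
    [-2s], hence is integrable for a nice measure, and [Tr] converges at every point for [f] in
    [L2r]. *)
Definition kw (delta : R) (x y : V) : R := Num.max delta (enorm (y - x)) `^ (- s).

Definition Ckw (delta : R) : R := Cfar s Lam s * delta `^ (- s).

Lemma kw_sq (delta : R) (x : V) : 0 < delta ->
  intg mu (fun y => kw delta x y ^+ 2) /\ \int[mu]_y (kw delta x y ^+ 2) <= Ckw delta.
Proof.
move=> d0.
have mw : measurable_fun setT (fun y : X => kw delta x y ^+ 2).
  apply: continuous_measurable_Rd.
  have cw : continuous (kw delta x).
    have M0 y : 0 < Num.max delta (enorm (y - x)) by rewrite lt_max d0.
    rewrite (_ : kw delta x = fun y => expR (- s * ln (Num.max delta (enorm (y - x))))).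
      apply: (@cont_comp _ _ expR); last by move=> y; exact: continuous_expR.
      apply: contZ; apply: (@cont_comp R d (@ln R)); last by move=> y; exact: continuous_ln.
      by apply: cont_max; [exact: cont_cst|exact: continuous_enormB].
    by apply/funext => y; rewrite /kw /powR gt_eqF.
  exact: contM.
have [] := @intg_far _ _ s Lam mu Lam0 nmu (fun y => kw delta x y ^+ 2) x 1 s delta mw ler01 s0 d0 s0.
  move=> y; rewrite mul1r ger0_norm ?sqr_ge0//.
  have M0 : 0 < Num.max delta (enorm (y - x)) by rewrite lt_max d0.
  by rewrite /kw expr2 -powRD ?opprD// (gt_eqF M0) implybT.
move=> i; rewrite mul1r => h; split=> //; apply: le_trans h.
rewrite le_eqVlt; apply/orP; left; apply/eqP; apply: eq_Rintegral => y _.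
by rewrite ger0_norm ?sqr_ge0.
Qed.

Lemma kd_le_kw (delta : R) (x y : V) : 0 < delta -> `|kd s om delta (x - y)| <= kw delta x y.
Proof. by move=> d0; rewrite /kw enormB; exact: (kd_le s omP _ d0). Qed.

Lemma kd_sq (delta : R) (x : V) : 0 < delta ->
  intg mu (fun y => kd s om delta (x - y) ^+ 2).
Proof.
move=> d0; have [i _] := kw_sq x d0; apply: (intg_le _ i).
  by apply: measurable_funM; exact: measurable_kd.
move=> y; rewrite ger0_norm ?sqr_ge0// -(real_normK (num_real (kd _ _ _ _))).
by rewrite lerXn2r ?nnegrE ?powR_ge0//; exact: kd_le_kw.
Qed.

Lemma Tr_intg (delta : R) (f : V -> R) (x : V) : 0 < delta -> L2r mu f ->
  intg mu (fun y => f y * kd s om delta (x - y)).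
Proof.
by move=> d0 [mf f2]; apply: intg_mul => //; [exact: measurable_kd|exact: kd_sq].
Qed.

Lemma Tr_abs_le (delta : R) (f : V -> R) (x : V) : 0 < delta -> L2r mu f ->
  \int[mu]_y `|f y * kd s om delta (x - y)| <= \int[mu]_y (f y ^+ 2) + Ckw delta.
Proof.
move=> d0 Lf; have [mf f2] := Lf; have [i h] := kw_sq x d0.
apply: (@le_trans _ _ (\int[mu]_y (f y ^+ 2 + kw delta x y ^+ 2))).
  apply: le_Rintegral => //.
  - by apply: intg_norm; exact: Tr_intg.
  - exact: intgD.
  move=> y _; rewrite normrM; have := kd_le_kw x y d0.
  by move=> kk; rewrite -(real_normK (num_real (f y))); exact: mulr_le_sqrD.
by rewrite RintegralD// lerD2l.
Qed.

(** Dominated convergence along a sequence [u n] tending to [x]. Continuity is what allows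
    [g * Tr f] to serve as a test function for weak convergence. *)
Lemma Tr_cont (delta : R) (f : V -> R) : 0 < delta -> L2r mu f ->
  continuous (Tr om mu delta f).
Proof.
move=> d0 Lf; have [mf f2] := Lf; apply/continuous_enormP => x e e0.
apply: contrapT => H.
have {}H n : exists y, enorm (y - x) < n.+1%:R^-1 /\
    e <= `|Tr om mu delta f y - Tr om mu delta f x|.
  have n0 : 0 < n.+1%:R^-1 :> R by rewrite invr_gt0.
  apply: contrapT => /forallNP h; apply: H; exists n.+1%:R^-1 => // y hy.
  by rewrite ltNge; apply/negP => h2; exact: (h y).
have {H} [u uH] := choice H.
pose F n y := (f y * kd s om delta (u n - y))%:E.
pose G y := (f y * kd s om delta (x - y))%:E.
have [i h] := kw_sq x d0.
(* Moving the centre by less than 1 changes [Num.max delta _] by a factor of at most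
   [1 + 1 / delta], so a single integrable function dominates the whole sequence. *)
pose C := (1 + delta^-1) `^ s.
have C0 : 0 <= C by exact: powR_ge0.
pose W (y : X) := (f y ^+ 2 + C ^+ 2 * kw delta x y ^+ 2)%:E.
have [|||||_ _] := @dominated_convergence _ X R mu setT measurableT F G W.
- by move=> n; apply/measurable_EFinP; apply: measurable_funM => //; exact: measurable_kd.
- by apply/measurable_EFinP; apply: measurable_funM => //; exact: measurable_kd.
- apply: aeW => y _; apply: cvg_EFin; first by apply: nearW.
  apply: cvgMr; apply/cvgrPdist_lt => ep ep0.
  have [r r0 hr] := kd_joint_cont s a0 a1 omP d0 x y ep0.
  near=> n; rewrite distrC; apply: hr; last by rewrite subrr enorm0.
  apply: lt_trans (uH n).1 _.
  by near: n; exact: near_infty_natSinv_lt (PosNum r0).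
- by apply: intgD => //; exact: intgZ.
- apply: aeW => y n _; rewrite lee_fin normrM.
  have k1 := kd_le_kw (u n) y d0.
  have k2 : kw delta (u n) y <= C * kw delta x y.
    have un1 : enorm (u n - x) < 1.
      by apply: lt_le_trans (uH n).1 _; rewrite invf_le1// ler1n.
    have tr := enorm_triangle (u n) y x.
    set a := enorm (y - u n) in tr; set b := enorm (y - x) in tr.
    have A0 : 0 < Num.max delta a by rewrite lt_max d0.
    have B0 : 0 < Num.max delta b by rewrite lt_max d0.
    have di : 0 < delta^-1 by rewrite invr_gt0.
    have D0 : 0 < 1 + delta^-1 by lra.
    have AB : Num.max delta b <= (1 + delta^-1) * Num.max delta a.
      have da : delta <= Num.max delta a by rewrite le_max lexx.
      have aa : a <= Num.max delta a by rewrite le_max lexx orbT.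
      have : 1 <= delta^-1 * Num.max delta a by rewrite mulrC ler_pdivlMr// mul1r.
      by rewrite ge_max => ?; apply/andP; split; lra.
    rewrite /kw -/a -/b /C !powRN.
    rewrite ler_pdivlMr ?powR_gt0// mulrC ler_pdivrMr ?powR_gt0//.
    rewrite -powRM ?(ltW D0) ?(ltW A0)//.
    by apply: ge0_ler_powR => //; rewrite ?nnegrE ?(ltW s0) ?(ltW B0) ?mulr_ge0 ?(ltW D0) ?(ltW A0).
  rewrite -exprMn -(real_normK (num_real (f y))); apply: mulr_le_sqrD => //.
  exact: le_trans k2.
move=> cv.
have {cv} cv : (fun n => Tr om mu delta f (u n)) @ \oo --> Tr om mu delta f x.
  have E : (\int[mu]_y G y)%E = (Tr om mu delta f x)%:E.
    by rewrite /Tr EFin_Rintegral//; exact: Tr_intg.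
  by move: cv; rewrite E => /fine_cvg; apply.
move/cvgrPdist_lt : cv => /(_ e e0) [n _ /(_ n (leqnn n))].
by rewrite /= distrC ltNge (uH n).2.
Unshelve. all: by end_near. Qed.

Lemma Pr_intg (delta : R) (f g : V -> R) : 0 < delta -> L2r mu f -> Cc g ->
  intg mu (fun x => g x * Tr om mu delta f x).
Proof.
move=> d0 Lf Cg; apply: (Cc_intg nmu).
rewrite (_ : (fun x => _) = fun x => Tr om mu delta f x * g x).
  by apply: CcMl => //; exact: Tr_cont.
by apply/funext => x; rewrite mulrC.
Qed.

(** Fubini and oddness of the kernel move the operator onto the compactly supported factor. As [f]
    ranges over [L2r], this is what extends the bound for the limit beyond [Cc]. *)
Lemma Pr_anti (delta : R) (f g : V -> R) : 0 < delta -> L2r mu f -> Cc g ->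
  Pr om mu delta f g = \int[mu]_y (f y * - Tr om mu delta g y).
Proof.
move=> d0 Lf Cg; have [mf f2] := Lf; have Lg := Cc_L2r Cg.
pose F x y := g x * (f y * kd s om delta (x - y)).
have iF x : intg mu (F x) by apply: intgZ; exact: Tr_intg.
have mg := Cc_measurable Cg.
have E x y : F x y = - f y * (g x * kd s om delta (y - x)).
  by rewrite /F -opprB (kdN _ omP); ring.
have iF' y : intg mu (F^~ y).
  rewrite (_ : F^~ y = fun x => - f y * (g x * kd s om delta (y - x))).
    by apply: intgZ; exact: Tr_intg.
  by apply/funext => x.
pose Q := \int[mu]_y (f y ^+ 2) + Ckw delta.
have mF : measurable_fun setT (fun p : X * X => F p.1 p.2).
  apply: measurable_funM; first exact: (measurableT_comp mg measurable_fst).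
  apply: measurable_funM; first exact: (measurableT_comp mf measurable_snd).
  exact: (measurable_kdB s a0 a1 omP d0).
have iG : intg mu (fun x => Q * `|g x|).
  by apply: intgZ; apply: intg_norm; exact: Cc_intg nmu Cg.
have FG x : \int[mu]_y `|F x y| <= Q * `|g x|.
  under eq_Rintegral do rewrite normrM.
  rewrite RintegralZl//; last by apply: intg_norm; exact: Tr_intg.
  by rewrite mulrC ler_wpM2r//; exact: Tr_abs_le.
have := @fubini_swap _ X R mu smu F _ mF iF iG FG iF'.
have -> : \int[mu]_x \int[mu]_y F x y = Pr om mu delta f g.
  by apply: eq_Rintegral => x _; rewrite /F RintegralZl//; exact: Tr_intg.
move=> ->; apply: eq_Rintegral => y _.
under eq_Rintegral do rewrite E.
by rewrite RintegralZl//; [rewrite mulrN mulNr|exact: Tr_intg].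
Qed.

Lemma TrB (delta : R) (f1 f2 : V -> R) (x : V) : 0 < delta ->
  L2r mu f1 -> L2r mu f2 ->
  Tr om mu delta (fun y => f1 y - f2 y) x = Tr om mu delta f1 x - Tr om mu delta f2 x.
Proof.
move=> d0 L1 L2; rewrite /Tr; under eq_Rintegral do rewrite mulrBl.
by rewrite RintegralB//; exact: Tr_intg.
Qed.

Lemma PrBl (delta : R) (f1 f2 g : V -> R) : 0 < delta ->
  L2r mu f1 -> L2r mu f2 -> Cc g ->
  Pr om mu delta (fun y => f1 y - f2 y) g = Pr om mu delta f1 g - Pr om mu delta f2 g.
Proof.
move=> d0 L1 L2 Cg; rewrite /Pr; under eq_Rintegral do rewrite TrB// mulrBr.
by rewrite RintegralB//; exact: Pr_intg.
Qed.

Lemma PrDr (delta : R) (f g1 g2 : V -> R) : 0 < delta ->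
  L2r mu f -> Cc g1 -> Cc g2 ->
  Pr om mu delta f (fun y => g1 y + g2 y) = Pr om mu delta f g1 + Pr om mu delta f g2.
Proof.
move=> d0 L1 L2 Cg; rewrite /Pr; under eq_Rintegral do rewrite mulrDl.
by rewrite RintegralD//; exact: Pr_intg.
Qed.

Lemma PrZr (delta a : R) (f g : V -> R) : 0 < delta ->
  L2r mu f -> Cc g -> Pr om mu delta f (fun y => a * g y) = a * Pr om mu delta f g.
Proof.
move=> d0 L1 Cg; rewrite /Pr; under eq_Rintegral do rewrite -mulrA.
by rewrite RintegralZl//; exact: Pr_intg.
Qed.

Lemma Pr_le (Lg delta : R) (f g : V -> R) : rgood om Lg mu -> 0 < delta ->
  Cc f -> Cc g ->
  Pr om mu delta f g ^+ 2 <=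
    Lg ^+ 2 * (\int[mu]_x (f x ^+ 2)) * (\int[mu]_x (g x ^+ 2)).
Proof.
move=> gd d0 Cf Cg; have [mf f2] := Cc_L2r Cf; have [mg g2] := Cc_L2r Cg.
have mT : measurable_fun setT (Tr om mu delta f : X -> R).
  by apply: continuous_measurable_Rd; apply: Tr_cont => //; exact: Cc_L2r.
have := gd delta f d0 Cf; rewrite -(EFin_Rintegral f2) -EFinM => h.
have [||i hi] := intg_ge0 _ _ h; first exact: measurable_funM.
  by move=> x; exact: sqr_ge0.
apply: (le_trans (cauchy_schwarz mg mT g2 i)); rewrite mulrC ler_wpM2r//.
by apply: Rintegral_ge0 => x _; exact: sqr_ge0.
Qed.

Lemma halve_le (p a b c e : R) : 2 * p <= 4 * a * b * c * e -> p <= 2 * a * b * c * e.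
Proof. by move=> h; lra. Qed.

Lemma antisym_le (delta delta' L M : R) (f g : V -> R) (x y : V) :
  0 < delta' -> 0 < delta -> 0 <= L -> 0 <= M ->
  (forall x, `|f x| <= M) -> (forall x, `|g x| <= M) ->
  (forall x y, `|f x - f y| <= L * enorm (x - y)) ->
  (forall x y, `|g x - g y| <= L * enorm (x - y)) -> 0 < enorm (y - x) ->
  `|(kd s om delta (x - y) - kd s om delta' (x - y)) * (g x * f y - f x * g y)|
    <= 4 * L * M * (enorm (y - x) * enorm (y - x) `^ (- s)).
Proof.
move=> d'0 d0 L0 M0 fM gM fL gL y0; rewrite normrM.
have kap_le : `|kd s om delta (x - y) - kd s om delta' (x - y)| <= 2 * enorm (y - x) `^ (- s).
  rewrite enormB in y0; have k1 := kd_le_enorm s0 omP d0 y0.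
  have k2 := kd_le_enorm s0 omP d'0 y0; rewrite enormB.
  apply: (le_trans (ler_normB _ _)).
  by rewrite mulr_natl mulr2n; exact: lerD.
have fg_le : `|g x * f y - f x * g y| <= 2 * L * M * enorm (y - x).
  rewrite (_ : _ - _ = (g x - g y) * f y + g y * (f y - f x)); last by ring.
  apply: (le_trans (ler_normD _ _)); rewrite !normrM.
  have := ler_pM (normr_ge0 _) (normr_ge0 _) (gL x y) (fM y).
  have := ler_pM (normr_ge0 _) (normr_ge0 _) (gM y) (fL y x).
  rewrite (enormB x y); move: (enorm _) => e h1 h2.
  by apply: (le_trans (lerD h2 h1)); rewrite le_eqVlt; apply/orP; left; apply/eqP; ring.
have := ler_pM (normr_ge0 _) (normr_ge0 _) kap_le fg_le.
move=> h; apply: (le_trans h); move: (enorm _) (_ `^ _) => e p.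
by rewrite le_eqVlt; apply/orP; left; apply/eqP; ring.
Qed.

(* Antisymmetrizing the kernel gains a factor [|x - y|], which makes the
   contribution of the region [|x - y| < delta] absolutely convergent. *)
Lemma Pr_diff (delta delta' N L M : R) (f g : V -> R) :
  0 < delta' -> delta' <= delta -> 0 < N -> 0 <= L -> 0 <= M ->
  Cc f -> Cc g ->
  (forall x, N <= enorm x -> f x = 0) -> (forall x, N <= enorm x -> g x = 0) ->
  (forall x, `|f x| <= M) -> (forall x, `|g x| <= M) ->
  (forall x y, `|f x - f y| <= L * enorm (x - y)) ->
  (forall x y, `|g x - g y| <= L * enorm (x - y)) ->
  `|Pr om mu delta f g - Pr om mu delta' f g| <=
    2 * L * M * (Cnear s Lam * delta) * (Lam * N `^ s).
Proof.
move=> d'0 dd' N0 L0 M0 Cf Cg fN gN fM gM fL gL.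
have d0 : 0 < delta by exact: lt_le_trans dd'.
have Lf := Cc_L2r Cf; have Lg := Cc_L2r Cg.
have D1 := Pr_anti d0 Lf Cg; have D2 := Pr_anti d'0 Lf Cg.
pose T1 := Tr om mu delta; pose T2 := Tr om mu delta'.
have if1 := Pr_intg d0 Lf Cg; have if2 := Pr_intg d'0 Lf Cg.
have ig1 := Pr_intg d0 Lg Cf; have ig2 := Pr_intg d'0 Lg Cf.
pose kap u := kd s om delta u - kd s om delta' u.
pose H x y := kap (x - y) * (g x * f y - f x * g y).
have iH x : intg mu (H x).
  have i1 := intgZ (g x) (Tr_intg x d0 Lf); have i2 := intgZ (g x) (Tr_intg x d'0 Lf).
  have i3 := intgZ (f x) (Tr_intg x d0 Lg); have i4 := intgZ (f x) (Tr_intg x d'0 Lg).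
  have := intgB (intgB i1 i2) (intgB i3 i4).
  apply: eq_ind; congr (intg mu _); apply/funext => y.
  by rewrite /H /kap; ring.
have HE x : \int[mu]_y H x y =
    (g x * T1 f x - g x * T2 f x) - (f x * T1 g x - f x * T2 g x).
  have i1 := intgZ (g x) (Tr_intg x d0 Lf); have i2 := intgZ (g x) (Tr_intg x d'0 Lf).
  have i3 := intgZ (f x) (Tr_intg x d0 Lg); have i4 := intgZ (f x) (Tr_intg x d'0 Lg).
  transitivity (\int[mu]_y ((g x * (f y * kd s om delta (x - y)) -
      g x * (f y * kd s om delta' (x - y))) -
     (f x * (g y * kd s om delta (x - y)) - f x * (g y * kd s om delta' (x - y))))).
    by apply: eq_Rintegral => y _; rewrite /H /kap; ring.
  apply: (etrans (RintegralB4 i1 i2 i3 i4)).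
  congr ((_ - _) - (_ - _)).
  - exact: (RintegralZl (g x) measurableT (Tr_intg x d0 Lf)).
  - exact: (RintegralZl (g x) measurableT (Tr_intg x d'0 Lf)).
  - exact: (RintegralZl (f x) measurableT (Tr_intg x d0 Lg)).
  - exact: (RintegralZl (f x) measurableT (Tr_intg x d'0 Lg)).
(* Each pairing is added to its swapped form, whose sign [Pr_anti] reverses; hence the factor 2. *)
have E : 2 * (Pr om mu delta f g - Pr om mu delta' f g) =
    \int[mu]_x \int[mu]_y H x y.
  transitivity (\int[mu]_x ((g x * T1 f x - g x * T2 f x) -
      (f x * T1 g x - f x * T2 g x))); last first.
    by apply: eq_Rintegral => x _; rewrite HE.
  apply: etrans (esym (RintegralB4 if1 if2 ig1 ig2)).
  have N1 : Pr om mu delta f g = - \int[mu]_x (f x * T1 g x).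
    apply: (etrans D1); rewrite -mulN1r.
    apply: etrans (RintegralZl (-1) measurableT ig1).
    by apply: eq_Rintegral => y _; rewrite mulN1r mulrN.
  have N2 : Pr om mu delta' f g = - \int[mu]_x (f x * T2 g x).
    apply: (etrans D2); rewrite -mulN1r.
    apply: etrans (RintegralZl (-1) measurableT ig2).
    by apply: eq_Rintegral => y _; rewrite mulN1r mulrN.
  have alg (p q p' q' : R) : p = - p' -> q = - q' -> 2 * (p - q) = (p - q) - (p' - q').
    by move=> -> ->; ring.
  exact: alg N1 N2.
have A0 : 0 <= 4 * L * M by rewrite !mulr_ge0.
have Hin x : \int[mu]_y `|H x y| <= 4 * L * M * (Cnear s Lam * delta).
  have [] // := @intg_near _ _ s Lam mu Lam0 nmu (H x) x (4 * L * M) delta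
    (intg_measurable (iH x)) A0 d0 s0.
  - move=> y hy; rewrite /H /kap !kd_far ?subrr ?mul0r// enormB//.
    exact: le_trans hy.
  - by rewrite /H /kap subrr !(kd0 _ omP) subrr mul0r.
  - by move=> y _ y0; exact: antisym_le.
have Hzero x : ~ eball 0 N x -> \int[mu]_y H x y = 0.
  move=> /negP; rewrite /eball/= subr0 -leNgt => xN.
  have alg (a b c e : R) : 0 * a - 0 * b - (0 * c - 0 * e) = 0 by ring.
  by rewrite HE (fN x xN) (gN x xN); exact: alg.
have HM x : `|\int[mu]_y H x y| <= 4 * L * M * (Cnear s Lam * delta).
  by apply: le_trans (Hin x); exact: (le_normr_Rintegral measurableT (iH x)).
have mH : measurable_fun setT (fun x : X => \int[mu]_y H x y).
  apply: (intg_measurable (mu := mu)); rewrite (_ : (fun x => _) =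
    fun x => (g x * T1 f x - g x * T2 f x) - (f x * T1 g x - f x * T2 g x)).
    exact: (intgB (intgB if1 if2) (intgB ig1 ig2)).
  by apply/funext => x; rewrite HE.
have [i h] := @intg_bounded _ _ s Lam mu nmu _ _ 0 N N0 mH HM Hzero.
have := le_trans (le_normr_Rintegral measurableT i) h.
by rewrite -E normrM (ger0_norm (ler0n R 2)); exact: halve_le.
Qed.

End pairing.

(** * Riesz representation *)

Section indicator_bounds.
Context {dd : measure_display} {T : measurableType dd} {R : realType}.
Variable mu : {measure set T -> \bar R}.

Lemma intg_le_indic (E : set T) (h : T -> R) : measurable E -> (mu E < +oo)%E ->
  measurable_fun setT h -> (forall x, 0 <= h x <= 1) -> (forall x, ~ E x -> h x = 0) ->
  intg mu h /\ \int[mu]_x h x <= fine (mu E).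
Proof.
move=> mE Ey mh h01 h0; apply: intg_ge0 => //; first by move=> x; case/andP: (h01 x).
rewrite fineK ?ge0_fin_numE//.
apply: (@le_trans _ _ (\int[mu]_x (\1_E x)%:E)%E); last by rewrite integral_indic// setIT.
apply: ge0_le_integral => //.
- by move=> x _; rewrite lee_fin; case/andP: (h01 x).
- exact/measurable_EFinP.
- by apply/measurable_EFinP; exact: measurable_indic.
- move=> x _; rewrite lee_fin indicE; case: (boolP (x \in E)) => Ex.
    by case/andP: (h01 x).
  by rewrite h0//; move/negP: Ex; rewrite inE.
Qed.

Lemma ge_indic_int (E : set T) (h : T -> R) : measurable E -> (mu E < +oo)%E ->
  intg mu h -> (forall x, 0 <= h x) -> (forall x, E x -> 1 <= h x) ->
  fine (mu E) <= \int[mu]_x h x.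
Proof.
move=> mE Ey jh h0 h1; rewrite -lee_fin fineK ?ge0_fin_numE// EFin_Rintegral//.
apply: (@le_trans _ _ (\int[mu]_x (\1_E x)%:E)%E); first by rewrite integral_indic// setIT.
apply: ge0_le_integral => //.
- by apply/measurable_EFinP; exact: measurable_indic.
- exact/measurable_EFinP/(intg_measurable jh).
- move=> x _; rewrite lee_fin indicE; case: (boolP (x \in E)) => Ex //=.
  by apply: h1; rewrite inE in Ex.
Qed.

End indicator_bounds.

Section riesz.
Context (R : realType) (d : nat).
Local Notation V := 'rV[R]_d.
Local Notation X := (Rd R d).

(** The distance to the complement of [O], capped at 1 so that it also makes sense when [O] is the
    whole space. It is 1-Lipschitz and, for open [O], positive exactly on [O]. *)
Definition dfun (O : set V) (x : V) : R :=
  sup [set r : R | 0 <= r <= 1 /\ eball x r `<=` O].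

Lemma dfun_sup (O : set V) (x : V) :
  has_sup [set r : R | 0 <= r <= 1 /\ eball x r `<=` O].
Proof.
split; last by exists 1 => r [/andP[]].
exists 0; split; first by rewrite lexx ler01.
by move=> y; rewrite /eball/= ltNge enorm_ge0.
Qed.

Lemma dfun_ge0 O x : 0 <= dfun O x.
Proof.
apply: (ub_le_sup (dfun_sup O x).2); split; first by rewrite lexx ler01.
by move=> y; rewrite /eball/= ltNge enorm_ge0.
Qed.

Lemma dfun0 (O : set V) x : ~ O x -> dfun O x = 0.
Proof.
move=> Ox; apply/eqP; rewrite eq_le dfun_ge0 andbT.
apply: (ge_sup (dfun_sup O x).1) => r [/andP[r0 _] h].
rewrite leNgt; apply/negP => rp; apply: Ox; apply: h.
by rewrite /eball/= subrr enorm0.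
Qed.

Lemma dfun_gt0 (O : set V) x : open O -> O x -> 0 < dfun O x.
Proof.
move=> oO Ox; have /nbhs_eballP[r r0 rO] : nbhs x O by apply: open_nbhs_nbhs.
have m0 : 0 < Num.min r 1 by rewrite lt_min r0 ltr01.
apply: (lt_le_trans m0); apply: (ub_le_sup (dfun_sup O x).2).
split; first by rewrite (ltW m0) ge_min lexx orbT.
by move=> y; rewrite /eball/= lt_min => /andP[h _]; exact: rO.
Qed.

Lemma dfun_lip O (x y : V) : dfun O x <= dfun O y + enorm (y - x).
Proof.
apply: (ge_sup (dfun_sup O x).1) => r [/andP[r0 r1] h].
rewrite -lerBlDr; have [ry|ry] := leP 0 (r - enorm (y - x)); last first.
  by apply: (le_trans (ltW ry)); exact: dfun_ge0.
apply: (ub_le_sup (dfun_sup O y).2); split.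
  by rewrite ry/= (le_trans _ r1)// gerBl enorm_ge0.
move=> z; rewrite /eball/= => hz; apply: h; rewrite /eball/=.
by have := enorm_triangle y z x; move: hz; lra.
Qed.

Lemma dfun_cont O : continuous (dfun O).
Proof.
apply/continuous_enormP => x e e0; exists e => // y ye.
have h1 := dfun_lip O x y; have h2 := dfun_lip O y x; rewrite (enormB x y) in h2.
by rewrite ltr_norml; apply/andP; split; lra.
Qed.

Variable lam : (V -> R) -> R.
Hypothesis lamD : forall f g, Cc f -> Cc g -> lam (fun x => f x + g x) = lam f + lam g.
Hypothesis lamZ : forall a f, Cc f -> lam (fun x => a * f x) = a * lam f.
Hypothesis lam_le : forall f g, Cc f -> Cc g -> (forall x, f x <= g x) -> lam f <= lam g.

Lemma lam0 : lam (fun=> 0) = 0.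
Proof.
have h := @lamZ 0 _ (@Cc_cst0 R d); rewrite [RHS]mul0r in h.
by rewrite -[RHS]h; congr lam; apply/funext => x; rewrite mul0r.
Qed.

Lemma lam_ge0 f : Cc f -> (forall x, 0 <= f x) -> 0 <= lam f.
Proof. by move=> Cf f0; rewrite -lam0; apply: lam_le => //; exact: Cc_cst0. Qed.

Lemma lamB f g : Cc f -> Cc g -> lam (fun x => f x - g x) = lam f - lam g.
Proof.
move=> Cf Cg; rewrite -[- lam g]mulN1r -lamZ// -lamD//; last exact: CcZ.
by congr lam; apply/funext => x; rewrite mulN1r.
Qed.

Lemma lam_sum (I : Type) (r : seq I) (F : I -> V -> R) :
  (forall i, Cc (F i)) -> lam (fun x => \sum_(i <- r) F i x) = \sum_(i <- r) lam (F i).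
Proof.
move=> cF; elim: r => [|i r ih].
  rewrite big_nil -[RHS]lam0; congr lam; apply/funext => x; by rewrite big_nil.
rewrite big_cons -ih -lamD//; last exact: Cc_sum.
by congr lam; apply/funext => x; rewrite big_cons.
Qed.

(** [f] has to vanish off [O], but its closed support may reach the boundary; the proofs below
    recover room by giving up a small [eta]. *)
Definition adm (O : set V) (f : V -> R) : Prop :=
  [/\ Cc f, forall x, 0 <= f x <= 1 & forall x, ~ O x -> f x = 0].

Lemma adm0 O : adm O (fun=> 0).
Proof. by split=> // [|x]; [exact: Cc_cst0|rewrite lexx ler01]. Qed.

Definition nuo (O : set V) : \bar R := ereal_sup [set (lam f)%:E | f in adm O].

Definition nus (A : set V) : \bar R :=
  ereal_inf [set nuo O | O in [set O | open O /\ A `<=` O]].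

Lemma nuo_ge (O : set V) f : adm O f -> ((lam f)%:E <= nuo O)%E.
Proof. by move=> h; apply: ereal_sup_ubound; exists f. Qed.

Lemma nuo_le (O : set V) (c : \bar R) :
  (forall f, adm O f -> ((lam f)%:E <= c)%E) -> (nuo O <= c)%E.
Proof. by move=> h; apply: ge_ereal_sup => _ [f /h + <-]. Qed.

Lemma nuo_ge0 O : (0 <= nuo O)%E.
Proof. by have := nuo_ge (adm0 O); rewrite lam0. Qed.

Lemma nuo_mono (O O' : set V) : O `<=` O' -> (nuo O <= nuo O')%E.
Proof.
move=> OO'; apply: nuo_le => f [h1 h2 h3]; apply: nuo_ge; split=> // x Ox.
by apply: h3 => /OO'.
Qed.

Lemma nus_ge0 A : (0 <= nus A)%E.
Proof. by apply: le_ereal_inf_tmp => _ [Q _ <-]; exact: nuo_ge0. Qed.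

Lemma nus_le (A O : set V) : open O -> A `<=` O -> (nus A <= nuo O)%E.
Proof. by move=> oO AO; apply: ereal_inf_lbound; exists O. Qed.

Lemma nus_open (O : set V) : open O -> nus O = nuo O.
Proof.
move=> oO; apply/eqP; rewrite eq_le nus_le//=.
by apply: le_ereal_inf_tmp => _ [Q [_ OQ] <-]; exact: nuo_mono.
Qed.

Lemma nus_mono (A B : set V) : A `<=` B -> (nus A <= nus B)%E.
Proof.
move=> AB; apply: le_ereal_inf_tmp => _ [Q [oQ BQ] <-]; apply: nus_le => //.
exact: subset_trans BQ.
Qed.

Lemma nus0 : nus set0 = 0%E.
Proof.
apply/eqP; rewrite eq_le nus_ge0 andbT nus_open; last exact: open0.
apply: nuo_le => f [_ _ f0]; rewrite lee_fin (_ : f = fun=> 0) ?lam0//.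
by apply/funext => x; apply: f0.
Qed.

Lemma nuo_adherent (O : set V) (e : R) : (nuo O < +oo)%E -> 0 < e ->
  exists2 f, adm O f & (nuo O <= (lam f + e)%:E)%E.
Proof.
move=> h e0.
have nf : nuo O \is a fin_num by rewrite ge0_fin_numE ?nuo_ge0.
have [_ [f Of <-]] := ub_ereal_sup_adherent e0 nf.
rewrite lteBlDr// => h2; exists f => //.
exact: ltW.
Qed.

(* Dini: on the compact set [f >= eta] the increasing functions
   [n * \sum_(i < n) dfun (O i)] eventually exceed 1. *)
Lemma cover_approx (O : nat -> set V) f (eta : R) : (forall i, open (O i)) ->
  adm (\bigcup_i O i) f -> 0 < eta ->
  exists n : nat, forall x, f x <= Num.min (f x) (n%:R * \sum_(i < n) dfun (O i) x) + eta.
Proof.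
move=> oO [Cf f01 f0] eta0.
have cK : compact [set x | eta <= f x].
  have [N [_ N0] fN] := Cc_support 0 Cf.
  apply: (@compact_eball_closed _ _ N).
    have : continuous f by case: Cf.
    rewrite continuous_closedP => /(_ _ (@closed_ge R eta)); apply.
  move=> x /= h; rewrite leNgt; apply/negP => /ltW /fN fx.
  by rewrite fx leNgt eta0 in h.
have /compact_near_coveringP K := cK.
have K2 := K nat \oo (fun n x => 1 <= n%:R * \sum_(i < n) dfun (O i) x) _.
have [] := K2.
  move=> x /= ex.
  have [i _ Oix] : (\bigcup_i O i) x.
    by apply: contrapT => /f0 fx; rewrite fx leNgt eta0 in ex.
  have d0 := dfun_gt0 (oO i) Oix.
  pose n0 := maxn i.+1 (Num.truncn (2 / dfun (O i) x)).+1.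
  exists (eball x (dfun (O i) x / 2), [set n | (n0 <= n)%N]) => /=.
    split; last by exists n0.
    by apply/nbhs_eballP; exists (dfun (O i) x / 2) => //; rewrite divr_gt0.
  move=> [x' n] [/= hx' hn].
  have ni : (i < n)%N by apply: leq_trans hn; rewrite leq_maxl.
  have h1 : dfun (O i) x / 2 <= dfun (O i) x'.
    have := dfun_lip (O i) x x'; rewrite /eball/= in hx'; lra.
  have h2 : 2 / dfun (O i) x <= n%:R.
    apply: (le_trans (ltW (truncnS_gt _))); rewrite ler_nat.
    by apply: leq_trans hn; rewrite leq_maxr.
  apply: (@le_trans _ _ (2 / dfun (O i) x * (dfun (O i) x / 2))).
    by rewrite le_eqVlt; apply/orP; left; apply/eqP; field; rewrite gt_eqF.
  apply: ler_pM => //.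
  - by rewrite divr_ge0// ltW.
  - by rewrite divr_ge0// ltW.
  apply: (le_trans h1); rewrite (bigD1 (Ordinal ni))//= lerDl sumr_ge0// => j _.
  exact: dfun_ge0.
move=> n _ /(_ n (leqnn n)) h; exists n => x.
have [ex|ex] := leP eta (f x).
  have /andP[_ f1] := f01 x.
  by rewrite min_l ?lerDl ?(ltW eta0)//; apply: (le_trans f1); exact: h.
apply: (le_trans (ltW ex)); rewrite lerDr le_min.
have /andP[-> _] := f01 x; rewrite mulr_ge0// sumr_ge0// => i _.
exact: dfun_ge0.
Qed.

Lemma nuo_subadd (O : nat -> set V) : (forall i, open (O i)) ->
  (nuo (\bigcup_i O i) <= \sum_(i <oo) nuo (O i))%E.
Proof.
move=> oO; apply: nuo_le => f Of; have [Cf f01 f0] := Of.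
have fge0 x : 0 <= f x by case/andP: (f01 x).
have cD n : continuous (fun x => n%:R * \sum_(i < n) dfun (O i) x).
  by apply: contZ; apply: cont_sum => i; exact: dfun_cont.
apply/lee_addgt0Pr => e e0.
pose S n i x := n%:R * \sum_(j < i) dfun (O j) x.
have S0 n i x : 0 <= S n i x.
  by rewrite mulr_ge0// sumr_ge0// => j _; exact: dfun_ge0.
have CS n i : Cc (fun x => Num.min (f x) (S n i x)).
  apply: Cc_min0 => //.
  by apply: contZ; apply: cont_sum => j; exact: dfun_cont.
have Smono n i x : S n i x <= S n i.+1 x.
  by rewrite /S ler_wpM2l// big_ord_recr/= lerDl dfun_ge0.
(* In place of a partition of unity, [f] is truncated at successive partial sums. The increment at
   stage [i] vanishes off [O i], because only [dfun (O i)] has been added. *)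
pose F n i x := Num.min (f x) (S n i.+1 x) - Num.min (f x) (S n i x).
have CF n i : Cc (F n i) by exact: CcB.
have AF n i : adm (O i) (F n i).
  split=> // [x|x Ox]; last first.
    by rewrite /F /S big_ord_recr/= dfun0// addr0 subrr.
  have /andP[_ f1] := f01 x; have := Smono n i x; have := S0 n i x.
  rewrite /F !minEle; have := fge0 x => h0 h1 h2.
  case: (leP (f x) (S n i.+1 x)) => h3; case: (leP (f x) (S n i x)) => h4;
    by apply/andP; split; lra.
have sumF n x : \sum_(i < n) F n i x = Num.min (f x) (S n n x).
  rewrite -(big_mkord xpredT (fun i => F n i x)) telescope_sumr//.
  by rewrite /S big_ord0 mulr0 (min_r (fge0 x)) subr0.
(* [C] is the value of the functional on a cutoff equal to 1 on the support of [f], so a pointwise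
   loss of [eta] costs [eta * C]. *)
have [C C0 hC] : exists2 C : R, 0 <= C & forall eta g,
  0 <= eta -> Cc g -> (forall x, 0 <= g x) ->
  (forall x, f x <= g x + eta) -> lam f <= lam g + eta * C.
  have [N [_ N0] fN] := Cc_support 0 Cf.
  have Cx := cutoff_Cc (0 : V) N0.
  exists (lam (cutoff 0 N)); first by apply: lam_ge0 => // x; exact: cutoff_ge0.
  move=> eta g eta0 Cg g0 fg.
  have Ce := CcZ eta Cx.
  rewrite -lamZ// -lamD//; apply: lam_le => //; first exact: CcD.
  move=> x; have [xN|xN] := leP (enorm x) N.
    by rewrite cutoff1 ?subr0// mulr1.
  by rewrite (fN x (ltW xN)) addr_ge0// mulr_ge0// cutoff_ge0.
pose eta := e / (C + 1).
have C1 : 0 < C + 1 by lra.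
have eta0 : 0 < eta by rewrite divr_gt0.
have [n hn] := cover_approx oO Of eta0.
have h := hC eta _ (ltW eta0) (CS n n) _ hn.
have {h} h : lam f <= lam (fun x => Num.min (f x) (S n n x)) + e.
  apply: (@le_trans _ _ (lam (fun x => Num.min (f x) (S n n x)) + eta * C)).
    by apply: h => x; rewrite le_min fge0 S0.
  rewrite lerD2l /eta mulrAC ler_pdivrMr// ler_wpM2l ?(ltW e0)//; lra.
apply: (@le_trans _ _ ((\sum_(i < n) lam (F n i))%:E + e%:E)%E).
  rewrite -EFinD lee_fin; apply: (le_trans h); rewrite lerD2r.
  rewrite -[leRHS]lam_sum// le_eqVlt; apply/orP; left; apply/eqP.
  by congr lam; apply/funext => x; rewrite sumF.
rewrite leeD2r// -sumEFin.
apply: (@le_trans _ _ (\sum_(i < n) nuo (O i))%E).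
  by apply: lee_sum => i _; exact: nuo_ge.
rewrite -(big_mkord xpredT (fun i => nuo (O i))).
by apply: nneseries_lim_ge => k _ _; exact: nuo_ge0.
Qed.

Lemma nus_sigma_subadd : sigma_subadditive nus.
Proof.
move=> A; have [[i ioo]|] := pselect (exists i, nus (A i) = +oo%E).
  rewrite (eseries_pinfty _ _ ioo) ?leey// => n _.
  by rewrite -ltNye (lt_le_trans _ (nus_ge0 _)).
rewrite -forallNE => Aoo.
apply/lee_addgt0Pr => e e0.
rewrite (le_trans _ (epsilon_trick _ _ (ltW e0)))//; last first.
  by move=> n; exact: nus_ge0.
pose P n (O : set V) := [/\ open O, A n `<=` O &
  (nuo O <= nus (A n) + (e / (2 ^ n.+1)%:R)%:E)%E].
have [G PG] : {G : nat -> set V & forall n, P n (G n)}.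
  apply: (@choice _ _ P) => n.
  have en1 : 0 < e / (2 ^ n.+1)%:R by rewrite divr_gt0// ltr0n expn_gt0.
  have nf : nus (A n) \is a fin_num.
    by rewrite ge0_fin_numE ?nus_ge0// ltey; apply/eqP.
  have [_ [Q [oQ AQ] <-] h] := lb_ereal_inf_adherent en1 nf.
  by exists Q; split=> //; exact: ltW.
apply: (@le_trans _ _ (nuo (\bigcup_n G n))).
  apply: nus_le; first by apply: bigcup_open => n _; case: (PG n).
  by apply: subset_bigcup => n _; case: (PG n).
apply: (le_trans (nuo_subadd _)); first by move=> n; case: (PG n).
by apply: lee_nneseries => [n _ _|n _]; [exact: nuo_ge0|case: (PG n)].
Qed.

(** Near-optimal functions are taken for [W] inside [O] and for the part of [W] where the first
    function is below [eta]. After the first is cut by [eta], the two are nonzero on disjoint sets,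
    so their sum is admissible for [W]. *)
Lemma nus_caratheodory (O : set V) : open O -> caratheodory_measurable nus O.
Proof.
move=> oO; pose m : {outer_measure set V -> \bar R} :=
  HB.pack_for (outer_measure R V) nus
    (isOuterMeasure.Build R V nus nus0 nus_ge0 nus_mono nus_sigma_subadd).
apply: (@le_caratheodory_measurable R V m) => A /=.
apply: le_ereal_inf_tmp => _ [W [oW AW] <-].
have [Wy|] := ltP (nuo W) +oo%E; last by move=> h; apply: le_trans h; exact: leey.
have oWO : open (W `&` O) by exact: openI.
have fin1 : (nuo (W `&` O) < +oo)%E.
  by apply: le_lt_trans Wy; apply: nuo_mono; exact: subIsetl.
apply/lee_addgt0Pr => e e0.
have e40 : 0 < e / 4 by rewrite divr_gt0.
have [f [Cf f01 f0] hf] := nuo_adherent fin1 e40.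
have fge0 x : 0 <= f x by case/andP: (f01 x).
have [N [_ N0] fN] := Cc_support 0 Cf.
have Cx := cutoff_Cc (0 : V) N0.
set C := lam (cutoff 0 N).
have C0 : 0 <= C by apply: lam_ge0 => // x; exact: cutoff_ge0.
have C1 : 0 < C + 1 by lra.
pose eta := e / 4 / (C + 1).
have eta0 : 0 < eta by rewrite divr_gt0.
(* subtracting [eta] moves the support of [f] inside the closed set [eta <= f] *)
pose f' x := f x - Num.min (f x) eta.
have Cf' : Cc f'.
  by apply: CcB => //; apply: Cc_min0 => // [|x]; [exact: cont_cst|exact: ltW].
have f'_ge0 x : 0 <= f' x by rewrite subr_ge0 ge_min lexx.
have f'_le x : f' x <= f x by rewrite gerBl le_min fge0 ltW.
have hlam : lam f <= lam f' + e / 4.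
  apply: (@le_trans _ _ (lam f' + eta * C)).
    rewrite /C -lamZ// -lamD//; last exact: CcZ.
    apply: lam_le => //; first by apply: CcD => //; exact: CcZ.
    move=> x; have [xN|xN] := leP (enorm x) N.
      rewrite cutoff1 ?subr0// mulr1 /f'.
      by rewrite -addrA lerDl addrC subr_ge0 ge_min lexx orbT.
    by rewrite (fN x (ltW xN)) addr_ge0// mulr_ge0 ?cutoff_ge0// ltW.
  rewrite lerD2l /eta mulrAC ler_pdivrMr// ler_wpM2l ?(ltW e40)//; lra.
have oK : open (W `&` [set x | f x < eta]).
  apply: openI => //.
  have : continuous f by case: Cf.
  by move=> /continuousP /(_ _ (@open_lt R eta)); apply.
have fin2 : (nuo (W `&` [set x | (f x < eta)%R]) < +oo)%E.
  by apply: le_lt_trans Wy; apply: nuo_mono; exact: subIsetl.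
have [g [Cg g01 g0] hg] := nuo_adherent fin2 e40.
have h1 : (nus (A `&` O) <= nuo (W `&` O))%E.
  by apply: nus_le => // x [/AW].
have h2 : (nus (A `&` ~` O) <= nuo (W `&` [set x | (f x < eta)%R]))%E.
  apply: nus_le => // x [/AW Wx Ox]; split=> //=.
  by rewrite f0// => -[].
have h3 : ((lam f' + lam g)%:E <= nuo W)%E.
  rewrite -lamD//; apply: nuo_ge; split=> [|x|x Wx]; first exact: CcD.
  - have /andP[g0' g1] := g01 x; have /andP[_ f1] := f01 x.
    rewrite addr_ge0//=; have [fe|fe] := ltP (f x) eta.
      by rewrite /f' min_l ?(ltW fe)// subrr add0r.
    rewrite (g0 x) ?addr0; first exact: le_trans f1.
    by case=> _ /=; rewrite ltNge fe.
  - rewrite g0; last by case.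
    by rewrite addr0 /f' f0 ?min_l ?subrr ?ltW//; case.
apply: (le_trans (leeD h1 h2)); apply: (le_trans (leeD hf hg)).
apply: (@le_trans _ _ ((lam f' + lam g)%:E + e%:E)%E); last by rewrite leeD2r.
by rewrite -!EFinD lee_fin; lra.
Qed.

Lemma nus_sub_cara : (@measurable _ X) `<=` caratheodory_measurable nus.
Proof.
pose m : {outer_measure set V -> \bar R} :=
  HB.pack_for (outer_measure R V) nus
    (isOuterMeasure.Build R V nus nus0 nus_ge0 nus_mono nus_sigma_subadd).
apply: smallest_sub; last by move=> O oO; exact: nus_caratheodory.
exact: (sigma_algebra_measurable (caratheodory_type m)).
Qed.

Lemma nus_semi_sigma_additive : semi_sigma_additive (nus : set X -> \bar R).
Proof.
pose m : {outer_measure set V -> \bar R} :=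
  HB.pack_for (outer_measure R V) nus
    (isOuterMeasure.Build R V nus nus0 nus_ge0 nus_mono nus_sigma_subadd).
move=> F mF tF mUF.
apply: (@caratheodory_measure_sigma_additive R V m F) => //.
- by move=> n; exact: nus_sub_cara.
- exact: nus_sub_cara.
Qed.

Definition riesz_measure : bmeasure R d :=
  HB.pack_for (bmeasure R d) (nus : set X -> \bar R)
    (isMeasure.Build _ X R (nus : set X -> \bar R) nus0 nus_ge0 nus_semi_sigma_additive).

Local Notation nu := riesz_measure.

Lemma riesz_open (O : set V) : open O -> nu O = nuo O.
Proof. exact: nus_open. Qed.

Lemma riesz_open_le (O : set V) (c : R) : open O ->
  (forall f, adm O f -> lam f <= c) -> (nu O <= c%:E)%E.
Proof.
by move=> oO h; rewrite riesz_open//; apply: nuo_le => f /h; rewrite lee_fin.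
Qed.

Lemma open_superlevel (f : V -> R) (t : R) : continuous f -> open [set x | t < f x].
Proof. by move=> /continuousP /(_ _ (@open_gt R t)); apply. Qed.

Lemma riesz_super_lty f (t : R) : Cc f -> 0 <= t -> (nu [set x | (t < f x)%R] < +oo)%E.
Proof.
move=> Cf t0; have [N [_ N0] fN] := Cc_support 0 Cf.
apply: le_lt_trans (ltry (lam (cutoff 0 N))).
apply: riesz_open_le; first by apply: open_superlevel; case: Cf.
move=> g [Cg g01 g0]; apply: lam_le => //; first exact: cutoff_Cc.
move=> x; have [xN|xN] := leP (enorm x) N.
  by rewrite cutoff1 ?subr0//; case/andP: (g01 x).
rewrite g0 ?cutoff_ge0//= (fN x (ltW xN)); apply/negP; by rewrite -leNgt.
Qed.

(** [f] is cut into [n.+1] horizontal slices; both the functional and the integral of a slice lie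
    between the measures of two consecutive superlevel sets. The gaps telescope, so the error is at
    most [A / n.+1] for every [n]. *)
Lemma riesz_unit f : Cc f -> (forall x, 0 <= f x <= 1) ->
  intg nu f /\ \int[nu]_x f x = lam f.
Proof.
move=> Cf f01; have cf : continuous f by case: Cf.
have fge0 x : 0 <= f x by case/andP: (f01 x).
have mE t : measurable ([set x | t < f x] : set X).
  by apply: open_measurable_Rd; exact: open_superlevel.
have E0 t : 0 <= t -> (nu [set x | (t < f x)%R] < +oo)%E by exact: riesz_super_lty.
pose A := fine (nu [set x | (0 < f x)%R]).
have A0 : 0 <= A by rewrite fine_ge0.
have mf : measurable_fun setT (f : X -> R) by exact: continuous_measurable_Rd.
have jf : intg nu f.
  have [] // := intg_le_indic (mE 0) (E0 0 (lexx 0)) mf f01.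
  by move=> x /negP; rewrite -leNgt => h; apply/eqP; rewrite eq_le fge0 h.
split=> //.
suff h n : n.+1%:R * `|lam f - \int[nu]_x f x| <= A.
  apply/eqP; rewrite eq_sym -subr_eq0 -normr_eq0; apply/negPn/negP => c0.
  have cp : 0 < `|lam f - \int[nu]_x f x| by rewrite lt_def normr_ge0 andbT.
  have := h (Num.truncn (A / `|lam f - \int[nu]_x f x|)).
  by rewrite leNgt -ltr_pdivrMr// truncnS_gt.
pose t k : R := k%:R / n.+1%:R.
have t0 k : 0 <= t k by rewrite divr_ge0.
have tS k : t k.+1 = t k + n.+1%:R^-1 by rewrite /t -natr1 mulrDl mul1r.
have n0 : 0 < n.+1%:R :> R by rewrite ltr0n.
have ni : 0 < n.+1%:R^-1 :> R by rewrite invr_gt0.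
pose E k : set X := [set x | t k < f x].
pose F k x := n.+1%:R * (Num.min (f x) (t k.+1) - Num.min (f x) (t k)).
have CF k : Cc (F k).
  by apply: CcZ; apply: CcB; (apply: Cc_min0 => //; exact: cont_cst).
have F01 k x : 0 <= F k x <= 1.
  rewrite /F tS mulr_ge0 ?ler0n//=.
    rewrite mulrC -ler_pdivlMr// div1r; move: n.+1%:R^-1 ni (t k) (f x) => i i0 u v.
    by rewrite !minEle; case: (leP v (u + i)) => h1; case: (leP v u) => h2; lra.
  by rewrite subr_ge0 le_min !ge_min lexx/= lerDl (ltW ni) orbT.
have F0 k x : ~ E k x -> F k x = 0.
  move=> /negP; rewrite -leNgt => h.
  by rewrite /F tS !min_l ?subrr ?mulr0//; apply: (le_trans h); rewrite lerDl ltW.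
have F1 k x : E k.+1 x -> F k x = 1.
  rewrite /E/= => h; rewrite /F !min_r ?(ltW h)//.
    by rewrite tS addrAC subrr add0r mulfV// gt_eqF.
  by apply: le_trans (ltW h); rewrite tS lerDl ltW.
pose a k := fine (nu (E k)).
have Ea k : (a k)%:E = nu (E k).
  by rewrite fineK// ge0_fin_numE//; exact: E0.
have mF k : measurable_fun setT (F k : X -> R).
  by apply: continuous_measurable_Rd; case: (CF k).
have lam_hi k : lam (F k) <= a k.
  rewrite -lee_fin Ea riesz_open; last exact: open_superlevel.
  by apply: nuo_ge; split; [exact: CF|exact: F01|exact: F0].
have lam_lo k : a k.+1 <= lam (F k).
  rewrite -lee_fin Ea; apply: riesz_open_le; first exact: open_superlevel.
  move=> g [Cg g01 g0]; apply: lam_le => // x.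
  have [Ex|Ex] := pselect (E k.+1 x); first by rewrite F1//; case/andP: (g01 x).
  by rewrite g0//; case/andP: (F01 k x).
have jF k := intg_le_indic (mE (t k)) (E0 _ (t0 k)) (mF k) (F01 k) (F0 k).
have int_lo k : a k.+1 <= \int[nu]_x F k x.
  apply: ge_indic_int; [exact: mE|exact: E0|exact: (jF k).1| |].
  - by move=> x; case/andP: (F01 k x).
  - by move=> x Ex; rewrite F1.
have sumF x : \sum_(k < n.+1) F k x = n.+1%:R * f x.
  rewrite /F -mulr_sumr; congr (_ * _).
  rewrite -(big_mkord xpredT (fun k => Num.min (f x) (t k.+1) - Num.min (f x) (t k))).
  rewrite (telescope_sumr (fun k => Num.min (f x) (t k)))// /t mul0r (min_r (fge0 x)) subr0.
  by rewrite mulfV ?gt_eqF// min_l//; case/andP: (f01 x).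
have eL : n.+1%:R * lam f = \sum_(k < n.+1) lam (F k).
  rewrite -lamZ// -lam_sum//; congr lam; apply/funext => x; by rewrite sumF.
have eI : n.+1%:R * \int[nu]_x f x = \sum_(k < n.+1) \int[nu]_x F k x.
  rewrite -(RintegralZl n.+1%:R measurableT jf) -Rintegral_sum; last by move=> k; exact: (jF k).1.
  by apply: eq_Rintegral => x _; rewrite sumF.
rewrite -[X in X * _](gtr0_norm n0) -normrM mulrBr eL eI -sumrB.
apply: (le_trans (ler_norm_sum _ _ _)).
apply: (@le_trans _ _ (\sum_(k < n.+1) (a k - a k.+1))).
  apply: ler_sum => k _; have := lam_hi k; have := lam_lo k; have := (jF k).2.
  rewrite -/(E k) -/(a k); have := int_lo k.
  by move: (\int[nu]_x F k x) (lam (F k)) => p q *; rewrite ler_norml; apply/andP; split; lra.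
rewrite -(big_mkord xpredT (fun k => a k - a k.+1)).
under eq_bigr do rewrite -opprB.
rewrite sumrN telescope_sumr// opprB.
have -> : a 0%N = A by rewrite /a /A /E /t mul0r.
by rewrite gerBl fine_ge0.
Qed.

Lemma riesz_repr f : Cc f -> intg nu f /\ \int[nu]_x f x = lam f.
Proof.
move=> Cf; have [M M0 fM] := Cc_bounded Cf.
pose g1 x := M^-1 * Num.max (f x) 0.
pose g2 x := M^-1 * Num.max (-1 * f x) 0.
have C1 : Cc g1 by apply: CcZ; apply: Cc_max => //; exact: Cc_cst0.
have C2 : Cc g2 by apply: CcZ; apply: Cc_max; [exact: CcZ|exact: Cc_cst0].
have u1 x : 0 <= g1 x <= 1.
  rewrite mulr_ge0 ?invr_ge0 ?(ltW M0) ?le_max ?lexx ?orbT//=.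
  rewrite ler_pdivrMl// mulr1 ge_max (ltW M0) andbT.
  exact: le_trans (ler_norm _) (fM x).
have u2 x : 0 <= g2 x <= 1.
  rewrite mulr_ge0 ?invr_ge0 ?(ltW M0) ?le_max ?lexx ?orbT//=.
  rewrite ler_pdivrMl// mulr1 ge_max (ltW M0) andbT mulN1r.
  by apply: le_trans (ler_norm _) _; rewrite normrN.
have [i1 e1] := riesz_unit C1 u1; have [i2 e2] := riesz_unit C2 u2.
have E : f = fun x => M * g1 x - M * g2 x.
  apply/funext => x; rewrite /g1 /g2 !mulrA mulfV ?gt_eqF// !mul1r mulN1r !maxEle.
  case: (leP (f x) 0) => h; first by case: (leP (- f x) 0) => h2; lra.
  by case: (leP (- f x) 0) => h2; lra.
have j1 := intgZ M i1; have j2 := intgZ M i2.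
split; first by rewrite E; exact: intgB.
rewrite {2}E lamB; [|exact: CcZ|exact: CcZ].
rewrite (lamZ M C1) (lamZ M C2) -e1 -e2.
rewrite -(RintegralZl M measurableT i1) -(RintegralZl M measurableT i2).
rewrite -(RintegralB measurableT j1 j2).
by apply: eq_Rintegral => x _; rewrite {1}E.
Qed.

End riesz.

(** * Weak limits along an ultrafilter *)

Section ultra.
Context {R : realType}.
Variables (U : set_system nat) (UF : UltraFilter U).

Lemma ultra_fmap (T : Type) (a : nat -> T) : UltraFilter (a @ U).
Proof.
split; first exact: fmap_proper_filter.
move=> G PG sub; apply/seteqP; split; last exact: sub.
move=> A GA; have [//|h] := in_ultra_setVsetC (a @^-1` A) UF.
have GC : G (~` A) by exact: sub.
have G0 : G set0 by rewrite -(setICr A); exact: filterI.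
by exfalso; exact: (filter_not_empty G G0).
Qed.

Lemma ultra_bounded_cvg (a : nat -> R) (M : R) : (forall n, `|a n| <= M) ->
  cvg (a @ U).
Proof.
move=> aM; have := @segment_compact R (- M) M.
rewrite compact_ultra => /(_ (a @ U) (ultra_fmap a)) [|l [_ al]]; last first.
  by apply/cvg_ex; exists l.
apply: (@filterS _ U _ setT) => [n _ /=|]; last exact: filterT.
by rewrite in_itv/= -ler_norml; exact: aM.
Qed.

End ultra.

Section weak_limit.
Context (R : realType) (d : nat).
Local Notation V := 'rV[R]_d.
Local Notation X := (Rd R d).
Variables (s Lam : R) (U : set_system nat) (UF : UltraFilter U).
Variable mu_ : nat -> bmeasure R d.
Hypothesis nmu : forall j, nice s Lam (mu_ j).

Let lam (f : V -> R) : R := lim ((\int[mu_ j]_x f x) @[j --> U]).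

Let lamP (f : V -> R) : Cc f -> (\int[mu_ j]_x f x) @[j --> U] --> lam f.
Proof.
move=> Cf; have [N [_ N0] fN] := Cc_support 0 Cf; have [M _ fM] := Cc_bounded Cf.
apply: (ultra_bounded_cvg UF (M := M * (Lam * N `^ s))) => j.
exact: (Rintegral_Cc_le (nmu j) N0 Cf fM fN).
Qed.

Let lamD (f g : V -> R) : Cc f -> Cc g -> lam (fun x => f x + g x) = lam f + lam g.
Proof.
move=> Cf Cg; apply: cvg_lim => //.
rewrite (_ : (fun j => _) = fun j => \int[mu_ j]_x f x + \int[mu_ j]_x g x).
  by apply: cvgD; exact: lamP.
by apply/funext => j; rewrite (RintegralD measurableT (Cc_intg (nmu j) Cf) (Cc_intg (nmu j) Cg)).
Qed.

Let lamZ (a : R) (f : V -> R) : Cc f -> lam (fun x => a * f x) = a * lam f.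
Proof.
move=> Cf; apply: cvg_lim => //.
rewrite (_ : (fun j => _) = fun j => a * \int[mu_ j]_x f x).
  by apply: cvgMr; exact: lamP.
by apply/funext => j; rewrite (RintegralZl a measurableT (Cc_intg (nmu j) Cf)).
Qed.

Let lam_le (f g : V -> R) : Cc f -> Cc g -> (forall x, f x <= g x) -> lam f <= lam g.
Proof.
move=> Cf Cg fg; apply: ler_lim; [exact: lamP|exact: lamP|].
apply: nearW => j; apply: (le_Rintegral measurableT (Cc_intg (nmu j) Cf) (Cc_intg (nmu j) Cg)).
by move=> x _; exact: fg.
Qed.

(** Niceness survives because the limit measure of an open ball is a supremum over functions
    vanishing off it, and the integral of each of these is bounded by the growth of every [mu_ j] on
    the same ball. *)
Lemma weak_limit_exists : exists nu : bmeasure R d, nice s Lam nu /\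
  forall f, Cc f -> (\int[mu_ j]_x f x) @[j --> U] --> \int[nu]_x f x.
Proof.
exists (riesz_measure lamD lamZ lam_le); split.
  move=> x r r0; apply: riesz_open_le; first exact: open_eball.
  move=> f [Cf f01 f0]; apply: limr_le; first exact: lamP.
  apply: nearW => j.
  have f1 y : `|f y| <= 1 by case/andP: (f01 y) => ? ?; rewrite ger0_norm.
  have [i h] := intg_bounded (nmu j) r0 (Cc_measurable Cf) f1 f0.
  rewrite mul1r in h; apply: le_trans h.
  by apply: (le_trans (ler_norm _)); exact: (le_normr_Rintegral measurableT i).
by move=> f Cf; rewrite (riesz_repr lamD lamZ lam_le Cf).2; exact: lamP.
Qed.

End weak_limit.

(** * Passage to the limit in the truncated operators *)

Section limit_operator.
Context (R : realType) (d : nat).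
Local Notation V := 'rV[R]_d.
Local Notation X := (Rd R d).
Variables (s alpha Lam : R).
Hypotheses (s0 : 0 < s) (a0 : 0 < alpha) (a1 : alpha <= 1) (Lam0 : 0 < Lam).
Variable om : V -> R.
Hypothesis omP : real_CZ alpha om.

Lemma mul_div_cancel (M A e : R) : M * A != 0 -> M * (e / (M * A)) * A = e.
Proof. by move=> h; rewrite mulrAC mulrC divfK. Qed.

(** The bound depends on the measure through [Lam] only, so it gives equicontinuity along a sequence
    of nice measures. *)
Lemma Tr_equi (mu : bmeasure R d) (f : V -> R) (M N e delta : R) (x x' : V) :
  nice s Lam mu -> 0 < delta -> Cc f -> 0 < N ->
  (forall y, `|f y| <= M) -> (forall y, N <= enorm y -> f y = 0) ->
  (forall y, enorm y <= N -> `|kd s om delta (x' - y) - kd s om delta (x - y)| <= e) ->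
  `|Tr s om mu delta f x' - Tr s om mu delta f x| <= M * e * (Lam * N `^ s).
Proof.
move=> nmu d0 Cf N0 fM fN he.
have Lf := Cc_L2r nmu Cf.
have i1 := Tr_intg s0 a0 a1 omP Lam0 nmu x d0 Lf.
have i2 := Tr_intg s0 a0 a1 omP Lam0 nmu x' d0 Lf.
rewrite /Tr -(RintegralB measurableT i2 i1).
have := intgB i2 i1.
set h := (fun y : X => _ - _) => ih.
have M0 : 0 <= M by apply: le_trans (fM 0).
have hM y : `|h y| <= M * e.
  rewrite /h -mulrBr normrM; have [yN|yN] := leP (enorm y) N.
    by apply: ler_pM => //; exact: he.
  rewrite (fN y (ltW yN)) normr0 mul0r mulr_ge0//.
  by apply: le_trans (he 0 _); rewrite ?enorm0 ?(ltW N0).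
have hN y : ~ eball 0 N y -> h y = 0.
  move=> /negP; rewrite /eball/= subr0 -leNgt => yN.
  by rewrite /h (fN y yN) !mul0r subrr.
have [i hh] := intg_bounded nmu N0 (intg_measurable ih) hM hN.
exact: (le_trans (le_normr_Rintegral measurableT i) hh).
Qed.

Variables (U : set_system nat) (UF : UltraFilter U) (mu_ : nat -> bmeasure R d).
Variable nu : bmeasure R d.
Hypothesis nmu : forall j, nice s Lam (mu_ j).
Hypothesis nnu : nice s Lam nu.
Hypothesis mu_nu : forall f, Cc f -> (\int[mu_ j]_x f x) @[j --> U] --> \int[nu]_x f x.

Lemma Tr_lim (delta : R) (f : V -> R) (x : V) : 0 < delta -> Cc f ->
  Tr s om (mu_ j) delta f x @[j --> U] --> Tr s om nu delta f x.
Proof.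
move=> d0 Cf; apply: mu_nu.
rewrite (_ : (fun y => _) = (fun y => kd s om delta (x - y) * f y)); last first.
  by apply/funext => y; rewrite mulrC.
apply: CcMl => //; apply/continuous_enormP => y e e0.
have [r r0 h] := kd_joint_cont s a0 a1 omP d0 x y e0.
by exists r => // y' hy; apply: h => //; rewrite subrr enorm0.
Qed.

(** If this fails, points [u j] of failure exist for [U]-many [j]. They converge along [U] to a
    point [x] of the compact ball, and equicontinuity carries the failure to [x], contradicting
    [Tr_lim]. *)
Lemma Tr_lim_unif (delta N e : R) (f : V -> R) : 0 < delta -> Cc f -> 0 < e -> 0 <= N ->
  \forall j \near U, forall x, enorm x <= N ->
    `|Tr s om (mu_ j) delta f x - Tr s om nu delta f x| <= e.
Proof.
move=> d0 Cf e0 N0.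
pose B j x := enorm x <= N /\
    e < `|Tr s om (mu_ j) delta f x - Tr s om nu delta f x|.
have [h|h] := in_ultra_setVsetC [set j | exists x, B j x] UF; last first.
  apply: filterS h => j /= h x xN; rewrite leNgt; apply/negP => xe.
  by apply: h; exists x.
exfalso.
have [u uB] : exists u : nat -> V, forall j, enorm (u j) <= N /\
    ((exists x, B j x) -> B j (u j)).
  have h2 j : exists y, enorm y <= N /\ ((exists x, B j x) -> B j y).
    have [[x Bx]|nB] := pselect (exists x, B j x); first by exists x; case: Bx.
    by exists 0; rewrite enorm0.
  by have [u hu] := choice h2; exists u.
have K := @compact_cball R d N; rewrite compact_ultra in K.
have [|x [/= xN ux]] := K (u @ U) (ultra_fmap UF u).
  apply: (@filterS _ U _ setT) => [j _ /=|]; last exact: filterT.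
  by case: (uB j).
have [Nf [_ Nf0] fN] := Cc_support 0 Cf; have [M M0 fM] := Cc_bounded Cf.
pose C := M * (Lam * Nf `^ s).
have C0 : 0 < C by rewrite !mulr_gt0// powR_gt0.
have e30 : 0 < e / 3 / C by rewrite !divr_gt0.
have [r r0 hr] := joint_unif x Nf (kd_joint_cont s a0 a1 omP d0) e30.
have near1 : \forall j \near U, enorm (u j - x) < r.
  have nb : nbhs x (eball x r) by apply/nbhs_eballP; exists r.
  exact: (ux _ nb).
have e3 : 0 < e / 3 by rewrite divr_gt0.
have FU : ProperFilter U by exact: ultra_proper.
have /cvgrPdist_lt/(_ _ e3) near2 := @Tr_lim delta f x d0 Cf.
have : U [set j | False]; last by move=> /filter_not_empty.
apply: filterS3 h near1 near2 => j /= Bj j1 j2.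
have [_ /(_ Bj) [_]] := uB j; rewrite ltNge => /negP; apply.
have kk y : enorm y <= Nf -> `|kd s om delta (u j - y) - kd s om delta (x - y)| <= e / 3 / C.
  by move=> yN; apply: ltW; exact: hr.
have E : M * (e / 3 / C) * (Lam * Nf `^ s) = e / 3.
  by apply: mul_div_cancel; rewrite gt_eqF.
have q1 := Tr_equi (nmu j) d0 Cf Nf0 fM fN kk; rewrite E in q1.
have q2 := Tr_equi nnu d0 Cf Nf0 fM fN kk; rewrite E in q2.
move: q1 q2 j2.
move: (Tr s om (mu_ j) delta f (u j)) (Tr s om (mu_ j) delta f x)
  (Tr s om nu delta f (u j)) (Tr s om nu delta f x) => p1 p2 p3 p4.
rewrite !ler_norml ltr_norml => /andP[? ?] /andP[? ?] /andP[? ?].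
by apply/andP; split; lra.
Qed.

(** Both the operator and the measure of integration vary with [j]. Uniform convergence on the
    support of [g] replaces the operator by that of [nu]; what remains is weak convergence on the
    fixed test function [g * Tr f]. *)
Lemma Pr_lim (delta : R) (f g : V -> R) : 0 < delta -> Cc f -> Cc g ->
  Pr s om (mu_ j) delta f g @[j --> U] --> Pr s om nu delta f g.
Proof.
move=> d0 Cf Cg; apply/cvgrPdist_le => e e0.
have [N [_ N0] gN] := Cc_support 0 Cg; have [M M0 gM] := Cc_bounded Cg.
pose C := M * (Lam * N `^ s).
have C0 : 0 < C by rewrite !mulr_gt0// powR_gt0.
have e20 : 0 < e / 2 / C by rewrite !divr_gt0.
have near1 := Tr_lim_unif d0 Cf e20 (ltW N0).
have cT := Tr_cont s0 a0 a1 omP Lam0 nnu d0 (Cc_L2r nnu Cf).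
have CG : Cc (fun x => g x * Tr s om nu delta f x).
  rewrite (_ : (fun x => _) = fun x => Tr s om nu delta f x * g x).
    exact: CcMl.
  by apply/funext => x; rewrite mulrC.
have e2 : 0 < e / 2 by rewrite divr_gt0.
have /cvgrPdist_le/(_ _ e2) near2 := mu_nu CG.
apply: filterS2 near1 near2 => j h1 h2.
have i1 := Pr_intg s0 a0 a1 omP Lam0 (nmu j) d0 (Cc_L2r (nmu j) Cf) Cg.
have i2 := Cc_intg (nmu j) CG.
have h3 : `|Pr s om (mu_ j) delta f g - \int[mu_ j]_x (g x * Tr s om nu delta f x)| <= e / 2.
  rewrite /Pr -(RintegralB measurableT i1 i2).
  have := intgB i1 i2; set h := (fun y : X => _ - _) => ih.
  have hM y : `|h y| <= M * (e / 2 / C).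
    rewrite /h -mulrBr normrM; have [yN|yN] := leP (enorm y) N.
      by apply: ler_pM => //; exact: h1.
    by rewrite (gN y (ltW yN)) normr0 mul0r mulr_ge0// ltW.
  have hN y : ~ eball 0 N y -> h y = 0.
    move=> /negP; rewrite /eball/= subr0 -leNgt => yN.
    by rewrite /h (gN y yN) !mul0r subrr.
  have [i hh] := intg_bounded (nmu j) N0 (intg_measurable ih) hM hN.
  apply: (le_trans (le_normr_Rintegral measurableT i)).
  apply: (le_trans hh); rewrite le_eqVlt; apply/orP; left; apply/eqP.
  by apply: mul_div_cancel; rewrite gt_eqF.
move: h2 h3; rewrite /Pr.
move: (\int[nu]_x _) (\int[mu_ j]_x (g x * Tr s om nu delta f x))
  (\int[mu_ j]_x _) => p1 p2 p3.
rewrite !ler_norml => /andP[? ?] /andP[? ?].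
by apply/andP; split; lra.
Qed.

Variable Lg : R.
Hypothesis gmu : forall j, rgood s om Lg (mu_ j).

Lemma Pr_lim_le (delta : R) (f g : V -> R) : 0 < delta -> Cc f -> Cc g ->
  Pr s om nu delta f g ^+ 2 <=
    Lg ^+ 2 * (\int[nu]_x (f x ^+ 2)) * (\int[nu]_x (g x ^+ 2)).
Proof.
move=> d0 Cf Cg.
have C2 (h : V -> R) : Cc h -> Cc (fun x => h x ^+ 2).
  by move=> Ch; apply: CcMl => //; case: Ch.
have c1 := Pr_lim d0 Cf Cg.
have c2 := mu_nu (C2 _ Cf); have c3 := mu_nu (C2 _ Cg).
have FU : ProperFilter U by exact: ultra_proper.
have c4 : (Pr s om (mu_ j) delta f g * Pr s om (mu_ j) delta f g) @[j --> U] -->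
    Pr s om nu delta f g * Pr s om nu delta f g by exact: cvgM.
have c5 : (Lg ^+ 2 * \int[mu_ j]_x f x ^+ 2 * \int[mu_ j]_x g x ^+ 2) @[j --> U] -->
    Lg ^+ 2 * \int[nu]_x f x ^+ 2 * \int[nu]_x g x ^+ 2.
  by apply: cvgM => //; exact: cvgMr.
rewrite [leLHS]expr2; apply: (ler_cvg_to c4 c5).
apply: nearW => j; rewrite /= -expr2.
exact: (Pr_le s0 a0 a1 omP Lam0 (nmu j) (gmu j) d0 Cf Cg).
Qed.

(* Duality: test the continuous function [h] against its own truncations. *)
Lemma dual_bound (h : V -> R) (B : R) : continuous h -> 0 <= B ->
  (forall g, Cc g -> (\int[nu]_x (g x * h x)) ^+ 2 <= B * \int[nu]_x (g x ^+ 2)) ->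
  (\int[nu]_x (h x ^+ 2)%:E <= B%:E)%E.
Proof.
move=> ch B0 hB.
pose chi n := @cutoff R d 0 n.+1%:R.
have Cchi n : Cc (chi n) by apply: cutoff_Cc; rewrite ltr0n.
pose F n x := h x ^+ 2 * chi n x.
have CF n : Cc (F n) by apply: CcMl => //; exact: contM.
have F0 n x : 0 <= F n x by rewrite mulr_ge0 ?sqr_ge0// cutoff_ge0.
have FB n : \int[nu]_x F n x <= B.
  have Cg : Cc (fun x => h x * chi n x) by exact: CcMl.
  have := hB _ Cg; set I := \int[nu]_x F n x.
  have -> : \int[nu]_x (h x * chi n x * h x) = I.
    by apply: eq_Rintegral => x _; rewrite /F expr2 mulrAC.
  have I0 : 0 <= I by apply: Rintegral_ge0 => x _; exact: F0.
  have I2 : \int[nu]_x ((h x * chi n x) ^+ 2) <= I.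
    apply: le_Rintegral => //.
    - by apply: (Cc_intg nnu); apply: CcMl => //; case: Cg.
    - exact: (Cc_intg nnu).
    move=> x _; rewrite /F exprMn ler_wpM2l ?sqr_ge0// expr2.
    by rewrite ler_piMr ?cutoff_ge0 ?cutoff_le1.
  move=> le1; have le2 : I ^+ 2 <= B * I by apply: (le_trans le1); rewrite ler_wpM2l.
  have [->//|In] := eqVneq I 0.
  have Ip : 0 < I by rewrite lt_def In.
  by rewrite -(ler_pM2r Ip) -expr2.
have cv x : (F n x)%:E @[n --> \oo] --> (h x ^+ 2)%:E.
  apply: cvg_EFin; first exact: nearW.
  apply/cvgrPdist_le => e e0; exists (Num.truncn (enorm x)) => // n /= hn.
  rewrite /F /chi cutoff1 ?mulr1 ?subrr ?normr0 ?ltW// ?ltr0n//.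
  by rewrite subr0 (lt_le_trans (truncnS_gt _))// ler_nat ltnS.
have mF n : measurable_fun setT (fun x : X => (F n x)%:E).
  by apply/measurable_EFinP; exact: (Cc_measurable (CF n)).
apply: (@le_trans _ _ (\int[nu]_x limn_einf (fun n => (F n x)%:E))%E).
  rewrite le_eqVlt; apply/orP; left; apply/eqP; apply: eq_integral => x _.
  by rewrite is_cvg_limn_einfE ?(cvg_lim _ (cv x))//; apply/cvg_ex; eexists; exact: cv.
apply: (le_trans (fatou nu measurableT mF _)); first by move=> n x _; rewrite lee_fin.
rewrite (_ : (fun n => _) = fun n => (\int[nu]_x F n x)%:E); last first.
  by apply/funext => n; rewrite EFin_Rintegral//; exact: (Cc_intg nnu).
rewrite limn_einf_lim; apply: lime_le; first exact: is_cvg_einfs.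
apply: nearW => n; apply: (@le_trans _ _ (\int[nu]_x F n x)%:E); last by rewrite lee_fin.
by apply: ereal_inf_lbound; exists n => //=.
Qed.

(** Duality is used twice: for [f] in [Cc] through [Pr_lim_le], then for [f] in [L2r] by moving the
    operator onto the test function with [Pr_anti], where the first case applies. *)
Lemma weak_good (delta : R) (f : V -> R) : 0 < delta -> L2r nu f ->
  (\int[nu]_x (Tr s om nu delta f x ^+ 2)%:E <=
      (Lg ^+ 2 * \int[nu]_x (f x ^+ 2))%:E)%E.
Proof.
move=> d0.
have B0 (h : V -> R) : 0 <= Lg ^+ 2 * \int[nu]_x (h x ^+ 2).
  by rewrite mulr_ge0 ?sqr_ge0//; apply: Rintegral_ge0 => x _; exact: sqr_ge0.
have good_Cc g : Cc g -> (\int[nu]_x (Tr s om nu delta g x ^+ 2)%:E <=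
      (Lg ^+ 2 * \int[nu]_x (g x ^+ 2))%:E)%E.
  move=> Cg; apply: dual_bound => //.
    exact: (Tr_cont s0 a0 a1 omP Lam0 nnu d0 (Cc_L2r nnu Cg)).
  by move=> h Ch; exact: (Pr_lim_le d0 Cg Ch).
move=> Lf; have [mf f2] := Lf; apply: dual_bound => //.
  exact: (Tr_cont s0 a0 a1 omP Lam0 nnu d0 Lf).
move=> g Cg.
have mT : measurable_fun setT (fun x : X => - Tr s om nu delta g x).
  apply: continuous_measurable_Rd; apply: contN.
  exact: (Tr_cont s0 a0 a1 omP Lam0 nnu d0 (Cc_L2r nnu Cg)).
have sq x : (- Tr s om nu delta g x) ^+ 2 = Tr s om nu delta g x ^+ 2 by rewrite sqrrN.
have [|||iT hT] := @intg_ge0 _ X R nu (fun x => (- Tr s om nu delta g x) ^+ 2)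
   (Lg ^+ 2 * \int[nu]_x (g x ^+ 2)).
- exact: measurable_funM.
- by move=> x; exact: sqr_ge0.
- by under eq_integral do rewrite sq; exact: good_Cc.
have := Pr_anti s0 a0 a1 omP Lam0 nnu d0 Lf Cg; rewrite /Pr => ->.
apply: (le_trans (cauchy_schwarz mf mT f2 iT)).
have f20 : 0 <= \int[nu]_x (f x ^+ 2) by apply: Rintegral_ge0 => x _; exact: sqr_ge0.
have := ler_wpM2l f20 hT.
by move=> h; apply: (le_trans h); rewrite mulrCA mulrA.
Qed.

End limit_operator.

(** * Lebesgue points of a bounded functional *)

Lemma measure_bigcup0 (R : realType) (d : nat) (mu : bmeasure R d) (F : nat -> set (Rd R d)) :
  (forall k, measurable (F k)) -> (forall k, mu (F k) = 0%E) -> mu (\bigcup_k F k) = 0%E.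
Proof.
move=> mF F0; apply/eqP; rewrite -measure_le0.
have mU : measurable (\bigcup_k F k) by exact: bigcup_measurable.
apply: (le_trans (@measure_sigma_subadditive _ _ _ mu _ _ mF mU (@subset_refl _ _))).
by rewrite eseries0.
Qed.

Section vitali.
Context (R : realType) (d : nat).
Local Notation V := 'rV[R]_d.

Definition separated (p q : V * R) : bool := p.2 + q.2 <= enorm (p.1 - q.1).

(** Greedy choice: keep a member [m] of largest radius and recurse on the members separated from it;
    the discarded ones fail to be separated from [m] and have no larger radius. *)
Lemma vitali_finite (l : seq (V * R)) : (forall p, p \in l -> 0 < p.2) ->
  exists t : seq (V * R), [/\ {subset t <= l}, pairwise separated t &
    forall p, p \in l -> exists2 q, q \in t & ~~ separated q p /\ p.2 <= q.2].
Proof.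
move: {2}(size l).+1 (ltnSn (size l)) => n; elim: n l => // n ih l ln l0.
have [->|] := eqVneq l [::]; first by exists [::].
rewrite -size_eq0 -lt0n => sl.
have [m ml mmax] : exists2 m, m \in l & forall p, p \in l -> p.2 <= m.2.
  case: l sl {ih ln l0} => // a l _; elim: l a => [|b l ihl] a.
    by exists a; rewrite ?mem_head// => p; rewrite inE => /eqP ->.
  have [m ml mm] := ihl b; have [am|am] := leP a.2 m.2.
    exists m; first by rewrite inE ml orbT.
    by move=> p; rewrite inE => /orP[/eqP ->//|/mm].
  exists a; first by rewrite mem_head.
  move=> p; rewrite inE => /orP[/eqP ->//|/mm h]; exact: le_trans h (ltW am).
pose l' := [seq p <- l | separated m p].
have mm : ~~ separated m m.
  by rewrite /separated subrr enorm0 -ltNge addr_gt0 ?l0.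
have [||t [tl' tp tc]] := ih l'.
- rewrite -ltnS; apply: leq_ltn_trans ln; rewrite size_filter.
  rewrite -(count_predC (separated m) l) -[X in (X < _)%N]addn0 ltn_add2l -has_count.
  by apply/hasP; exists m.
- by move=> p; rewrite mem_filter => /andP[_ /l0].
exists (m :: t); split.
- move=> p; rewrite inE => /orP[/eqP ->//|/tl']; by rewrite mem_filter => /andP[].
- rewrite /= tp andbT; apply/allP => q /tl'; by rewrite mem_filter => /andP[].
- move=> p pl; have [mp|mp] := boolP (separated m p); last first.
    by exists m; rewrite ?mem_head; last by split=> //; exact: mmax.
  have [|q qt hq] := tc p; first by rewrite mem_filter mp.
  by exists q => //; rewrite inE qt orbT.
Qed.

Lemma not_separated_sub (p q : V * R) : ~~ separated q p -> p.2 <= q.2 ->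
  eball p.1 p.2 `<=` eball q.1 (3 * q.2).
Proof.
rewrite /separated -ltNge => h1 h2 y; rewrite /eball/= => h3.
have := enorm_triangle p.1 y q.1; rewrite (enormB p.1 q.1); lra.
Qed.

End vitali.

Section near_minimizer.
Context (R : realType) (d : nat).
Local Notation V := 'rV[R]_d.
Local Notation X := (Rd R d).
Variables (s Lam : R) (mu : bmeasure R d).
Hypothesis nmu : nice s Lam mu.
Variable l : (V -> R) -> R.
Hypothesis lD : forall f g, Cc f -> Cc g -> l (fun x => f x + g x) = l f + l g.
Hypothesis lZ : forall a f, Cc f -> l (fun x => a * f x) = a * l f.

(* A Riesz representative of the bounded functional [l] in [L^2], up to a small
   error, obtained as a near-minimizer of [\int g^2 - 2 l g]. *)
Lemma near_minimizer (Q e : R) : 0 <= Q -> 0 < e ->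
  (forall h, Cc h -> l h ^+ 2 <= Q * \int[mu]_x (h x ^+ 2)) ->
  exists2 g, Cc g & forall h, Cc h ->
    (l h - \int[mu]_x (g x * h x)) ^+ 2 <= e * \int[mu]_x (h x ^+ 2).
Proof.
move=> Q0 e0 lQ.
pose Phi (g : V -> R) := \int[mu]_x (g x ^+ 2) - 2 * l g.
have sq_ge0 (g : V -> R) : 0 <= \int[mu]_x (g x ^+ 2).
  by apply: Rintegral_ge0 => x _; exact: sqr_ge0.
(* With [I] the integral of [g^2], the hypothesis bounds [2 * l g] by [2 * sqrt (Q * I)], which is
   at most [Q + I]. *)
have lbP g : Cc g -> - Q <= Phi g.
  move=> Cg; have := lQ g Cg; rewrite /Phi; have := sq_ge0 g.
  move: (\int[mu]_x _) (l g) => I L I0 h.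
  rewrite -subr_ge0 opprK; apply: contrapT => /negP; rewrite -ltNge => h2.
  have : (Q + I) ^+ 2 < (2 * L) ^+ 2.
    by rewrite ltr_pXn2r ?nnegrE ?addr_ge0//; lra.
  have := sqr_ge0 (Q - I); nra.
have hinf : has_inf [set Phi g | g in @Cc R d].
  split; first by exists (Phi (fun=> 0)); exists (fun=> 0) => //; exact: Cc_cst0.
  by exists (- Q) => _ [g Cg <-]; exact: lbP.
have [_ [g Cg <-] hg] := inf_adherent e0 hinf.
exists g => // h Ch; rewrite -sqrrN opprB.
have i1 : intg mu (fun x => g x ^+ 2) by apply: (Cc_intg nmu); apply: CcMl => //; case: Cg.
have i2 : intg mu (fun x => g x * h x) by apply: (Cc_intg nmu); apply: CcMl => //; case: Cg.
have i3 : intg mu (fun x => h x ^+ 2) by apply: (Cc_intg nmu); apply: CcMl => //; case: Ch.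
(* Near-minimality of [g] along the line [g + t * h] makes a quadratic polynomial in [t] with
   constant term [e] nonnegative. *)
apply: discriminant => [||t]; [exact: ltW|exact: sq_ge0|].
have Cth : Cc (fun x => t * h x) by exact: CcZ.
have Cgh : Cc (fun x => g x + t * h x) by exact: CcD.
have : inf [set Phi g | g in @Cc R d] <= Phi (fun x => g x + t * h x).
  by apply: (ge_inf hinf.2); exists (fun x => g x + t * h x).
have -> : Phi (fun x => g x + t * h x) =
    Phi g + 2 * t * (\int[mu]_x (g x * h x) - l h) + t ^+ 2 * \int[mu]_x (h x ^+ 2).
  rewrite /Phi (lD Cg Cth) (lZ t Ch).
  have j2 := intgZ (2 * t) i2; have j3 := intgZ (t ^+ 2) i3.
  have -> : \int[mu]_x ((g x + t * h x) ^+ 2) = \int[mu]_x (g x ^+ 2) +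
     2 * t * \int[mu]_x (g x * h x) + t ^+ 2 * \int[mu]_x (h x ^+ 2).
    rewrite -(RintegralZl (2 * t) measurableT i2) -(RintegralZl (t ^+ 2) measurableT i3).
    rewrite -(RintegralD measurableT i1 j2) -(RintegralD measurableT (intgD i1 j2) j3).
    by apply: eq_Rintegral => x _; ring.
  by ring.
by move: hg; move: (inf _) (Phi g) (\int[mu]_x _ - _) (t ^+ 2 * _) => p q u v; lra.
Qed.

Hypothesis Lam0 : 0 < Lam.

Lemma l_sum (I : Type) (r : seq I) (F : I -> V -> R) :
  (forall i, Cc (F i)) -> l (fun x => \sum_(i <- r) F i x) = \sum_(i <- r) l (F i).
Proof.
have l0 : l (fun=> 0) = 0.
  have h := lZ 0 (@Cc_cst0 R d); rewrite [RHS]mul0r in h.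
  by rewrite -[RHS]h; congr l; apply/funext => x; rewrite mul0r.
move=> cF; elim: r => [|i r ih].
  by rewrite big_nil -[RHS]l0; congr l; apply/funext => x; rewrite big_nil.
rewrite big_cons -ih -lD//; last exact: Cc_sum.
by congr l; apply/funext => x; rewrite big_cons.
Qed.

(* The signed sum [h] of the test functions [psi p] satisfies [l h >= kap * S], while the
   disjointness of the supports gives [\int h^2 <= Lam * S], [S] being the sum to bound. *)
Lemma separated_sum_le (e kap : R) (psi : V * R -> V -> R) (t : seq (V * R)) :
  0 < kap -> 0 <= e ->
  (forall h, Cc h -> l h ^+ 2 <= e * \int[mu]_x (h x ^+ 2)) ->
  (forall p, Cc (psi p)) -> (forall p x, `|psi p x| <= 1) ->
  (forall p x, ~ eball p.1 p.2 x -> psi p x = 0) ->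
  (forall p, p \in t -> 0 < p.2 /\ kap * p.2 `^ s <= `|l (psi p)|) ->
  pairwise (@separated R d) t ->
  \sum_(p <- t) p.2 `^ s <= e * Lam / kap ^+ 2.
Proof.
move=> k0 e0 le Cpsi psi1 psi0 tb tp.
pose h x := \sum_(p <- t) Num.sg (l (psi p)) * psi p x.
have Ch : Cc h by apply: Cc_sum => p; exact: CcZ.
set S := \sum_(p <- t) p.2 `^ s.
have S0 : 0 <= S by apply: sumr_ge0 => p _; exact: powR_ge0.
have lh : kap * S <= l h.
  rewrite /h l_sum; last by move=> p; exact: CcZ.
  rewrite mulr_sumr big_seq_cond [leRHS]big_seq_cond; apply: ler_sum => p.
  rewrite andbT => pt; rewrite lZ// mulrC -normrEsg mulrC.
  by case: (tb p pt).
have h2 x : h x ^+ 2 <= \sum_(p <- t) psi p x ^+ 2.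
  rewrite /h {S S0 lh Ch h}; elim: t tp tb => [|p t ih] /=.
    by rewrite !big_nil expr0n.
  move=> /andP[/allP pt tp] tb; rewrite !big_cons sqrrD.
  have z : psi p x * (\sum_(q <- t) Num.sg (l (psi q)) * psi q x) = 0.
    rewrite mulr_sumr big_seq big1// => q qt.
    have [px|px] := pselect (eball p.1 p.2 x); last by rewrite psi0// mul0r.
    rewrite (psi0 q) ?mulr0// => qx.
    have := pt q qt; rewrite /separated leNgt => /negP; apply.
    move: px qx; rewrite /eball/= => px qx.
    by have := enorm_triangle x p.1 q.1; rewrite (enormB p.1 x); lra.
  rewrite -mulrA z mulr0 mul0rn addr0 exprMn lerD//.
    rewrite ler_piMl ?sqr_ge0// -real_normK ?num_real// expr_le1// normr_sg.
    by case: eqP.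
  by apply: ih => // q qt; apply: tb; rewrite inE qt orbT.
have ipsi p : intg mu (fun x => psi p x ^+ 2).
  by apply: (Cc_intg nmu); apply: CcMl => //; case: (Cpsi p).
have Ih : \int[mu]_x (h x ^+ 2) <= Lam * S.
  apply: (@le_trans _ _ (\int[mu]_x (\sum_(p <- t) psi p x ^+ 2))).
    apply: le_Rintegral => //.
    - by apply: (Cc_intg nmu); apply: CcMl => //; case: Ch.
    - exact: intg_sum.
  rewrite Rintegral_sum// mulr_sumr big_seq_cond [leRHS]big_seq_cond.
  apply: ler_sum => p; rewrite andbT => pt; have [p0 _] := tb p pt.
  have u1 x : `|psi p x ^+ 2| <= 1.
    by rewrite normrX expr_le1.
  have u0 x : ~ eball p.1 p.2 x -> psi p x ^+ 2 = 0.
    by move=> /psi0 ->; rewrite expr0n.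
  have [_] := intg_bounded nmu p0 (intg_measurable (ipsi p)) u1 u0.
  rewrite mul1r; apply: le_trans.
  by apply: (le_trans (ler_norm _)); exact: (le_normr_Rintegral measurableT (ipsi p)).
have k2 : 0 < kap ^+ 2 by rewrite exprn_gt0.
rewrite ler_pdivlMr//.
have kS : (kap * S) ^+ 2 <= e * (Lam * S).
  apply: (@le_trans _ _ (l h ^+ 2)).
    by rewrite lerXn2r ?nnegrE ?mulr_ge0 ?(ltW k0)//; apply: le_trans lh; rewrite mulr_ge0 ?(ltW k0).
  by apply: (le_trans (le h Ch)); rewrite ler_wpM2l.
have [->|Sn] := eqVneq S 0; first by rewrite mul0r mulr_ge0// ltW.
have Sp : 0 < S by rewrite lt_def Sn.
rewrite -(ler_pM2r Sp).
by rewrite (_ : S * kap ^+ 2 * S = (kap * S) ^+ 2) -?mulrA//; ring.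
Qed.

Lemma mu_ball3 (q : V * R) : 0 < q.2 ->
  (mu (eball q.1 (3 * q.2)) <= (Lam * 3 `^ s * q.2 `^ s)%:E)%E.
Proof.
move=> q0; have q3 : 0 < 3 * q.2 by rewrite mulr_gt0.
apply: (le_trans (nmu _ q3)).
by rewrite lee_fin powRM ?(ltW q0)// mulrA.
Qed.

(** [W] is the union of all balls carrying a test function that violates the bound. Lindelof and
    continuity from below reduce its measure to that of finitely many balls; Vitali selects
    separated ones whose triples cover these, and the growth bound combined with [separated_sum_le]
    gives the constant. *)
Lemma bad_set_small (e kap : R) : 0 < kap -> 0 <= e ->
  (forall h, Cc h -> l h ^+ 2 <= e * \int[mu]_x (h x ^+ 2)) ->
  exists W : set X, [/\ measurable W,
    (mu W <= (Lam * 3 `^ s * (e * Lam / kap ^+ 2))%:E)%E &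
    forall x (r : R) psi, 0 < r -> Cc psi -> (forall y, `|psi y| <= 1) ->
      (forall y, ~ eball x r y -> psi y = 0) -> kap * r `^ s < `|l psi| -> W x].
Proof.
move=> k0 e0 le.
pose wit (p : V * R) (psi : V -> R) := [/\ Cc psi, forall y, `|psi y| <= 1,
  forall y, ~ eball p.1 p.2 y -> psi y = 0 & kap * p.2 `^ s < `|l psi|].
pose D : set (V * R) := [set p | 0 < p.2 /\ exists psi, wit p psi].
(* Outside [D] the zero function is the default, so that regularity, size and support hold for every
   [p]. *)
have [psi psiP] : exists psi : V * R -> V -> R, forall p,
    [/\ Cc (psi p), forall y, `|psi p y| <= 1,
     forall y, ~ eball p.1 p.2 y -> psi p y = 0 &
     D p -> kap * p.2 `^ s < `|l (psi p)|].
  have h p : exists f, [/\ Cc f, forall y, `|f y| <= 1,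
     forall y, ~ eball p.1 p.2 y -> f y = 0 & D p -> kap * p.2 `^ s < `|l f|].
    have [[_ [f [? ? ? ?]]]|nD] := pselect (D p); first by exists f; split.
    by exists (fun=> 0); split=> //; [exact: Cc_cst0|move=> y; rewrite normr0].
  by have [psi hpsi] := choice h; exists psi.
have Cpsi p : Cc (psi p) by case: (psiP p).
have psi1 p y : `|psi p y| <= 1 by case: (psiP p).
have psi0 p y : ~ eball p.1 p.2 y -> psi p y = 0.
  by case: (psiP p) => _ _ h _; exact: h.
have [E [ED EU]] := @lindelof R d (V * R)%type D (fun p => eball p.1 p.2)
  (fun p _ => @open_eball R d p.1 p.2).
pose W : set X := \bigcup_n E n.
have mE n : measurable (E n : set X).
  by have [->|[p _ ->]] := ED n; [exact: measurable0|exact: measurable_eball].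
have mW : measurable W by apply: bigcup_measurable => n _; exact: mE.
exists W; split=> //; last first.
  move=> x r f r0 Cf f1 f0 lf; rewrite /W -EU; exists (x, r).
    by split=> //; exists f; split.
  by rewrite /eball/= subrr enorm0.
pose F n : set X := \big[setU/set0]_(i < n) E i.
have mF n : measurable (F n) by apply: bigsetU_measurable => i _; exact: mE.
have WF : W = \bigcup_n F n.
  apply/seteqP; split=> [x [n _ Ex]|x [n _]].
    exists n.+1 => //; rewrite /F big_ord_recr/=; by right.
  by rewrite /F -bigcup_mkord => -[i _ Eix]; exists i.
have ndF : nondecreasing_seq F.
  apply/nondecreasing_seqP => n; apply/subsetPset; rewrite /F [X in _ `<=` X]big_ord_recr/=.
  exact: subsetUl.
have mUF : measurable (\bigcup_n F n) by rewrite -WF.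
have cv : (mu \o F) @ \oo --> mu (\bigcup_n F n) := nondecreasing_cvg_mu mF mUF ndF.
rewrite WF -(cvg_lim _ cv)//; apply: lime_le; first by apply/cvg_ex; eexists; exact: cv.
apply: nearW => n /=.
have [L [LD LF]] : exists L : seq (V * R), (forall p, p \in L -> D p) /\
    F n `<=` [set x | exists2 p, p \in L & eball p.1 p.2 x].
  elim: n => [|n [L [LD LF]]].
    by exists [::]; split=> // x; rewrite /F big_ord0.
  have [E0|[p Dp Ep]] := ED n.
    by exists L; split=> //; rewrite /F big_ord_recr/= E0 setU0.
  exists (p :: L); split=> [q|x].
    by rewrite inE => /orP[/eqP ->//|/LD].
  rewrite /F big_ord_recr/= => -[/LF[q qL qx]|]; first by exists q => //; rewrite inE qL orbT.
  by rewrite Ep => px; exists p => //; rewrite mem_head.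
have [|t [tL tp tc]] := @vitali_finite R d L; first by move=> p /LD[].
have tD p : p \in t -> D p by move=> /tL /LD.
have Sle := @separated_sum_le e kap psi t k0 e0 le Cpsi psi1 psi0 _ tp.
have {}Sle : \sum_(p <- t) p.2 `^ s <= e * Lam / kap ^+ 2.
  apply: Sle => p /tD Dp; split; first by case: Dp.
  by case: (psiP p) => _ _ _ /(_ Dp) /ltW.
apply: (@le_trans _ _ (\sum_(p <- t) (Lam * 3 `^ s * p.2 `^ s)%:E)%E); last first.
  rewrite sumEFin lee_fin -mulr_sumr ler_wpM2l// mulr_ge0 ?powR_ge0//; exact: ltW.
have sub : F n `<=` \big[setU/set0]_(p <- t) (eball p.1 (3 * p.2)).
  move=> x /LF[p /tc[q qt [h1 h2]] px]; rewrite -bigcup_seq; exists q => //.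
  exact: (not_separated_sub h1 h2).
apply: (@le_trans _ _ (mu (\big[setU/set0]_(p <- t) (eball p.1 (3 * p.2) : set X)))).
  apply: le_measure; rewrite ?inE//.
  by apply: bigsetU_measurable => p _; exact: measurable_eball.
have : forall p, p \in t -> 0 < p.2 by move=> p /tD[].
elim: (t) => [|p u ih] u0; first by rewrite !big_nil measure0.
rewrite !big_cons.
have mU : measurable (\big[setU/set0]_(j <- u) (eball j.1 (3 * j.2)) : set X).
  by apply: bigsetU_measurable => q _; exact: measurable_eball.
apply: (le_trans (measureU2 _ (measurable_eball _ _) mU)).
apply: leeD; first by apply: mu_ball3; apply: u0; rewrite mem_head.
by apply: ih => q qu; apply: u0; rewrite inE qu orbT.
Qed.

End near_minimizer.

Section lebesgue_point.
Context (R : realType) (d : nat).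
Local Notation V := 'rV[R]_d.
Local Notation X := (Rd R d).
Variables (s Lam : R) (mu : bmeasure R d).
Hypotheses (Lam0 : 0 < Lam) (nmu : nice s Lam mu).
Variable l : (V -> R) -> R.
Hypothesis lD : forall f g, Cc f -> Cc g -> l (fun x => f x + g x) = l f + l g.
Hypothesis lZ : forall a f, Cc f -> l (fun x => a * f x) = a * l f.

(** For each [n], [l] is the pairing with the continuous function [g n] plus a remainder [ln n] of
    squared norm at most [e n]. The remainder is harmless off a set of measure [O(e n)], and against
    mean zero the pairing sees only the oscillation of [g n] near [x]. *)
Lemma lebesgue_point (Q : R) : 0 <= Q ->
  (forall h, Cc h -> l h ^+ 2 <= Q * \int[mu]_x (h x ^+ 2)) ->
  exists Z : set X, [/\ measurable Z, mu Z = 0%E &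
    forall x, ~ Z x -> forall kap : R, 0 < kap -> exists2 rho : R, 0 < rho &
      forall (r : R) psi, 0 < r -> r < rho -> Cc psi -> (forall y, `|psi y| <= 1) ->
        (forall y, ~ eball x r y -> psi y = 0) -> \int[mu]_y psi y = 0 ->
        `|l psi| <= kap * r `^ s].
Proof.
move=> Q0 lQ.
pose e n : R := n.+1%:R^-1.
have e0 n : 0 < e n by rewrite invr_gt0.
have [g gP] : exists g : nat -> V -> R, forall n, Cc (g n) /\
    forall h, Cc h -> (l h - \int[mu]_x (g n x * h x)) ^+ 2 <= e n * \int[mu]_x (h x ^+ 2).
  have h n : exists f, Cc f /\ forall h, Cc h ->
      (l h - \int[mu]_x (f x * h x)) ^+ 2 <= e n * \int[mu]_x (h x ^+ 2).
    by have [f Cf hf] := near_minimizer nmu lD lZ Q0 (e0 n) lQ; exists f.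
  by have [g hg] := choice h; exists g.
pose ln n h := l h - \int[mu]_x (g n x * h x).
have ig n h : Cc h -> intg mu (fun x => g n x * h x).
  by move=> Ch; apply: (Cc_intg nmu); apply: CcMl => //; case: (gP n) => -[].
have lnD n f h : Cc f -> Cc h -> ln n (fun x => f x + h x) = ln n f + ln n h.
  move=> Cf Ch; rewrite /ln lD//.
  have -> : \int[mu]_x (g n x * (f x + h x)) =
     \int[mu]_x (g n x * f x) + \int[mu]_x (g n x * h x).
    rewrite -(RintegralD measurableT (ig n f Cf) (ig n h Ch)).
    by apply: eq_Rintegral => x _; rewrite mulrDr.
  by ring.
have lnZ n a f : Cc f -> ln n (fun x => a * f x) = a * ln n f.
  move=> Cf; rewrite /ln lZ// mulrBr; congr (_ - _).
  rewrite -(RintegralZl a measurableT (ig n f Cf)).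
  by apply: eq_Rintegral => x _; rewrite mulrCA.
have [W WP] : exists W : nat * nat -> set X, forall p, [/\ measurable (W p),
    (mu (W p) <= (Lam * 3 `^ s * (e p.2 * Lam / e p.1 ^+ 2))%:E)%E &
    forall x (r : R) psi, 0 < r -> Cc psi -> (forall y, `|psi y| <= 1) ->
      (forall y, ~ eball x r y -> psi y = 0) ->
      e p.1 * r `^ s < `|ln p.2 psi| -> W p x].
  have h p := bad_set_small nmu (lnD p.2) (lnZ p.2) Lam0 (e0 p.1) (ltW (e0 p.2)) (gP p.2).2.
  by have [W hW] := choice h; exists W.
have mW p : measurable (W p) by case: (WP p).
(* At precision [e k] a point is excluded only if it is bad for every [n]; the measure of [W (k, n)]
   tends to 0 as [n] grows, so [Zk k] is null. *)
pose Zk k : set X := \bigcap_n W (k, n).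
have mZk k : measurable (Zk k) by apply: bigcap_measurable => // n _; exact: mW.
exists (\bigcup_k Zk k); split.
- by apply: bigcup_measurable => k _; exact: mZk.
- apply: measure_bigcup0 => // k.
  apply/eqP; rewrite eq_le measure_ge0 andbT.
  set C := Lam * 3 `^ s * (Lam / e k ^+ 2).
  have C0 : 0 <= C.
    by rewrite !mulr_ge0 ?powR_ge0 ?(ltW Lam0)// invr_ge0 exprn_ge0 ?(ltW (e0 _)).
  have h n : (mu (Zk k) <= (C * e n)%:E)%E.
    apply: (@le_trans _ _ (mu (W (k, n)))).
      by apply: le_measure; rewrite ?inE//; exact: bigcap_inf.
    have [_ h _] := WP (k, n); apply: (le_trans h); rewrite lee_fin /=.
    by rewrite /C -!mulrA [e n * _]mulrC -!mulrA.
  apply/lee_addgt0Pr => ep ep0; rewrite add0e.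
  have := h (Num.truncn (C / ep)); move=> /le_trans; apply; rewrite lee_fin.
  rewrite ler_pdivrMr// mulrC -ler_pdivrMr//; exact: ltW (truncnS_gt _).
- move=> x Zx kap k0.
  have k20 : 0 < kap / 2 by rewrite divr_gt0.
  pose k := Num.truncn (2 / kap).
  have ek : e k <= kap / 2.
    rewrite /e invf_ple ?posrE// invf_div; exact: ltW (truncnS_gt _).
  have [n nW] : exists n, ~ W (k, n) x.
    by apply: contrapT => /forallNP h; apply: Zx; exists k => // n _; apply: contrapT; exact: h.
  have kL : 0 < kap / 2 / Lam by rewrite !divr_gt0.
  have [Cg gh] := gP n.
  have /continuous_enormP/(_ x _ kL)[rho rho0 hrho] : continuous (g n) by case: Cg.
  exists rho => // r psi r0 rrho Cpsi psi1 psi0 psiI.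
  have l1 : `|ln n psi| <= e k * r `^ s.
    rewrite leNgt; apply/negP => h; apply: nW.
    by have [_ _] := WP (k, n); apply; [exact: r0|exact: Cpsi|exact: psi1|exact: psi0|exact: h].
  have i0 := Cc_intg nmu Cpsi; have i1 := ig n psi Cpsi; have i2 := intgZ (g n x) i0.
  have l2 : `|\int[mu]_y (g n y * psi y)| <= kap / 2 / Lam * (Lam * r `^ s).
    have -> : \int[mu]_y (g n y * psi y) = \int[mu]_y (g n y * psi y - g n x * psi y).
      by rewrite (RintegralB measurableT i1 i2) (RintegralZl (g n x) measurableT i0) psiI mulr0 subr0.
    have ih := intgB i1 i2.
    have hM y : `|g n y * psi y - g n x * psi y| <= kap / 2 / Lam.
      rewrite -mulrBl normrM; have [yr|yr] := pselect (eball x r y); last first.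
        by rewrite psi0// normr0 mulr0 ltW.
      apply: (@le_trans _ _ (kap / 2 / Lam * 1)); last by rewrite mulr1.
      apply: ler_pM => //; apply: ltW; apply: hrho; exact: lt_trans yr rrho.
    have hN y : ~ eball x r y -> g n y * psi y - g n x * psi y = 0.
      by move=> /psi0 ->; rewrite !mulr0 subrr.
    have [i hh] := intg_bounded nmu r0 (intg_measurable ih) hM hN.
    exact: (le_trans (le_normr_Rintegral measurableT i) hh).
  rewrite mulrA divfK ?gt_eqF// in l2.
  have -> : l psi = ln n psi + \int[mu]_y (g n y * psi y) by rewrite /ln subrK.
  apply: (le_trans (ler_normD _ _)).
  have rs := powR_ge0 r s; have := ler_wpM2r rs ek.
  by move: l1 l2; move: `|ln n psi| `|\int[mu]_y _| (r `^ s) rs => p q z z0; lra.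
Qed.

End lebesgue_point.

(** * Upper density *)

Section density.
Context (R : realType) (d : nat).
Local Notation V := 'rV[R]_d.
Local Notation X := (Rd R d).
Variables (s Lam : R) (mu : bmeasure R d).
Hypotheses (s0 : 0 < s) (Lam0 : 0 < Lam) (nmu : nice s Lam mu).

(** A slightly smaller concentric ball still has mass above [t], and it is contained in the ball of
    radius [r] about every nearby centre. This lower semicontinuity makes [thin] measurable. *)
Lemma open_eball_gt (r t : R) : open [set x : V | (t%:E < mu (eball x r))%E].
Proof.
rewrite openE => x /= tx.
pose F (n : nat) : set X := eball x (r - n.+1%:R^-1).
have mF n : measurable (F n) by exact: measurable_eball.
have UF : \bigcup_n F n = eball x r.
  apply/seteqP; split=> [y [n _]|y]; rewrite /F /eball/=.
    by move=> /lt_le_trans; apply; rewrite gerBl invr_ge0.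
  move=> yr; exists (Num.truncn (r - enorm (y - x))^-1) => //=.
  rewrite ltrBrDr -ltrBrDl invf_plt ?posrE ?subr_gt0//; exact: truncnS_gt.
have ndF : nondecreasing_seq F.
  apply/nondecreasing_seqP => n; apply/subsetPset => y; rewrite /F /eball/= => h.
  apply: (lt_le_trans h); rewrite lerD2l lerN2 lef_pV2 ?posrE// ler_nat //.
have mUF : measurable (\bigcup_n F n) by exact: bigcup_measurable.
have cv : (mu \o F) @ \oo --> mu (\bigcup_n F n) := nondecreasing_cvg_mu mF mUF ndF.
have [n tn] : exists n, (t%:E < mu (F n))%E.
  apply: contrapT => /forallNP h; move: tx; rewrite -UF ltNge => /negP; apply.
  rewrite -(cvg_lim _ cv)//; apply: lime_le; first by apply/cvg_ex; eexists; exact: cv.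
  by apply: nearW => n /=; rewrite leNgt; apply/negP; exact: h.
apply/nbhs_eballP; exists n.+1%:R^-1; first by rewrite /= invr_gt0.
move=> y; rewrite /eball/= => yx; apply: (lt_le_trans tn).
apply: le_measure; rewrite ?inE//; first exact: measurable_eball.
move=> z; rewrite /F /eball/= => zx; have := enorm_triangle x z y.
rewrite (enormB x y); move: (n.+1%:R^-1) yx zx => u; lra.
Qed.

(* The points at which [mu] has small upper density at all scales below [rho]; covering
   sets that meet it can be replaced by balls of comparable diameter and small measure. *)
Definition thin (c rho : R) : set V :=
  [set x | forall r : R, 0 < r -> r < rho -> (mu (eball x r) <= (c * r `^ s)%:E)%E].

Lemma measurable_thin (c rho : R) : measurable (thin c rho : set X).
Proof.
rewrite -[thin c rho]setCK; apply: measurableC; apply: open_measurable_Rd.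
rewrite (_ : ~` _ = \bigcup_(r in [set r : R | 0 < r < rho])
    [set x : V | ((c * r `^ s)%:E < mu (eball x r))%E]).
  by apply: bigcup_open => r _; exact: open_eball_gt.
apply/seteqP; split=> [x /= h|x [r /andP[r0 rr] /= h]].
  apply: contrapT => h'; apply: h => r r0 rr; rewrite leNgt; apply/negP => h.
  by apply: h'; exists r => //=; rewrite r0.
by move=> /(_ r r0 rr); rewrite leNgt h.
Qed.

Lemma msupp_compl_null : exists N : set X, [/\ measurable N, mu N = 0%E &
  forall x, ~ N x -> msupp mu x].
Proof.
pose D : set (V * R) := [set p | mu (eball p.1 p.2) = 0%E].
have [E [ED EU]] := @lindelof R d (V * R)%type D (fun p => eball p.1 p.2)
  (fun p _ => @open_eball R d p.1 p.2).
have mE n : measurable (E n : set X).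
  by have [->|[p _ ->]] := ED n; [exact: measurable0|exact: measurable_eball].
exists (\bigcup_n E n); split.
- exact: bigcup_measurable.
- apply: measure_bigcup0 => // n.
  by have [->|[p Dp ->]] := ED n; [exact: measure0|exact: Dp].
- move=> x; rewrite -EU => h r r0; rewrite lt_neqAle measure_ge0 andbT.
  apply/eqP => m0; apply: h; exists (x, r); first by rewrite /D/= -m0.
  by rewrite /eball/= subrr enorm0.
Qed.

(** A set lies in the closed ball about any of its points with radius its diameter, even when the
    diameter is zero; hence closed balls for the coverings. *)
Definition cball (x : V) (r : R) : set V := [set y | enorm (y - x) <= r].

Lemma measurable_cball (x : V) (r : R) : measurable (cball x r : set X).
Proof.
rewrite (_ : cball x r = \bigcap_n (eball x (r + n.+1%:R^-1) : set X)).
  by apply: bigcap_measurable => // n _; exact: measurable_eball.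
apply/seteqP; split=> [y yr n _|y h]; rewrite /cball /eball/=.
  by apply: (le_lt_trans yr); rewrite ltrDl invr_gt0.
apply/ler_addgt0Pr => e e0; apply: ltW.
apply: (lt_le_trans (h (Num.truncn e^-1) I)); rewrite lerD2l.
by rewrite invf_ple ?posrE//; exact: ltW (truncnS_gt _).
Qed.

(** The radius below solves [Lam * r^s = e], as [s > 0]. Absence of atoms settles the covering sets
    of diameter zero, for which [thin] offers no ball of comparable radius. *)
Lemma nice_point (x : V) : mu (cball x 0) = 0%E.
Proof.
apply/eqP; rewrite -measure_le0; apply/lee_addgt0Pr => e e0; rewrite add0e.
pose r := (e / Lam) `^ s^-1.
have eL : 0 < e / Lam by rewrite divr_gt0.
have r0 : 0 < r by rewrite powR_gt0.
apply: (@le_trans _ _ (mu (eball x r))).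
  apply: le_measure; rewrite ?inE; [exact: measurable_cball|exact: measurable_eball|].
  by move=> y; rewrite /cball /eball/= => h; exact: le_lt_trans h r0.
apply: (le_trans (nmu _ r0)); rewrite lee_fin /r -powRrM mulVf ?gt_eqF//.
by rewrite powRr1 ?(ltW eL)// mulrCA mulfV ?gt_eqF// mulr1.
Qed.

(** In a cover of the support, each set meeting [thin c rho] is enclosed in a ball about a thin
    point with radius twice its diameter [D], whose mass is at most [c * (2 D)^s]. Adding up
    recovers the Hausdorff sum. *)
Lemma thin_small (H c rho : R) (N : set X) : 0 <= c -> 0 < rho ->
  (hausdorff s (msupp mu) < H%:E)%E ->
  measurable N -> (forall x, ~ N x -> msupp mu x) ->
  (mu (thin c rho `\` N : set X) <= (c * 2 `^ s * H)%:E)%E.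
Proof.
move=> c0 rho0 hH mN NS.
(* With diameters at most [rho / 4], the doubled radius stays below [rho]. *)
have r40 : 0 < rho / 4 by rewrite divr_gt0.
have : (Hdelta s (rho / 4) (msupp mu) < H%:E)%E.
  by apply: le_lt_trans hH; apply: ereal_sup_ubound; exists (rho / 4).
move=> /ereal_inf_lt[_ [U [cU dU] <-] sU].
have [x xP] : exists x : nat -> V, forall i,
    (exists2 y, U i y & thin c rho y) -> U i (x i) /\ thin c rho (x i).
  have h i : exists y, (exists2 y, U i y & thin c rho y) -> U i y /\ thin c rho y.
    have [[y Uy ty]|n] := pselect (exists2 y, U i y & thin c rho y); first by exists y.
    by exists 0 => /n.
  by have [x hx] := choice h; exists x.
pose D i := ediam (U i).
pose C i : set X := if pselect (exists2 y, U i y & thin c rho y) then cball (x i) (D i) else set0.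
have mC i : measurable (C i).
  by rewrite /C; case: pselect => h //=; exact: measurable_cball.
have muC i : (mu (C i) <= (c * 2 `^ s * D i `^ s)%:E)%E.
  rewrite /C; case: pselect => [h|h] /=; last first.
    by rewrite measure0 lee_fin !mulr_ge0 ?powR_ge0.
  have [Ux tx] := xP i h.
  have Dle : D i <= rho / 4.
    apply: ge_sup; first by exists (enorm (x i - x i)), (x i), (x i).
    by move=> t [y [z [Uy [Uz ->]]]]; exact: (dU i).
  have D0 : 0 <= D i.
    apply: (le_trans (enorm_ge0 (x i - x i))); apply: ub_le_sup; last by exists (x i), (x i).
    by exists (rho / 4) => t [u [v [Uu [Uv ->]]]]; exact: (dU i).
  have [E0|En] := eqVneq (D i) 0.
    by rewrite E0 nice_point lee_fin !mulr_ge0 ?powR_ge0.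
  have Dp : 0 < D i by rewrite lt_def En.
  have D2 : 0 < 2 * D i by rewrite mulr_gt0.
  apply: (@le_trans _ _ (mu (eball (x i) (2 * D i)))).
    apply: le_measure; rewrite ?inE; [exact: measurable_cball|exact: measurable_eball|].
    by move=> y; rewrite /cball /eball/=; lra.
  have := tx (2 * D i) D2; rewrite powRM ?(ltW Dp)// mulrA; apply.
  lra.
have mA : measurable (thin c rho `\` N : set X).
  by apply: measurableD => //; exact: measurable_thin.
have sub : (thin c rho `\` N : set X) `<=` \bigcup_i C i.
  move=> y [ty Ny]; have [i _ Uy] := cU y (NS y Ny); exists i => //.
  rewrite /C; case: pselect => [h|h] /=; last by exfalso; apply: h; exists y.
  have [Ux tx] := xP i h; rewrite /cball/=; apply: ub_le_sup; last by exists y, (x i).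
  by exists (rho / 4) => t [u [v [Uu [Uv ->]]]]; exact: (dU i).
apply: (le_trans (@measure_sigma_subadditive _ _ _ mu _ _ mC mA sub)).
apply: (@le_trans _ _ (\sum_(0 <= i <oo) ((c * 2 `^ s)%:E * (D i `^ s)%:E))%E).
  by apply: lee_nneseries => i _; rewrite ?measure_ge0// -EFinM.
rewrite nneseriesZl; last by move=> i _; rewrite lee_fin powR_ge0.
by rewrite (EFinM (c * 2 `^ s) H) lee_wpmul2l ?lee_fin ?mulr_ge0 ?powR_ge0// ltW.
Qed.

(** [B k] collects the points outside [N] at which all small balls have density at most [e k]. The
    bound of [thin_small] does not depend on the scale, so [B k] has measure [O(e k)] and the
    intersection of the [B k] is null; elsewhere some [e k] serves as [c]. *)
Lemma upper_density : (hausdorff s (msupp mu) < +oo)%E ->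
  exists Z : set X, [/\ measurable Z, mu Z = 0%E &
    forall x : V, ~ Z x -> exists2 c : R, 0 < c & forall rho : R, 0 < rho ->
      exists r : R, [/\ 0 < r, r < rho & ((c * r `^ s)%:E < mu (eball x r))%E]].
Proof.
move=> hH.
have [H H0 HH] : exists2 H : R, 0 <= H & (hausdorff s (msupp mu) < H%:E)%E.
  move: hH; move: (hausdorff _ _) => [h _|//|_].
    exists (Num.max h 0 + 1); first by rewrite addr_ge0// le_max lexx orbT.
    by rewrite lte_fin ltr_pwDr// le_max lexx.
  by exists 0 => //; rewrite ltNyr.
have [N [mN N0 NS]] := msupp_compl_null.
pose e n : R := n.+1%:R^-1.
have e0 n : 0 < e n by rewrite invr_gt0.
pose A k m : set X := thin (e k) (e m) `\` N.
have mA k m : measurable (A k m) by apply: measurableD => //; exact: measurable_thin.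
pose B k : set X := \bigcup_m A k m.
have mB k : measurable (B k) by exact: bigcup_measurable.
have muB k : (mu (B k) <= (2 `^ s * H * e k)%:E)%E.
  have nd : nondecreasing_seq (A k).
    apply/nondecreasing_seqP => m; apply/subsetPset => y [ty Ny]; split=> // r r0 rm.
    apply: ty => //; apply: (lt_le_trans rm); rewrite lef_pV2 ?posrE// ler_nat //.
  have cv : (mu \o A k) @ \oo --> mu (B k) := nondecreasing_cvg_mu (mA k) (mB k) nd.
  rewrite -(cvg_lim _ cv)//; apply: lime_le; first by apply/cvg_ex; eexists; exact: cv.
  apply: nearW => m /=; apply: (le_trans (thin_small (ltW (e0 k)) (e0 m) HH mN NS)).
  by rewrite lee_fin -mulrA mulrC.
exists (N `|` \bigcap_k B k); split.
- by apply: measurableU => //; apply: bigcap_measurable.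
- apply/eqP; rewrite -measure_le0; apply/lee_addgt0Pr => ep ep0; rewrite add0e.
  have mI : measurable (\bigcap_k B k) by apply: bigcap_measurable.
  have hU : (mu (N `|` \bigcap_k B k) <= mu N + mu (\bigcap_k B k))%E by exact: measureU2.
  apply: (le_trans hU); rewrite N0 add0e.
  pose k := Num.truncn (2 `^ s * H / ep).
  apply: (@le_trans _ _ (mu (B k))).
    by apply: le_measure; rewrite ?inE//; exact: bigcap_inf.
  apply: (le_trans (muB k)); rewrite lee_fin.
  rewrite ler_pdivrMr// [ep * _]mulrC -ler_pdivrMr//; exact: ltW (truncnS_gt _).
- move=> x /not_orP[Nx Bx].
  have [k Bk] : exists k, ~ B k x.
    by apply: contrapT => /forallNP h; apply: Bx => k _; apply: contrapT; exact: h.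
  exists (e k) => // rho rho0; pose m := Num.truncn rho^-1.
  have em : e m <= rho by rewrite /e invf_ple ?posrE//; exact: ltW (truncnS_gt _).
  apply: contrapT => h; apply: Bk; exists m => //; split=> // r r0 rm.
  rewrite leNgt; apply/negP => h'; apply: h; exists r; split=> //.
  exact: lt_le_trans rm em.
Qed.

End density.

(** * Blow-ups and the far field *)

Section blowup.
Context (R : realType) (d : nat).
Local Notation V := 'rV[R]_d.
Local Notation X := (Rd R d).
Variables (s alpha Lam : R) (mu : bmeasure R d).
Hypotheses (s0 : 0 < s) (a0 : 0 < alpha) (a1 : alpha <= 1).
Hypotheses (Lam0 : 0 < Lam) (nmu : nice s Lam mu).

Definition blow (x : V) (r : R) (y : V) : V := r^-1 *: (y - x).

Lemma enorm_blow (x u y : V) (r : R) : 0 < r ->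
  enorm (blow x r y - u) = r^-1 * enorm (y - (x + r *: u)).
Proof.
move=> r0; rewrite -[in RHS](gtr0_norm (x := r^-1)) ?invr_gt0// -enormZ; congr enorm.
apply/rowP => i; rewrite !mxE; field; exact: lt0r_neq0.
Qed.

Lemma continuous_blow (x : V) (r : R) : 0 < r -> continuous (blow x r).
Proof.
move=> r0 y A /nbhs_eballP[e e0 eA]; apply/nbhs_eballP; exists (r * e).
  by rewrite mulr_gt0.
move=> z zy; apply: eA; rewrite /eball/= enorm_blow//.
rewrite (_ : x + r *: blow x r y = y).
  by rewrite mulrC ltr_pdivrMr// mulrC.
by apply/rowP => i; rewrite !mxE; field; exact: lt0r_neq0.
Qed.

Lemma Cc_blow (x : V) (r : R) (f : V -> R) : 0 < r -> Cc f -> Cc (fun y => f (blow x r y)).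
Proof.
move=> r0 [cf [N fN]]; split.
  by move=> y; apply: continuous_comp; [exact: continuous_blow|exact: cf].
exists (r * N + enorm x) => y h; apply: fN.
have := enorm_blow x 0 y r0; rewrite subr0 scaler0 addr0 => ->.
rewrite mulrC ler_pdivlMr// mulrC.
by have := enorm_triangle x y 0; rewrite !subr0; lra.
Qed.

(** The blow-up is exposed only through its values and its integrals of nonnegative functions; the
    lemmas below take these two facts as hypotheses on an arbitrary [m]. *)
Lemma blowup_exists (x : V) (r : R) : 0 < r -> exists m : bmeasure R d,
  (forall A : set X, measurable A -> m A = ((r `^ (- s))%:E * mu (blow x r @^-1` A))%E) /\
  forall f : X -> R, measurable_fun setT f -> (forall y, 0 <= f y) ->
    (\int[m]_y (f y)%:E = (r `^ (- s))%:E * \int[mu]_y (f (blow x r y))%:E)%E.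
Proof.
move=> r0; have mb : measurable_fun setT (blow x r : X -> X).
  by apply: continuous_measurable_RdRd; exact: continuous_blow.
pose k := NngNum (powR_ge0 r (- s)).
pose p : bmeasure R d := measure_function_pushforward__canonical__measure_function_Measure mu mb.
exists (mscale k p); split=> // f mf f0.
rewrite ge0_integral_mscale//; [|exact/measurable_EFinP|by move=> y _; rewrite lee_fin].
congr (_ * _)%E; rewrite ge0_integral_pushforward//.
  exact/measurable_EFinP.
by move=> y _; rewrite lee_fin.
Qed.

Variables (x : V) (r : R) (m : bmeasure R d).
Hypothesis r0 : 0 < r.
Hypothesis mE : forall A : set X, measurable A ->
  m A = ((r `^ (- s))%:E * mu (blow x r @^-1` A))%E.
Hypothesis intE : forall f : X -> R, measurable_fun setT f -> (forall y, 0 <= f y) ->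
    (\int[m]_y (f y)%:E = (r `^ (- s))%:E * \int[mu]_y (f (blow x r y))%:E)%E.

Lemma blowup_eball (u : V) (t : R) :
  m (eball u t) = ((r `^ (- s))%:E * mu (eball (x + r *: u) (r * t)))%E.
Proof.
rewrite mE; last exact: measurable_eball; congr (_ * mu _)%E.
by apply/seteqP; split=> y; rewrite /eball/= enorm_blow// ltr_pdivrMl.
Qed.

Lemma blowup_nice : nice s Lam m.
Proof.
move=> u t t0; rewrite blowup_eball.
have rt : 0 < r * t by rewrite mulr_gt0.
apply: (le_trans (lee_wpmul2l _ (nmu _ rt))); first by rewrite lee_fin powR_ge0.
rewrite -EFinM lee_fin powRM ?(ltW r0) ?(ltW t0)// powRN.
by rewrite mulrCA [_^-1 * (_ * _)]mulrA mulVf ?mul1r// gt_eqF// powR_gt0.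
Qed.

Lemma blowup_intg (f : V -> R) : Cc f ->
  \int[m]_y f y = r `^ (- s) * \int[mu]_y f (blow x r y).
Proof.
move=> Cf.
have Cp : Cc (fun y => Num.max (f y) 0) by apply: Cc_max => //; exact: Cc_cst0.
have Cn : Cc (fun y => Num.max (- f y) 0).
  apply: Cc_max; last exact: Cc_cst0.
  have := CcZ (-1) Cf.
  by congr Cc; apply/funext => y; rewrite mulN1r.
have E (h : V -> R) : Cc h -> (forall y, 0 <= h y) ->
    \int[m]_y h y = r `^ (- s) * \int[mu]_y h (blow x r y).
  move=> Ch h0; apply: EFin_inj; rewrite EFinM.
  rewrite (EFin_Rintegral (Cc_intg blowup_nice Ch)).
  rewrite (EFin_Rintegral (Cc_intg nmu (Cc_blow x r0 Ch))).
  by apply: intE => //; exact: Cc_measurable.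
have D y : f y = Num.max (f y) 0 - Num.max (- f y) 0.
  by rewrite !maxEle; case: ifP => h1; case: ifP => h2; lra.
have p0 y : 0 <= Num.max (f y) 0 by rewrite le_max lexx orbT.
have n0 y : 0 <= Num.max (- f y) 0 by rewrite le_max lexx orbT.
have -> : \int[m]_y f y = \int[m]_y Num.max (f y) 0 - \int[m]_y Num.max (- f y) 0.
  rewrite -(RintegralB measurableT (Cc_intg blowup_nice Cp) (Cc_intg blowup_nice Cn)).
  by apply: eq_Rintegral => y _; exact: D.
rewrite (E _ Cp p0) (E _ Cn n0) -mulrBr; congr (_ * _).
have := RintegralB measurableT (Cc_intg nmu (Cc_blow x r0 Cp)) (Cc_intg nmu (Cc_blow x r0 Cn)).
by move=> <-; apply: eq_Rintegral => y _; rewrite -D.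
Qed.

Variables (om : V -> R).
Hypothesis omP : real_CZ alpha om.

Lemma Cc_kd (delta : R) (f : V -> R) (u : V) : 0 < delta -> Cc f ->
  Cc (fun y => f y * kd s om delta (u - y)).
Proof.
move=> d0 Cf.
rewrite (_ : (fun y => _) = (fun y => kd s om delta (u - y) * f y)); last first.
  by apply/funext => y; rewrite mulrC.
apply: CcMl => //; apply/continuous_enormP => y e e0.
have [t t0 h] := kd_joint_cont s a0 a1 omP d0 u y e0.
by exists t => // y' hy; apply: h => //; rewrite subrr enorm0.
Qed.

(** The density factor [r^(-s)] of the blow-up is absorbed by the homogeneity of the kernel; only
    the truncation level changes. *)
Lemma blowup_Tr (delta : R) (f : V -> R) (u : V) : 0 < delta -> Cc f ->
  Tr s om m delta f u = Tr s om mu (r * delta) (fun y => f (blow x r y)) (x + r *: u).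
Proof.
move=> d0 Cf; have Ck := Cc_kd u d0 Cf; rewrite /Tr (blowup_intg Ck).
rewrite -(RintegralZl (r `^ (- s)) measurableT (Cc_intg nmu (Cc_blow x r0 Ck))).
apply: eq_Rintegral => y _; rewrite mulrCA; congr (_ * _).
rewrite -(kd_scale s omP (u - blow x r y) r0 d0); congr kd.
by apply/rowP => i; rewrite !mxE; field; exact: lt0r_neq0.
Qed.

Let blowK (v : V) : x + r *: blow x r v = v.
Proof. by apply/rowP => i; rewrite !mxE; field; exact: lt0r_neq0. Qed.

Lemma blowup_Pr (delta : R) (f g : V -> R) : 0 < delta -> Cc f -> Cc g ->
  Pr s om m delta f g =
    r `^ (- s) * Pr s om mu (r * delta) (fun y => f (blow x r y)) (fun y => g (blow x r y)).
Proof.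
move=> d0 Cf Cg; have CT : Cc (fun u => g u * Tr s om m delta f u).
  rewrite (_ : (fun y => _) = (fun y => Tr s om m delta f y * g y)); last first.
    by apply/funext => y; rewrite mulrC.
  apply: CcMl => //; apply: (Tr_cont s0 a0 a1 omP Lam0 blowup_nice d0).
  exact: (Cc_L2r blowup_nice Cf).
rewrite /Pr (blowup_intg CT); congr (_ * _); apply: eq_Rintegral => y _.
by rewrite (blowup_Tr _ d0 Cf) blowK.
Qed.

Lemma blowup_rgood (Lg : R) : rgood s om Lg mu -> rgood s om Lg m.
Proof.
move=> gmu delta f d0 Cf.
have rd : 0 < r * delta by rewrite mulr_gt0.
have cT : continuous (Tr s om m delta f).
  by apply: (Tr_cont s0 a0 a1 omP Lam0 blowup_nice d0); exact: (Cc_L2r blowup_nice Cf).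
rewrite intE; last by move=> y; exact: sqr_ge0.
  rewrite intE; last by move=> y; exact: sqr_ge0.
    rewrite muleCA; apply: lee_wpmul2l; first by rewrite lee_fin powR_ge0.
    apply: le_trans (gmu (r * delta) _ rd (Cc_blow x r0 Cf)).
    rewrite le_eqVlt; apply/orP; left; apply/eqP; apply: eq_integral => y _.
    by rewrite (blowup_Tr _ d0 Cf) blowK.
  by apply: measurable_funX; exact: Cc_measurable.
by apply: measurable_funX; exact: continuous_measurable_Rd.
Qed.

End blowup.

Lemma Rintegral_cst0 (R : realType) (d : nat) (mu : bmeasure R d) :
  \int[mu]_x (cst 0 x : R) = 0.
Proof. by apply: EFin_inj; rewrite EFin_Rintegral ?integral0//; exact: integrable0. Qed.

Section far_field.
Context (R : realType) (d : nat).
Local Notation V := 'rV[R]_d.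
Local Notation X := (Rd R d).
Variables (s alpha Lam : R) (mu : bmeasure R d) (om : V -> R).
Hypotheses (s0 : 0 < s) (a0 : 0 < alpha) (a1 : alpha <= 1).
Hypotheses (Lam0 : 0 < Lam) (nmu : nice s Lam mu) (omP : real_CZ alpha om).
Variables (c : V) (rho1 rho2 delta : R) (w : V -> R).
Hypotheses (r10 : 0 < rho1) (r12 : 2 * rho1 <= rho2) (d0 : 0 < delta) (dr : delta <= rho1).
Hypothesis mw : measurable_fun setT (w : X -> R).
Hypothesis w1 : forall y, `|w y| <= 1.
Hypothesis w0 : forall y : V, enorm (y - c) < rho2 -> w y = 0.

(** The kernel recentred at [c]. The subtracted term does not depend on [u], so pairings with
    functions of mean zero are unchanged, while the decay in [y] improves by the power [alpha]. *)
Definition kdc (u y : V) : R := w y * (kd s om delta (u - y) - kd s om delta (c - y)).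

(** Up to a constant this is [(rho1 / rho2)^alpha]; it is therefore invariant under dilation. *)
Definition Kfar : R := Creg s * rho1 `^ alpha * (Cfar s Lam alpha * rho2 `^ (- alpha)).

Lemma Kfar_ge0 : 0 <= Kfar.
Proof.
by apply: mulr_ge0; apply: mulr_ge0; rewrite ?powR_ge0 ?(ltW (Creg_gt0 s0))// (Cfar_ge0 s Lam0 a0).
Qed.

Lemma kdc_le (u y : V) : enorm (u - c) <= rho1 ->
  `|kdc u y| <= Creg s * rho1 `^ alpha * Num.max rho2 (enorm (y - c)) `^ (- (s + alpha)).
Proof.
move=> uc; have C0 : 0 <= Creg s * rho1 `^ alpha.
  by rewrite mulr_ge0 ?powR_ge0// ltW// Creg_gt0.
have [yc|yc] := ltP (enorm (y - c)) rho2.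
  by rewrite /kdc w0// mul0r normr0 mulr_ge0// powR_ge0.
rewrite /kdc normrM -[leRHS]mul1r; apply: ler_pM => //.
have yu : rho1 <= enorm (u - y).
  by rewrite (enormB u); have := enorm_triangle u y c; move: r10 r12; lra.
have dr' := dr; have r10' := r10; have r12' := r12.
(* Both [u - y] and [c - y] have norm at least [rho1 >= delta], so neither truncation is active. *)
rewrite !kd_far; [|by rewrite (enormB c); lra|lra].
have cy0 : 0 < enorm (c - y) by rewrite (enormB c); lra.
have e1 : (c - y) - (u - y) = c - u by apply/rowP => i; rewrite !mxE; ring.
have cu : enorm ((c - y) - (u - y)) <= enorm (c - y) / 2.
  by rewrite e1 (enormB c y) (enormB c u); lra.
rewrite distrC; apply: (le_trans (k0_reg s0 a0 a1 omP cy0 cu)).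
rewrite e1 (enormB c y) (enormB c u) -mulrA ler_wpM2l ?(ltW (Creg_gt0 s0))// ler_wpM2r ?powR_ge0//.
by apply: ge0_ler_powR; rewrite ?nnegrE ?enorm_ge0// ltW.
Qed.

Lemma measurable_kdc (u : V) : measurable_fun setT (kdc u : X -> R).
Proof.
apply: measurable_funM => //; apply: measurable_funB; exact: (measurable_kd s a0 a1 omP).
Qed.

Lemma kdc_intg (u : V) : enorm (u - c) <= rho1 ->
  intg mu (kdc u) /\ \int[mu]_y `|kdc u y| <= Kfar.
Proof.
move=> uc.
have C0 : 0 <= Creg s * rho1 `^ alpha.
  by rewrite mulr_ge0 ?powR_ge0// ltW// Creg_gt0.
have r20 : 0 < rho2 by apply: lt_le_trans r12; rewrite mulr_gt0.
have := intg_far Lam0 nmu (measurable_kdc u) C0 a0 r20 s0 (fun y => kdc_le y uc).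
by rewrite /Kfar.
Qed.

Lemma far_field (psi : V -> R) (B : R) : measurable_fun setT (psi : X -> R) ->
  (forall u, `|psi u| <= B) -> (forall u, ~ eball c rho1 u -> psi u = 0) ->
  intg mu (fun u => psi u * \int[mu]_y kdc u y) /\
  `|\int[mu]_u (psi u * \int[mu]_y kdc u y)| <= B * Kfar * (Lam * rho1 `^ s).
Proof.
move=> mpsi psiB psi0.
pose F u y := psi u * kdc u y.
have iF u : intg mu (F u).
  have [uc|uc] := pselect (eball c rho1 u).
    by apply: intgZ; case: (kdc_intg (ltW uc)).
  rewrite (_ : F u = cst 0); first exact: integrable0.
  by apply/funext => y; rewrite /F psi0// mul0r.
have [ipsi _] := intg_bounded nmu r10 mpsi psiB psi0.
have FG u : \int[mu]_y `|F u y| <= Kfar * `|psi u|.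
  have [uc|uc] := pselect (eball c rho1 u); last first.
    rewrite psi0// normr0 mulr0 (_ : (fun y => _) = cst 0) ?Rintegral_cst0//.
    by apply/funext => y; rewrite /F psi0// mul0r normr0.
  have [ik hk] := kdc_intg (ltW uc).
  under eq_Rintegral do rewrite normrM.
  by rewrite (RintegralZl _ measurableT (intg_norm ik)) mulrC ler_wpM2r.
have mF : measurable_fun setT (fun p : X * X => F p.1 p.2).
  apply: measurable_funM; first exact: (measurableT_comp mpsi measurable_fst).
  apply: measurable_funM; first exact: (measurableT_comp mw measurable_snd).
  apply: measurable_funB; first exact: (measurable_kdB s a0 a1 omP d0).
  exact: (measurableT_comp (measurable_kd s a0 a1 omP c d0) measurable_snd).
have smu := nice_sigma_finite nmu.
have := fubini_intg smu mF iF (intgZ Kfar (intg_norm ipsi)) FG.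
have E : (fun u => \int[mu]_y F u y) = (fun u => psi u * \int[mu]_y kdc u y).
  apply/funext => u; have [uc|uc] := pselect (eball c rho1 u).
    by rewrite (RintegralZl _ measurableT (kdc_intg (ltW uc)).1).
  rewrite psi0// mul0r (_ : F u = cst 0) ?Rintegral_cst0//.
  by apply/funext => y; rewrite /F psi0// mul0r.
rewrite E => i; split=> //.
have hM u : `|psi u * \int[mu]_y kdc u y| <= B * Kfar.
  have [uc|uc] := pselect (eball c rho1 u); last first.
    by rewrite psi0// mul0r normr0 mulr_ge0 ?Kfar_ge0//; exact: le_trans (psiB 0).
  have [ik hk] := kdc_intg (ltW uc); rewrite normrM; apply: ler_pM => //.
  exact: le_trans (le_normr_Rintegral measurableT ik) hk.
have hN u : ~ eball c rho1 u -> psi u * \int[mu]_y kdc u y = 0.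
  by move=> uc; rewrite psi0// mul0r.
have [_ hh] := intg_bounded nmu r10 (intg_measurable i) hM hN.
exact: le_trans (le_normr_Rintegral measurableT i) hh.
Qed.

(** Since [psi] has mean zero, the constant [Tr w c] may be subtracted from [Tr w]. *)
Lemma far_field_Pr (psi : V -> R) : L2r mu w -> Cc psi ->
  (forall u, ~ eball c rho1 u -> psi u = 0) -> \int[mu]_u psi u = 0 ->
  Pr s om mu delta w psi = \int[mu]_u (psi u * \int[mu]_y kdc u y).
Proof.
move=> Lw Cpsi psi0 psiI; have [B B0 psiB] := Cc_bounded Cpsi.
have [i1 _] := far_field (Cc_measurable Cpsi) psiB psi0.
have i2 := intgZ (Tr s om mu delta w c) (Cc_intg nmu Cpsi).
have : \int[mu]_u (Tr s om mu delta w c * psi u) = 0.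
  by rewrite (RintegralZl _ measurableT (Cc_intg nmu Cpsi)) psiI mulr0.
move=> h; rewrite -[RHS]addr0 -h -(RintegralD measurableT i1 i2) /Pr.
apply: eq_Rintegral => u _; rewrite [_ * psi u]mulrC -mulrDr; congr (_ * _).
have t1 := Tr_intg s0 a0 a1 omP Lam0 nmu u d0 Lw.
have t2 := Tr_intg s0 a0 a1 omP Lam0 nmu c d0 Lw.
apply/eqP; rewrite -subr_eq /Tr -(RintegralB measurableT t1 t2); apply/eqP.
by apply: eq_Rintegral => y _; rewrite /kdc mulrBr.
Qed.

End far_field.

(** * Smallness of the truncated pairing at almost every point *)

Section vanishing.
Context (R : realType) (d : nat).
Local Notation V := 'rV[R]_d.
Local Notation X := (Rd R d).
Variables (s alpha Lam Lg : R) (mu : bmeasure R d) (om : V -> R).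
Hypotheses (s0 : 0 < s) (a0 : 0 < alpha) (a1 : alpha <= 1).
Hypotheses (Lam0 : 0 < Lam) (nmu : nice s Lam mu) (omP : real_CZ alpha om).
Hypothesis gmu : rgood s om Lg mu.

(** The bound is asked for arbitrarily small truncations, not for all small ones: this is what a
    limit along an ultrafilter provides, and [blow_est] uses a single such [eta]. *)
Definition vanishing (chi : V -> R) (x : V) (kap r : R) : Prop :=
  forall (psi : V -> R) (eta0 : R), Cc psi -> (forall y, `|psi y| <= 1) ->
    (forall y, ~ eball x r y -> psi y = 0) -> \int[mu]_y psi y = 0 -> 0 < eta0 ->
    exists eta : R, [/\ 0 < eta, eta < eta0 & `|Pr s om mu eta chi psi| <= kap * r `^ s].

Lemma vanishing_ae (chi : V -> R) : Cc chi ->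
  exists Z : set X, [/\ measurable Z, mu Z = 0%E &
    forall x, ~ Z x -> forall kap : R, 0 < kap -> exists2 rho : R, 0 < rho &
      forall r : R, 0 < r -> r < rho -> vanishing chi x kap r].
Proof.
move=> Cchi; have [U [UF ooU]] := ultraFilterLemma (F := \oo) _.
have FU : ProperFilter U by exact: ultra_proper.
pose e n : R := n.+1%:R^-1.
have e0 n : 0 < e n by rewrite invr_gt0.
pose Q := Lg ^+ 2 * \int[mu]_x (chi x ^+ 2).
have I0 (h : V -> R) : 0 <= \int[mu]_x (h x ^+ 2).
  by apply: Rintegral_ge0 => x _; exact: sqr_ge0.
have Q0 : 0 <= Q by rewrite mulr_ge0 ?sqr_ge0.
have PQ n (h : V -> R) : Cc h -> Pr s om mu (e n) chi h ^+ 2 <= Q * \int[mu]_x (h x ^+ 2).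
  by move=> Ch; exact: (Pr_le s0 a0 a1 omP Lam0 nmu gmu (e0 n) Cchi Ch).
pose l (h : V -> R) : R := lim (Pr s om mu (e n) chi h @[n --> U]).
have lP (h : V -> R) : Cc h -> Pr s om mu (e n) chi h @[n --> U] --> l h.
  (* The inequality [|p| <= p^2 + 1] turns the bound on the square into a bound on the pairing. *)
  move=> Ch; apply: (ultra_bounded_cvg UF (M := Q * \int[mu]_x (h x ^+ 2) + 1)) => n.
  have := PQ n h Ch; move: (Pr _ _ _ _ _ _) (Q * _) => p q hq.
  have : `|p| ^+ 2 <= q by rewrite real_normK ?num_real.
  have := normr_ge0 p; move: `|p| => t t0 tq.
  by have := sqr_ge0 (t - 1); rewrite sqrrB; nra.
have Lchi := Cc_L2r nmu Cchi.
have lD (f g : V -> R) : Cc f -> Cc g -> l (fun x => f x + g x) = l f + l g.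
  move=> Cf Cg; apply: cvg_lim => //.
  rewrite (_ : (fun n => _) = fun n => Pr s om mu (e n) chi f + Pr s om mu (e n) chi g).
    by apply: cvgD; exact: lP.
  by apply/funext => n; exact: (PrDr s0 a0 a1 omP Lam0 nmu (e0 n) Lchi Cf Cg).
have lZ (a : R) (f : V -> R) : Cc f -> l (fun x => a * f x) = a * l f.
  move=> Cf; apply: cvg_lim => //.
  rewrite (_ : (fun n => _) = fun n => a * Pr s om mu (e n) chi f).
    by apply: cvgM; [exact: cvg_cst|exact: lP].
  by apply/funext => n; exact: (PrZr s0 a0 a1 omP Lam0 nmu a (e0 n) Lchi Cf).
have lQ (h : V -> R) : Cc h -> l h ^+ 2 <= Q * \int[mu]_x (h x ^+ 2).
  move=> Ch.
  have cv : Pr s om mu (e n) chi h ^+ 2 @[n --> U] --> l h ^+ 2.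
    by rewrite expr2; under eq_fun do rewrite expr2; apply: cvgM; exact: lP.
  rewrite -(cvg_lim _ cv)//; apply: limr_le; first by apply/cvg_ex; eexists; exact: cv.
  by apply: nearW => n; exact: PQ.
have [Z [mZ Z0 ZP]] := lebesgue_point Lam0 nmu lD lZ Q0 lQ.
exists Z; split=> // x Zx kap k0.
have k20 : 0 < kap / 2 by rewrite divr_gt0.
have [rho rho0 h] := ZP x Zx (kap / 2) k20; exists rho => // r r0 rr.
move=> psi eta0 Cpsi psi1 psi0 psiI et0.
have hl := h r psi r0 rr Cpsi psi1 psi0 psiI.
have kr0 : 0 < kap / 2 * r `^ s by rewrite mulr_gt0// powR_gt0.
have /cvgrPdist_le/(_ _ kr0) n1 := lP psi Cpsi.
have n2 : \forall n \near U, e n < eta0.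
  by apply: ooU; exact: near_infty_natSinv_lt (PosNum et0).
have [n [hn1 hn2]] := filter_ex (filterI n1 n2).
exists (e n); split=> //.
move: hl hn1; move: (l psi) (Pr _ _ _ _ _ _) (r `^ s) => p q t.
by rewrite !ler_norml => /andP[? ?] /andP[? ?]; apply/andP; split; lra.
Qed.

Variables (x : V) (K : R).
Hypothesis xK : enorm x < K.
Local Notation chi := (@cutoff R d 0 (K + 1)).

Lemma Kfar_scale (N M r : R) : 0 < N -> 0 < M -> 0 < r ->
  Kfar s alpha Lam (N * r) (M * r) = Kfar s alpha Lam N M.
Proof.
move=> N0 M0 r0; rewrite /Kfar !powRM ?(ltW N0) ?(ltW M0) ?(ltW r0)// powRN.
have p0 := powR_gt0 alpha r0; have q0 := powR_gt0 alpha M0.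
rewrite [r `^ (- _)]powRN; field.
by rewrite !gt_eqF.
Qed.

(* The truncation at [delta] is replaced by a much smaller one by [Pr_diff], [cutoff 0 M] is
   replaced by [chi] by [far_field_Pr], and what remains is small at a vanishing point. *)
Lemma blow_est (r N M B L kap delta : R) (m : bmeasure R d) (psi : V -> R) :
  0 < r -> 1 <= N -> 2 * N <= M -> 1 <= B -> 1 <= L -> 0 < delta -> M * r <= 1 -> 0 <= kap ->
  (forall A : set X, measurable A -> m A = ((r `^ (- s))%:E * mu (blow x r @^-1` A))%E) ->
  (forall f : X -> R, measurable_fun setT f -> (forall y, 0 <= f y) ->
    (\int[m]_y (f y)%:E = (r `^ (- s))%:E * \int[mu]_y (f (blow x r y))%:E)%E) ->
  Cc psi -> (forall y, `|psi y| <= B) -> (forall y : V, N <= enorm y -> psi y = 0) ->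
  (forall y z : V, `|psi y - psi z| <= L * enorm (y - z)) -> \int[m]_y psi y = 0 ->
  vanishing chi x kap (N * r) ->
  `|Pr s om m delta (cutoff 0 M) psi| <=
    2 * L * B * (Cnear s Lam * delta) * (Lam * (2 * M) `^ s) +
    B * Kfar s alpha Lam N M * (Lam * N `^ s) + kap * B * N `^ s.
Proof.
move=> r0 N1 NM B1 L1 d0 Mr k0 mE intE Cpsi psiB psiN psiL psiI van.
have N0 : 0 < N by lra.
have M0 : 0 < M by lra.
have B0 : 0 < B by lra.
have Nr0 : 0 < N * r by rewrite mulr_gt0.
have nm := blowup_nice nmu r0 mE.
have Cphi : Cc (@cutoff R d 0 M) by exact: cutoff_Cc.
pose Psi y := psi (blow x r y); pose Phi y := @cutoff R d 0 M (blow x r y).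
have CPsi : Cc Psi by exact: Cc_blow.
have CPhi : Cc Phi by exact: Cc_blow.
have nb y : enorm (blow x r y) = r^-1 * enorm (y - x).
  by have := enorm_blow x 0 y r0; rewrite subr0 scaler0 addr0.
have Psi0 y : ~ eball x (N * r) y -> Psi y = 0.
  move=> /negP; rewrite /eball/= -leNgt => h; apply: psiN; rewrite nb.
  by rewrite ler_pdivlMl// mulrC.
have PsiI : \int[mu]_y Psi y = 0.
  have := blowup_intg nmu r0 mE intE Cpsi; rewrite psiI => /esym/eqP.
  by rewrite mulf_eq0 gt_eqF ?powR_gt0//= => /eqP.
(* [eta < r * delta] is for the comparison of truncations after rescaling, [eta < N * r] for the far
   field. Division by [B] meets the normalization in [vanishing]. *)
have [eta [e0 eta0 hvan]] : exists eta, [/\ 0 < eta, eta < Num.min (r * delta) (N * r) &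
    `|Pr s om mu eta chi (fun y => B^-1 * Psi y)| <= kap * (N * r) `^ s].
  apply: van; [exact: CcZ| | | |by rewrite lt_min mulr_gt0//=].
  - by move=> y; rewrite normrM gtr0_norm ?invr_gt0// mulrC ler_pdivrMr// mul1r; exact: psiB.
  - by move=> y /Psi0 ->; rewrite mulr0.
  - by rewrite (RintegralZl _ measurableT (Cc_intg nmu CPsi)) PsiI mulr0.
move: eta0; rewrite lt_min => /andP[er eN].
have K0 : 0 < K by exact: le_lt_trans (enorm_ge0 x) xK.
have K10 : 0 < K + 1 by rewrite addr_gt0.
have Cchi : Cc chi by exact: cutoff_Cc.
rewrite (PrZr s0 a0 a1 omP Lam0 nmu B^-1 e0 (Cc_L2r nmu Cchi) CPsi) in hvan.
pose w y := chi y - Phi y.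
have Cw : Cc w by exact: CcB.
have w1 y : `|w y| <= 1.
  have := cutoff_ge0 0 (K + 1) y; have := cutoff_le1 0 (K + 1) y.
  have := cutoff_ge0 0 M (blow x r y); have := cutoff_le1 0 M (blow x r y).
  by rewrite /w /Phi ler_norml; move: (cutoff _ _ _) (cutoff _ _ _) => p q; lra.
(* As [M * r <= 1] and [enorm x < K], the ball [B(x, M r)] lies in [B(0, K + 1)], so both cutoffs
   equal 1 on it. *)
have w0 (y : V) : enorm (y - x) < M * r -> w y = 0.
  move=> h; rewrite /w /Phi !cutoff1 ?subrr//.
    by rewrite subr0 nb ler_pdivrMl// mulrC ltW.
  have := enorm_triangle x y 0; move: xK; rewrite !subr0; lra.
have NMr : 2 * (N * r) <= M * r by rewrite mulrA ler_pM2r.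
have mw := Cc_measurable Cw.
have hfar := far_field_Pr s0 a0 a1 Lam0 nmu omP Nr0 NMr e0 (ltW eN) mw w1 w0
  (Cc_L2r nmu Cw) CPsi Psi0 PsiI.
have [_ hfar2] := far_field s0 a0 a1 Lam0 nmu omP Nr0 NMr e0 (ltW eN) mw w1 w0
  (Cc_measurable CPsi) (fun y => psiB (blow x r y)) Psi0.
rewrite -hfar in hfar2.
rewrite (PrBl s0 a0 a1 omP Lam0 nmu e0 (Cc_L2r nmu Cchi) (Cc_L2r nmu CPhi) CPsi) in hfar2.
have d'0 : 0 < eta / r by rewrite divr_gt0.
have d'd : eta / r <= delta by rewrite ler_pdivrMr// mulrC ltW.
have hPr := blowup_Pr s0 a0 a1 Lam0 nmu r0 mE intE omP d'0 Cphi Cpsi.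
rewrite [r * _]mulrC divfK ?gt_eqF// in hPr.
have M20 : 0 < 2 * M by rewrite mulr_gt0.
have hdiff : `|Pr s om m delta (cutoff 0 M) psi - Pr s om m (eta / r) (cutoff 0 M) psi| <=
    2 * L * B * (Cnear s Lam * delta) * (Lam * (2 * M) `^ s).
  apply: (Pr_diff s0 a0 a1 omP Lam0 nm) => //.
  - by lra.
  - exact: ltW.
  - by move=> y h; apply: cutoff0 => //; rewrite subr0.
  - by move=> y h; apply: psiN; lra.
  - move=> y; rewrite ger0_norm ?cutoff_ge0//; apply: le_trans B1; exact: cutoff_le1.
  - move=> y z; apply: (le_trans (cutoff_lip _ _ _ M0)).
    rewrite ler_wpM2r ?enorm_ge0//; apply: le_trans L1; rewrite invf_le1//; lra.
rewrite Kfar_scale// in hfar2.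
have p0 := powR_gt0 s r0.
have rs : r `^ (- s) * (N * r) `^ s = N `^ s.
  rewrite powRM ?(ltW N0) ?(ltW r0)// powRN; field; exact: lt0r_neq0.
have E1 : `|Pr s om m (eta / r) (cutoff 0 M) psi| <=
    B * Kfar s alpha Lam N M * (Lam * N `^ s) + kap * B * N `^ s.
  rewrite hPr normrM ger0_norm ?powR_ge0//.
  have q0 : 0 <= r `^ (- s) by exact: powR_ge0.
  rewrite (_ : _ + _ = r `^ (- s) * (B * Kfar s alpha Lam N M * (Lam * (N * r) `^ s) +
     B * (kap * (N * r) `^ s))); last by rewrite -rs; ring.
  rewrite ler_wpM2l//.
  move: hvan; rewrite normrM gtr0_norm ?invr_gt0// ler_pdivrMl//.
  move: hfar2; rewrite -/Psi -/Phi.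
  move: (Pr s om mu eta chi Psi) (Pr s om mu eta Phi Psi) => p q.
  move: (_ * (Lam * _)) (B * (kap * _)) => u v.
  by rewrite !ler_norml => /andP[? ?] /andP[? ?]; apply/andP; split; lra.
move: hdiff E1; move: (Pr s om m delta _ _) (Pr s om m (eta / r) _ _) => p q.
move: (B * Kfar _ _ _ _ _ * _) (kap * B * _) (2 * L * B * _ * _) => u v t.
by rewrite !ler_norml => /andP[? ?] /andP[? ?]; apply/andP; split; lra.
Qed.

End vanishing.

(** * Tangent measures *)

Section tangent.
Context (R : realType) (d : nat).
Local Notation V := 'rV[R]_d.
Local Notation X := (Rd R d).
Variables (s alpha Lam : R) (mu : bmeasure R d) (om : V -> R).
Hypotheses (s0 : 0 < s) (a0 : 0 < alpha) (a1 : alpha <= 1).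
Hypotheses (Lam0 : 0 < Lam) (nmu : nice s Lam mu) (omP : real_CZ alpha om).
Variables (x : V) (K : R).
Hypothesis xK : enorm x < K.
Hypothesis van : forall kap : R, 0 < kap -> exists2 rho : R, 0 < rho &
  forall r : R, 0 < r -> r < rho -> vanishing s mu om (cutoff 0 (K + 1)) x kap r.
Variables (r_ : nat -> R) (m_ : nat -> bmeasure R d).
Hypothesis r0 : forall j, 0 < r_ j.
Hypothesis rj : forall j, r_ j < j.+1%:R^-1.
Hypothesis mE : forall j (A : set X), measurable A ->
  m_ j A = ((r_ j `^ (- s))%:E * mu (blow x (r_ j) @^-1` A))%E.
Hypothesis intE : forall j (f : X -> R), measurable_fun setT f -> (forall y, 0 <= f y) ->
  (\int[m_ j]_y (f y)%:E = (r_ j `^ (- s))%:E * \int[mu]_y (f (blow x (r_ j) y))%:E)%E.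
Variable c : R.
Hypothesis c0 : 0 < c.
Hypothesis mc : forall j, (c%:E <= m_ j (eball 0 1))%E.
Variables (U : set_system nat) (UF : UltraFilter U).
Hypothesis ooU : \oo `<=` U.
Variable nu : bmeasure R d.
Hypothesis nnu : nice s Lam nu.
Hypothesis mu_nu : forall f, Cc f -> (\int[m_ j]_x f x) @[j --> U] --> \int[nu]_x f x.

Let nm j : nice s Lam (m_ j) := blowup_nice nmu (r0 j) (mE j).

Lemma le_of_eps (p b t : R) : 0 <= t -> (forall kap : R, 0 < kap -> p <= b + kap * t) -> p <= b.
Proof.
move=> t0 h; apply/ler_addgt0Pr => e e0.
have t1 : 0 < t + 1 by rewrite ltr_wpDl.
apply: (le_trans (h (e / (t + 1)) (divr_gt0 e0 t1))).
rewrite lerD2l mulrAC ler_pdivrMr// ler_pM2l//; lra.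
Qed.

Lemma mass_ge (j : nat) : c <= \int[m_ j]_y (cutoff 0 1 y).
Proof.
have C : Cc (@cutoff R d 0 1) by exact: cutoff_Cc.
have fin := nice_lty (nm j) 0 1.
have h : c <= fine (m_ j (eball 0 1)).
  by rewrite -lee_fin fineK ?ge0_fin_numE//; exact: mc.
apply: (le_trans h); apply: (ge_indic_int (measurable_eball _ _) fin (Cc_intg (nm j) C)).
  by move=> y; exact: cutoff_ge0.
by move=> y; rewrite /eball/= => /ltW yy; rewrite cutoff1.
Qed.

Lemma tangent_mass : c <= \int[nu]_y (cutoff 0 1 y).
Proof.
have FU : ProperFilter U by exact: ultra_proper.
have C : Cc (@cutoff R d 0 1) by exact: cutoff_Cc.
have cv := mu_nu C.
rewrite -(cvg_lim _ cv)//; apply: limr_ge; first by apply/cvg_ex; eexists; exact: cv.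
by apply: nearW => j; exact: mass_ge.
Qed.

(** For fixed [M] and [delta] the estimate [blow_est] passes to the limit in [j], and its last term
    disappears because [kap] is arbitrary. *)
Lemma tangent_vanishing (psi : V -> R) (L0 : R) : Cc psi -> 0 <= L0 ->
  (forall y z, `|psi y - psi z| <= L0 * enorm (y - z)) -> \int[nu]_y psi y = 0 ->
  exists N B L : R, [/\ 1 <= N, 1 <= B, 1 <= L & forall M delta : R, 2 * N <= M -> 0 < delta ->
   `|Pr s om nu delta (cutoff 0 M) psi| <=
    2 * L * B * (Cnear s Lam * delta) * (Lam * (2 * M) `^ s) +
    B * Kfar s alpha Lam N M * (Lam * N `^ s)].
Proof.
have FU : ProperFilter U by exact: ultra_proper.
move=> Cpsi L00 psiL psiI.
(* [N > 2] makes room for the support of [chi0]; the two [+ 1] below absorb the correction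
   [a * chi0], where [|a| <= 1]. *)
have [N [N2 N0] psiN] := Cc_support 2 Cpsi; have [B0 B00 psiB] := Cc_bounded Cpsi.
exists N, (B0 + 1), (L0 + 1); split; [lra|lra|lra|move=> M delta NM d0].
have M0 : 0 < M by lra.
pose chi0 : V -> R := cutoff 0 1.
have C0 : Cc chi0 by exact: cutoff_Cc.
have Cphi : Cc (@cutoff R d 0 M) by exact: cutoff_Cc.
set bnd := (X in _ <= X).
(* The summand 2 pays for the convergence of the pairing with [psi] and for the correction term. *)
apply: (@le_of_eps _ _ ((B0 + 1) * N `^ s + 2)).
  by rewrite addr_ge0// mulr_ge0 ?powR_ge0//; lra.
move=> kap k0.
have [rho rho0 hrho] := van k0.
pose p' := Pr s om nu delta (cutoff 0 M) chi0.
have /cvgrPdist_le/(_ 1 ltr01) n1 := Pr_lim s0 a0 a1 Lam0 omP UF nm nnu mu_nu d0 Cphi C0.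
have /cvgrPdist_le/(_ _ k0) n2 := Pr_lim s0 a0 a1 Lam0 omP UF nm nnu mu_nu d0 Cphi Cpsi.
have p'0 : 0 < `|p'| + 1 by rewrite ltr_wpDl.
(* The minimum ensures [|a| <= 1] and a correction term of at most [kap]; the factor [c] is the
   lower bound for the mass [J] by which [a] is divided. *)
have t0 : 0 < c * Num.min 1 (kap / (`|p'| + 1)).
  by rewrite mulr_gt0// lt_min ltr01 divr_gt0.
have /cvgrPdist_le/(_ _ t0) n3 := mu_nu Cpsi.
have q0 : 0 < Num.min (rho / N) M^-1 by rewrite lt_min divr_gt0// invr_gt0.
have n4 : \forall j \near U, j.+1%:R^-1 < Num.min (rho / N) M^-1.
  by apply: ooU; exact: near_infty_natSinv_lt (PosNum q0).
have [j [[hn1 hn2] [hn3 hn4]]] := filter_ex (filterI (filterI n1 n2) (filterI n3 n4)).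
have := lt_trans (rj j) hn4; rewrite lt_min => /andP[rN rM].
have J1 := mass_ge j; rewrite -/chi0 in J1.
set J := \int[m_ j]_y chi0 y in J1.
have J0 : 0 < J by exact: lt_le_trans c0 J1.
rewrite psiI sub0r normrN in hn3.
pose a := (\int[m_ j]_y psi y) / J.
have ha : `|a| <= Num.min 1 (kap / (`|p'| + 1)).
  rewrite /a normrM normfV (gtr0_norm J0) ler_pdivrMr//.
  apply: (le_trans hn3); rewrite mulrC ler_wpM2l// ltW//.
  by rewrite lt_min ltr01 divr_gt0.
move: ha; rewrite le_min => /andP[ha1 ha2].
(* [psi] has mean zero for [nu] only; [psij] has mean zero for [m_ j] *)
pose psij y := psi y - a * chi0 y.
have Cac : Cc (fun y => a * chi0 y) by exact: CcZ.
have Cpsij : Cc psij by exact: CcB.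
have est : `|Pr s om (m_ j) delta (cutoff 0 M) psij| <= bnd + kap * (B0 + 1) * N `^ s.
  apply: (blow_est s0 a0 a1 Lam0 nmu omP xK (r0 j)) => //; try lra.
  - by rewrite -ler_pdivlMl// mulr1 ltW.
  - exact: mE.
  - exact: intE.
  - move=> y; apply: (le_trans (ler_normB _ _)); rewrite lerD// normrM.
    rewrite -[leRHS]mul1r; apply: ler_pM => //.
    by rewrite ger0_norm ?cutoff_ge0// cutoff_le1.
  - move=> y yN; rewrite /psij psiN// /chi0 cutoff0 ?mulr0 ?subr0//; lra.
  - move=> y z; rewrite (_ : _ - _ = (psi y - psi z) - a * (chi0 y - chi0 z)); last by rewrite /psij; ring.
    apply: (le_trans (ler_normB _ _)); rewrite mulrDl lerD// normrM.
    apply: ler_pM => //; apply: (le_trans (cutoff_lip _ _ _ ltr01)).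
    by rewrite invr1 mul1r.
  - rewrite /psij (RintegralB measurableT (Cc_intg (nm j) Cpsi) (Cc_intg (nm j) Cac)).
    rewrite (RintegralZl _ measurableT (Cc_intg (nm j) C0)) -/J /a divfK ?subrr// gt_eqF//.
  - by apply: hrho; [rewrite mulr_gt0|rewrite mulrC -ltr_pdivlMr].
have Lphi := Cc_L2r (nm j) Cphi.
have E : Pr s om (m_ j) delta (cutoff 0 M) psi =
    Pr s om (m_ j) delta (cutoff 0 M) psij + a * Pr s om (m_ j) delta (cutoff 0 M) chi0.
  rewrite -(PrZr s0 a0 a1 omP Lam0 (nm j) a d0 Lphi C0).
  rewrite -(PrDr s0 a0 a1 omP Lam0 (nm j) d0 Lphi Cpsij Cac).
  by congr Pr; apply/funext => y; rewrite /psij subrK.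
rewrite E in hn2.
have hac : `|a * Pr s om (m_ j) delta (cutoff 0 M) chi0| <= kap.
  rewrite normrM -[leRHS](@divfK _ (`|p'| + 1)) ?gt_eqF//; apply: ler_pM => //.
  have := ler_normB p' (p' - Pr s om (m_ j) delta (cutoff 0 M) chi0).
  by rewrite subKr => /le_trans; apply; rewrite lerD2l.
move: hn2 hac est.
move: (Pr s om nu _ _ _) (Pr s om (m_ j) _ _ psij) (a * _) => u v t.
have -> : kap * ((B0 + 1) * N `^ s + 2) = kap * (B0 + 1) * N `^ s + 2 * kap by ring.
move: (_ * N `^ s) => z.
by rewrite !ler_norml => /andP[? ?] /andP[? ?] /andP[? ?]; apply/andP; split; lra.
Qed.

End tangent.

(** * Reflectionlessness for a real kernel *)

Section reflection.
Context (R : realType) (d : nat).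
Local Notation V := 'rV[R]_d.
Local Notation X := (Rd R d).
Variables (s alpha Lam : R) (nu : bmeasure R d) (om : V -> R).
Hypotheses (s0 : 0 < s) (a0 : 0 < alpha) (a1 : alpha <= 1).
Hypotheses (Lam0 : 0 < Lam) (nnu : nice s Lam nu) (omP : real_CZ alpha om).
Variables (c z : V) (r : R) (phi psi : V -> R).
Hypotheses (r0 : 0 < r) (zc : eball c r z).
Hypotheses (Lphi : L2r nu phi) (phi1 : forall y, eball c (2 * r) y -> phi y = 1).
Hypothesis phi01 : forall y, 0 <= phi y <= 1.
Hypotheses (Cpsi : Cc psi) (psi0 : forall u, ~ eball c r u -> psi u = 0).
Hypothesis psiI : \int[nu]_y psi y = 0.

Lemma Kfar_small (N e : R) : 0 < N -> 0 < e ->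
  exists2 M0 : R, 0 < M0 & forall M, M0 <= M -> Kfar s alpha Lam N M <= e.
Proof.
move=> N0 e0; pose C := Creg s * N `^ alpha * Cfar s Lam alpha + 1.
have C0 : 0 <= Creg s * N `^ alpha * Cfar s Lam alpha.
  apply: mulr_ge0; last exact: (Cfar_ge0 s Lam0 a0).
  by rewrite mulr_ge0 ?powR_ge0 ?(ltW (Creg_gt0 s0)).
have C1 : 0 < C by rewrite ltr_wpDl.
pose M0 := (e / C) `^ (- alpha^-1).
have eC : 0 < e / C by rewrite divr_gt0.
exists M0; first exact: powR_gt0.
move=> M MM; have M00 : 0 < M0 by exact: powR_gt0.
have h1 : M `^ (- alpha) <= e / C.
  apply: (@le_trans _ _ (M0 `^ (- alpha))).
    rewrite !powRN lef_pV2 ?posrE ?powR_gt0//; last exact: lt_le_trans M00 MM.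
    by apply: ge0_ler_powR; rewrite ?nnegrE ?(ltW a0) ?(ltW M00)// (le_trans (ltW M00)).
  by rewrite /M0 -powRrM mulrNN mulVf ?gt_eqF// powRr1// ltW.
rewrite /Kfar mulrA.
have p0 := powR_ge0 M (- alpha).
apply: (@le_trans _ _ (C * M `^ (- alpha))); first by rewrite ler_wpM2r// /C lerDl.
by rewrite mulrC -ler_pdivlMr.
Qed.

(** For [u] in [B(c, r)] the factor [1 - phi] vanishes near the singularities of both kernels, which
    may then be replaced by truncated ones. *)
Definition corrR (u : V) : R := \int[nu]_y ((1 - phi y) * (k0 s om (u - y) - k0 s om (z - y))).

Let w1 (y : V) : R := 1 - phi y.

Let mw1 : measurable_fun setT (w1 : X -> R).
Proof.
by apply: measurable_funB; [exact: measurable_cst|case: Lphi].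
Qed.

Let w11 y : `|w1 y| <= 1.
Proof. by have := phi01 y; rewrite /w1 ler_norml; lra. Qed.

Let w10 (y : V) : enorm (y - c) < 2 * r -> w1 y = 0.
Proof. by move=> h; rewrite /w1 phi1// subrr. Qed.

Let cr (y : V) : 2 * r <= enorm (y - c) -> forall u, eball c r u -> r <= enorm (u - y).
Proof.
move=> yc u; rewrite /eball/= => uc; have := enorm_triangle u y c.
by rewrite (enormB u y); lra.
Qed.

(** Recentring from [z] to [c] costs a quantity independent of [u], which mean zero removes later,
    and brings the correction into the form treated by [far_field]. *)
Let corrE (delta : R) (u : V) : 0 < delta -> delta <= r -> eball c r u ->
  corrR u = \int[nu]_y kdc s om c delta w1 u y - \int[nu]_y kdc s om c delta w1 z y.
Proof.
move=> d0 dr uc.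
have ik v : eball c r v -> intg nu (kdc s om c delta w1 v).
  by move=> vc; case: (kdc_intg s0 a0 a1 Lam0 nnu omP r0 (lexx _) d0 dr mw1 w11 w10 (ltW vc)).
rewrite -(RintegralB measurableT (ik u uc) (ik z zc)).
suff E y : (1 - phi y) * (k0 s om (u - y) - k0 s om (z - y)) =
    kdc s om c delta w1 u y - kdc s om c delta w1 z y.
  by apply: eq_Rintegral => y _; exact: E.
rewrite /kdc (_ : 1 - phi y = w1 y)//.
have [yc|yc] := ltP (enorm (y - c)) (2 * r); first by rewrite (w10 yc) !mul0r subrr.
rewrite -(kd_far s om (le_trans dr (cr yc zc))) -(kd_far s om (le_trans dr (cr yc uc))).
by ring.
Qed.

Let corr_cst (delta : R) : R := \int[nu]_y kdc s om c delta w1 z y.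

Let psi_corrE (delta : R) (u : V) : 0 < delta -> delta <= r ->
  psi u * corrR u = psi u * \int[nu]_y kdc s om c delta w1 u y - corr_cst delta * psi u.
Proof.
move=> d0 dr; have [uc|uc] := pselect (eball c r u); last by rewrite psi0// !mul0r mulr0 subrr.
by rewrite (corrE d0 dr uc) mulrBr [corr_cst _ * _]mulrC.
Qed.

Lemma corr_intg : intg nu (fun u => psi u * corrR u).
Proof.
have [B _ psiB] := Cc_bounded Cpsi.
have [i1 _] := far_field s0 a0 a1 Lam0 nnu omP r0 (lexx _) r0 (lexx _) mw1 w11 w10
  (Cc_measurable Cpsi) psiB psi0.
have i2 := intgZ (corr_cst r) (Cc_intg nnu Cpsi).
have := intgB i1 i2; congr (intg nu _); apply/funext => u.
by rewrite -psi_corrE.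
Qed.

(* Splitting [1 - phi] as [(cutoff 0 M - phi) + (1 - cutoff 0 M)]: the first summand is the
   difference of two pairings, the second contributes [O(M^(-alpha))]. *)
Lemma Pr_corr_le (delta M B : R) : 0 < delta -> delta <= r -> enorm c + 2 * r <= M ->
  (forall y, `|psi y| <= B) ->
  `|Pr s om nu delta phi psi + \int[nu]_u (psi u * corrR u)| <=
    `|Pr s om nu delta (cutoff 0 M) psi| + B * Kfar s alpha Lam r (M - enorm c) * (Lam * r `^ s).
Proof.
move=> d0 dr cM psiB.
have M0 : 0 < M by have := enorm_ge0 c; have := r0; lra.
pose phiM : V -> R := cutoff 0 M.
have CM : Cc phiM by exact: cutoff_Cc.
have LM := Cc_L2r nnu CM.
have phiM1 (y : V) : enorm (y - c) < M - enorm c -> phiM y = 1.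
  move=> h; apply: cutoff1 => //; have := enorm_triangle c y 0; rewrite !subr0; lra.
have phiM01 y : 0 <= phiM y <= 1 by rewrite cutoff_ge0 cutoff_le1.
pose w2 (y : V) : R := phiM y - phi y; pose w3 (y : V) : R := 1 - phiM y.
have mM := Cc_measurable CM.
have mw2 : measurable_fun setT (w2 : X -> R).
  by apply: measurable_funB => //; case: Lphi.
have mw3 : measurable_fun setT (w3 : X -> R).
  by apply: measurable_funB => //; exact: measurable_cst.
have w21 y : `|w2 y| <= 1.
  by have := phi01 y; have := phiM01 y; rewrite /w2 ler_norml; lra.
have w31 y : `|w3 y| <= 1.
  by have := phiM01 y; rewrite /w3 ler_norml; lra.
have w20 (y : V) : enorm (y - c) < 2 * r -> w2 y = 0.
  by move=> h; rewrite /w2 phi1// phiM1 ?subrr//; lra.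
have w30 (y : V) : enorm (y - c) < M - enorm c -> w3 y = 0.
  by move=> h; rewrite /w3 phiM1 ?subrr.
have rM : 2 * r <= M - enorm c by lra.
have Lw2 : L2r nu w2.
  split=> //; apply: (intg_le _ (intgD (intgZ 2 LM.2) (intgZ 2 Lphi.2))).
    by apply: measurable_funX.
  by move=> y; rewrite ger0_norm ?sqr_ge0// /w2; have := sqr_ge0 (phiM y + phi y); nra.
have [i1 _] := far_field s0 a0 a1 Lam0 nnu omP r0 (lexx _) d0 dr mw1 w11 w10
  (Cc_measurable Cpsi) psiB psi0.
have [i2 _] := far_field s0 a0 a1 Lam0 nnu omP r0 (lexx _) d0 dr mw2 w21 w20
  (Cc_measurable Cpsi) psiB psi0.
have [i3 h3] := far_field s0 a0 a1 Lam0 nnu omP r0 rM d0 dr mw3 w31 w30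
  (Cc_measurable Cpsi) psiB psi0.
have P2 := far_field_Pr s0 a0 a1 Lam0 nnu omP r0 (lexx _) d0 dr mw2 w21 w20 Lw2 Cpsi psi0 psiI.
rewrite (PrBl s0 a0 a1 omP Lam0 nnu d0 LM Lphi Cpsi) in P2.
have E1 : \int[nu]_u (psi u * corrR u) = \int[nu]_u (psi u * \int[nu]_y kdc s om c delta w1 u y).
  under eq_Rintegral do rewrite (psi_corrE _ d0 dr).
  have ic := intgZ (corr_cst delta) (Cc_intg nnu Cpsi).
  rewrite (RintegralB measurableT i1 ic).
  by rewrite (RintegralZl _ measurableT (Cc_intg nnu Cpsi)) psiI mulr0 subr0.
have E2 : \int[nu]_u (psi u * \int[nu]_y kdc s om c delta w1 u y) =
   \int[nu]_u (psi u * \int[nu]_y kdc s om c delta w2 u y) +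
   \int[nu]_u (psi u * \int[nu]_y kdc s om c delta w3 u y).
  rewrite -(RintegralD measurableT i2 i3); apply: eq_Rintegral => u _.
  have [uc|uc] := pselect (eball c r u); last by rewrite psi0// !mul0r addr0.
  have [j2 _] := kdc_intg s0 a0 a1 Lam0 nnu omP r0 (lexx _) d0 dr mw2 w21 w20 (ltW uc).
  have [j3 _] := kdc_intg s0 a0 a1 Lam0 nnu omP r0 rM d0 dr mw3 w31 w30 (ltW uc).
  rewrite -mulrDr -(RintegralD measurableT j2 j3); congr (_ * _).
  by apply: eq_Rintegral => y _; rewrite /kdc /w1 /w2 /w3; ring.
rewrite E1 E2 -P2; move: h3; rewrite -/phiM.
move: (Pr s om nu delta phi psi) (Pr s om nu delta phiM psi) (\int[nu]_u _) (_ * (Lam * _)).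
move=> p q t b; rewrite (_ : p + (q - p + t) = q + t); last by ring.
by move=> h; apply: (le_trans (ler_normD _ _)); rewrite lerD2l.
Qed.

(** [M] is fixed first, making both far-field errors at most [eps / 3]. The remaining error is
    linear in [delta] with a constant depending on [M], and it determines [eta]. *)
Lemma reflectionless_real :
  (exists N B L : R, [/\ 1 <= N, 1 <= B, 1 <= L & forall M delta : R, 2 * N <= M -> 0 < delta ->
   `|Pr s om nu delta (cutoff 0 M) psi| <=
    2 * L * B * (Cnear s Lam * delta) * (Lam * (2 * M) `^ s) +
    B * Kfar s alpha Lam N M * (Lam * N `^ s)]) ->
  forall eps : R, 0 < eps -> exists2 eta : R, 0 < eta & forall delta : R, 0 < delta ->
    delta < eta -> `|Pr s om nu delta phi psi + \int[nu]_u (psi u * corrR u)| <= eps.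
Proof.
move=> [N [B [L [N1 B1 L1 hN]]]] eps e0.
have [B' B'0 psiB] := Cc_bounded Cpsi.
have N0 : 0 < N by lra.
have B0 : 0 < B by lra.
have L0 : 0 < L by lra.
have p1 := powR_gt0 s N0; have p2 := powR_gt0 s r0.
pose q1 := B * (Lam * N `^ s); pose q2 := B' * (Lam * r `^ s).
have q10 : 0 < q1 by rewrite !mulr_gt0.
have q20 : 0 < q2 by rewrite !mulr_gt0.
have e30 : 0 < eps / 3 by rewrite divr_gt0.
have [M1 M10 hM1] := Kfar_small N0 (divr_gt0 e30 q10).
have [M2 M20 hM2] := Kfar_small r0 (divr_gt0 e30 q20).
have c0 := enorm_ge0 c.
pose M := M1 + M2 + 2 * N + enorm c + 2 * r.
have MN : 2 * N <= M by rewrite /M; have := r0; lra.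
have MM1 : M1 <= M by rewrite /M; have := r0; lra.
have MM2 : M2 <= M - enorm c by rewrite /M; have := r0; lra.
have Mc : enorm c + 2 * r <= M by rewrite /M; lra.
have M0 : 0 < M by lra.
have Cn0 : 0 < Cnear s Lam by rewrite /Cnear !mulr_gt0// powR_gt0.
pose q3 := 2 * L * B * Cnear s Lam * (Lam * (2 * M) `^ s).
have q30 : 0 < q3 by rewrite !mulr_gt0// powR_gt0// mulr_gt0.
exists (Num.min r (eps / 3 / q3)); first by rewrite lt_min r0 divr_gt0.
move=> delta d0; rewrite lt_min => /andP[dr dq].
apply: (le_trans (Pr_corr_le d0 (ltW dr) Mc psiB)).
have h1 := hN M delta MN d0.
have h2 : 2 * L * B * (Cnear s Lam * delta) * (Lam * (2 * M) `^ s) <= eps / 3.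
  move: dq; rewrite ltr_pdivlMr// => /ltW; apply: le_trans.
  by rewrite /q3 le_eqVlt; apply/orP; left; apply/eqP; ring.
have h3 : B * Kfar s alpha Lam N M * (Lam * N `^ s) <= eps / 3.
  have := hM1 M MM1; rewrite ler_pdivlMr// /q1; apply: le_trans.
  by rewrite le_eqVlt; apply/orP; left; apply/eqP; ring.
have h4 : B' * Kfar s alpha Lam r (M - enorm c) * (Lam * r `^ s) <= eps / 3.
  have := hM2 _ MM2; rewrite ler_pdivlMr// /q2; apply: le_trans.
  by rewrite le_eqVlt; apply/orP; left; apply/eqP; ring.
move: h1 h2 h3 h4; move: `|_| (2 * L * B * _ * _) (B * _ * _) (B' * _ * _).
by move=> t1 t2 t3 t4; lra.
Qed.

End reflection.

(** * Complex kernels *)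

Section complex_parts.
Context (R : realType).
Implicit Types (z w : R[i]).
Local Open Scope complex_scope.

(** With a boolean selector, the real components of the kernel are indexed by the finite type
    ['I_d' * bool]. *)
Definition cpart (b : bool) z : R := if b then complex.Re z else complex.Im z.

Lemma cpart0 b : cpart b 0 = 0.
Proof. by case: b. Qed.

Lemma cpartB b z w : cpart b (z - w) = cpart b z - cpart b w.
Proof. by case: b; case: z; case: w. Qed.

Lemma cpart_real b (a : R) z : cpart b (a%:C * z) = a * cpart b z.
Proof. by case: b; case: z => u v /=; rewrite mul0r ?subr0 ?addr0. Qed.

Lemma cabs2E z : cabs2 z = cpart true z ^+ 2 + cpart false z ^+ 2.
Proof. by []. Qed.

Lemma cpart_sqr_le b z : cpart b z ^+ 2 <= cabs2 z.
Proof. by rewrite cabs2E; case: b; rewrite ?lerDl ?lerDr sqr_ge0. Qed.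

Lemma cpart_le b z : `|cpart b z| <= cabs z.
Proof. by rewrite -sqrtr_sqr; apply: ler_wsqrtr; exact: cpart_sqr_le. Qed.

Lemma cpart_sqr_le_vec (n : nat) b (v : 'rV[R[i]]_n) j : cpart b (v ord0 j) ^+ 2 <= cvnorm2 v.
Proof.
apply: (le_trans (cpart_sqr_le b _)); rewrite /cvnorm2 (bigD1 j)//= lerDl.
by apply: sumr_ge0 => i _; rewrite cabs2E addr_ge0 ?sqr_ge0.
Qed.

Lemma cpart_le_vec (n : nat) b (v : 'rV[R[i]]_n) j : `|cpart b (v ord0 j)| <= cvnorm v.
Proof. by rewrite -sqrtr_sqr; apply: ler_wsqrtr; exact: cpart_sqr_le_vec. Qed.

Lemma cvnorm_le (n : nat) (v : 'rV[R[i]]_n) (e : R) : 0 <= e ->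
  (forall b j, `|cpart b (v ord0 j)| <= e) -> cvnorm v <= 2 * n%:R * e.
Proof.
move=> e0 h.
have h2 b j : cpart b (v ord0 j) ^+ 2 <= e ^+ 2.
  by rewrite -real_normK ?num_real// lerXn2r ?nnegrE//; exact: h.
have S : cvnorm2 v <= 2 * n%:R * e ^+ 2.
  apply: (@le_trans _ _ (\sum_(j < n) (2 * e ^+ 2))).
    apply: ler_sum => j _; rewrite cabs2E.
    by have := h2 true j; have := h2 false j; lra.
  by rewrite sumr_const card_ord -[_ *+ n]mulr_natr mulrAC lexx.
have n2 : 0 <= 2 * n%:R * e by rewrite !mulr_ge0.
rewrite -(ger0_norm n2) -sqrtr_sqr; apply: ler_wsqrtr; apply: (le_trans S).
have e2 := sqr_ge0 e; rewrite !exprMn; apply: ler_wpM2r => //.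
have : n%:R <= n%:R ^+ 2 :> R by rewrite -natrX ler_nat; case: n {v h h2 S n2} => // n; rewrite expnS leq_pmulr.
by have := ler0n R n; nra.
Qed.

End complex_parts.

Section kernel_parts.
Context (R : realType) (d d' : nat).
Local Notation V := 'rV[R]_d.
Local Notation X := (Rd R d).
Variables (s alpha : R) (Om : V -> 'rV[R[i]]_d').
Hypothesis (OmP : CZ_Omega alpha Om).

Definition omc (p : 'I_d' * bool) (x : V) : R := cpart p.2 (Om x ord0 p.1).

Lemma real_CZ_omc p : real_CZ alpha (omc p).
Proof.
have [h1 h2 h3 _] := OmP.
have hom (l : R) x : omc p (l *: x) = l * omc p x.
  by rewrite /omc h1 mxE cpart_real.
split=> // [x|x x' x1 x'1].
  have [->|x0] := eqVneq x 0.
    by rewrite -(scale0r (0 : V)) hom mul0r normr0 enorm_ge0.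
  have n0 : 0 < enorm x by exact: enorm_gt0.
  pose u := (enorm x)^-1 *: x.
  have u1 : enorm u = 1 by rewrite enormZ gtr0_norm ?invr_gt0// mulVf// gt_eqF.
  have -> : omc p x = enorm x * omc p u.
    by rewrite -hom scalerA mulfV ?gt_eqF// scale1r.
  rewrite normrM gtr0_norm// -[leRHS]mulr1 ler_pM2l//.
  exact: le_trans (cpart_le_vec _ _ _) (h2 u u1).
rewrite /omc -cpartB.
have := cpart_le_vec p.2 (Om x - Om x') p.1; rewrite !mxE => /le_trans; apply.
exact: h3.
Qed.

Lemma Kdelta_part (delta : R) (x : V) j b :
  cpart b (Kdelta s Om delta x ord0 j) = kd s (omc (j, b)) delta x.
Proof. by rewrite mxE cpart_real kdE. Qed.

Lemma Kern_part (x : V) j b : cpart b (Kern s Om x ord0 j) = k0 s (omc (j, b)) x.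
Proof.
rewrite /Kern; case: eqP => [->|_]; last by rewrite mxE cpart_real k0E.
rewrite mxE cpart0 k0E.
have [h _ _] := real_CZ_omc (j, b).
by rewrite -(scale0r (0 : V)) h mul0r mulr0.
Qed.

Variable mu : bmeasure R d.

Lemma cpart_cint b (f : V -> R[i]) : cpart b (cint mu f) = \int[mu]_x cpart b (f x).
Proof. by case: b. Qed.

Lemma cint_mul (f g : V -> R[i]) :
  (forall b b', intg mu (fun x => cpart b (f x) * cpart b' (g x))) ->
  cpart true (cint mu (fun x => f x * g x)) =
    \int[mu]_x (cpart true (f x) * cpart true (g x)) -
    \int[mu]_x (cpart false (f x) * cpart false (g x)) /\
  cpart false (cint mu (fun x => f x * g x)) =
    \int[mu]_x (cpart true (f x) * cpart false (g x)) +
    \int[mu]_x (cpart false (f x) * cpart true (g x)).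
Proof.
move=> ifg; rewrite !cpart_cint.
rewrite -(RintegralB measurableT (ifg true true) (ifg false false)).
rewrite -(RintegralD measurableT (ifg true false) (ifg false true)).
by split; apply: eq_Rintegral => x _; case: (f x); case: (g x).
Qed.

Lemma cvintE (n : nat) (f : V -> R[i]) (F : V -> 'rV[R[i]]_n) j :
  cvint mu (fun x => f x *: F x) ord0 j = cint mu (fun x => f x * F x ord0 j).
Proof. by rewrite mxE; congr cint; apply/funext => x; rewrite mxE. Qed.

Lemma Tdelta_real (delta : R) (f : V -> R) (x : V) j b :
  cpart b (Tdelta s Om mu delta (fun y => (f y)%:C%C) x ord0 j) = Tr s (omc (j, b)) mu delta f x.
Proof.
rewrite /Tdelta cvintE cpart_cint; apply: eq_Rintegral => y _.
by rewrite cpart_real Kdelta_part.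
Qed.

Hypotheses (s0 : 0 < s) (a0 : 0 < alpha) (a1 : alpha <= 1).
Variable Lam : R.
Hypotheses (Lam0 : 0 < Lam) (nmu : nice s Lam mu).

Lemma cvnorm2_parts (v : 'rV[R[i]]_d') :
  cvnorm2 v = \sum_(j < d') (cpart true (v ord0 j) ^+ 2 + cpart false (v ord0 j) ^+ 2).
Proof. by []. Qed.

Lemma continuous_cvnorm2 (F : V -> 'rV[R[i]]_d') :
  (forall b j, continuous (fun x => cpart b (F x ord0 j))) ->
  continuous (fun x => cvnorm2 (F x)).
Proof.
move=> cF; rewrite (_ : (fun x => _) = fun x =>
  \sum_(j < d') (cpart true (F x ord0 j) * cpart true (F x ord0 j) +
    cpart false (F x ord0 j) * cpart false (F x ord0 j))).
  by apply: cont_sum => j; apply: contD; apply: contM.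
by apply/funext => x; rewrite cvnorm2_parts; apply: eq_bigr => j _; rewrite !expr2.
Qed.

(** For real [f], each real component of the vector operator is the scalar operator of the kernel
    [omc p], and it is dominated pointwise by the full norm. *)
Lemma good_rgood (Lg : R) p : good s Om Lg mu -> rgood s (omc p) Lg mu.
Proof.
move=> [_ gmu] delta f d0 Cf; case: p => j b.
have [mf f2] := Cc_L2r nmu Cf.
pose fc y := (f y)%:C%C.
have fcE y : cabs2 (fc y) = f y ^+ 2 by rewrite /cabs2/= expr0n addr0.
have cT i b' : continuous (fun x => cpart b' (Tdelta s Om mu delta fc x ord0 i)).
  rewrite (_ : (fun x => _) = Tr s (omc (i, b')) mu delta f).
    exact: (Tr_cont s0 a0 a1 (real_CZ_omc _) Lam0 nmu d0 (Cc_L2r nmu Cf)).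
  by apply/funext => x; exact: Tdelta_real.
have Lfc : L2 mu fc.
  split; [exact: mf|by have := @measurable_cst _ _ X R setT 0|].
  under eq_integral do rewrite fcE.
  by rewrite -(EFin_Rintegral f2) ltry.
have := gmu delta fc d0 Lfc.
under [X in (_ * X)%E]eq_integral do rewrite fcE.
apply: le_trans; apply: ge0_le_integral => //.
- by move=> x _; rewrite lee_fin sqr_ge0.
- apply/measurable_EFinP; apply: measurable_funX; apply: continuous_measurable_Rd.
  exact: (Tr_cont s0 a0 a1 (real_CZ_omc _) Lam0 nmu d0 (Cc_L2r nmu Cf)).
- apply/measurable_EFinP; apply: continuous_measurable_Rd.
  by apply: continuous_cvnorm2 => b' i; exact: cT.
- by move=> x _; rewrite lee_fin -Tdelta_real; exact: cpart_sqr_le_vec.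
Qed.

Lemma L2_part (f : V -> R[i]) b : L2 mu f -> L2r mu (fun x => cpart b (f x)).
Proof.
move=> [m1 m2 fi].
have mb b' : measurable_fun setT (fun x : X => cpart b' (f x)) by case: b'.
have m2b : measurable_fun setT (fun x : X => cabs2 (f x)).
  apply: (@measurable_funD _ _ _ _ (fun x : X => cpart true (f x) ^+ 2)
    (fun x : X => cpart false (f x) ^+ 2)).
    by apply: measurable_funX; exact: mb.
  by apply: measurable_funX; exact: mb.
have c0 x : 0 <= cabs2 (f x) by rewrite cabs2E addr_ge0 ?sqr_ge0.
have [|i _] := @intg_ge0 _ X _ mu (fun x => cabs2 (f x)) (fine (\int[mu]_x (cabs2 (f x))%:E)%E) m2b c0.
  rewrite fineK// ge0_fin_numE// integral_ge0// => x _; exact: c0.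
split=> //; apply: (intg_le _ i); first by apply: measurable_funX; exact: mb.
by move=> x; rewrite ger0_norm ?sqr_ge0//; exact: cpart_sqr_le.
Qed.

Lemma Tdelta_parts (delta : R) (f : V -> R[i]) (x : V) j : 0 < delta -> L2 mu f ->
  cpart true (Tdelta s Om mu delta f x ord0 j) =
    Tr s (omc (j, true)) mu delta (fun y => cpart true (f y)) x -
    Tr s (omc (j, false)) mu delta (fun y => cpart false (f y)) x /\
  cpart false (Tdelta s Om mu delta f x ord0 j) =
    Tr s (omc (j, false)) mu delta (fun y => cpart true (f y)) x +
    Tr s (omc (j, true)) mu delta (fun y => cpart false (f y)) x.
Proof.
move=> d0 Lf; rewrite /Tdelta cvintE.
have E b b' : (fun y => cpart b (f y) * cpart b' (Kdelta s Om delta (x - y) ord0 j)) =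
    (fun y => cpart b (f y) * kd s (omc (j, b')) delta (x - y)).
  by apply/funext => y; rewrite Kdelta_part.
have [|-> ->] := @cint_mul f (fun y => Kdelta s Om delta (x - y) ord0 j).
  move=> b b'; rewrite E.
  exact: (Tr_intg s0 a0 a1 (real_CZ_omc _) Lam0 nmu x d0 (L2_part b Lf)).
by split; rewrite /Tr; congr (_ + _); rewrite ?E//; congr (- _); rewrite E.
Qed.

Lemma sqr_parts_le (a b c e : R) :
  (a - b) ^+ 2 + (c + e) ^+ 2 <= 2 * (a ^+ 2 + b ^+ 2 + c ^+ 2 + e ^+ 2).
Proof. by have := sqr_ge0 (a + b); have := sqr_ge0 (c - e); lra. Qed.

Lemma sum4_le (A1 A2 A3 A4 q B1 B2 : R) : A1 <= q * B1 -> A2 <= q * B2 -> A3 <= q * B1 ->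
  A4 <= q * B2 -> A1 + A2 + A3 + A4 <= 2 * q * (B1 + B2).
Proof. by lra. Qed.

(** [good] asks one constant to bound both the growth and the operator, hence the sum. Splitting [f]
    and the kernel into real parts leaves four scalar terms per component, at a total cost of
    [4 * d' * Lg^2 <= (2 * d' * Lg)^2]. *)
Lemma rgood_good (Lg : R) : 0 < Lg -> (1 <= d')%N ->
  (forall p delta f, 0 < delta -> L2r mu f ->
    (\int[mu]_x (Tr s (omc p) mu delta f x ^+ 2)%:E <= (Lg ^+ 2 * \int[mu]_x (f x ^+ 2))%:E)%E) ->
  good s Om (Lam + 2 * d'%:R * Lg) mu.
Proof.
move=> Lg0 d'1 H; have d'0 : 1 <= d'%:R :> R by rewrite ler1n.
have LL : 0 < 2 * d'%:R * Lg by rewrite !mulr_gt0//; lra.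
split.
  move=> x r r0; apply: (le_trans (nmu x r0)); rewrite lee_fin ler_wpM2r ?powR_ge0// lerDl ltW//.
move=> delta f d0 Lf.
pose f_ b x := cpart b (f x).
have Lf_ b : L2r mu (f_ b) by exact: L2_part.
pose T p b x := Tr s (omc p) mu delta (f_ b) x.
have cT p b : continuous (T p b).
  exact: (Tr_cont s0 a0 a1 (real_CZ_omc _) Lam0 nmu d0 (Lf_ b)).
have iT p b : intg mu (fun x => T p b x ^+ 2) /\
    \int[mu]_x (T p b x ^+ 2) <= Lg ^+ 2 * \int[mu]_x (f_ b x ^+ 2).
  apply: intg_ge0.
  - by apply: measurable_funX; exact: continuous_measurable_Rd.
  - by move=> x; exact: sqr_ge0.
  - exact: H.
pose I := \int[mu]_x (f_ true x ^+ 2) + \int[mu]_x (f_ false x ^+ 2).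
have IE : (\int[mu]_x (cabs2 (f x))%:E)%E = I%:E.
  rewrite /I -(RintegralD measurableT (Lf_ true).2 (Lf_ false).2).
  by rewrite (EFin_Rintegral (intgD (Lf_ true).2 (Lf_ false).2)).
pose G j x := T (j, true) true x ^+ 2 + T (j, false) false x ^+ 2 +
   T (j, false) true x ^+ 2 + T (j, true) false x ^+ 2.
have iG j : intg mu (G j).
  have i12 := intgD (iT (j, true) true).1 (iT (j, false) false).1.
  exact: (intgD (intgD i12 (iT (j, false) true).1) (iT (j, true) false).1).
have IG j : \int[mu]_x G j x <= 2 * Lg ^+ 2 * I.
  rewrite /G.
  have h1 := iT (j, true) true; have h2 := iT (j, false) false.
  have h3 := iT (j, false) true; have h4 := iT (j, true) false.
  have i12 := intgD h1.1 h2.1; have i123 := intgD i12 h3.1.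
  rewrite (RintegralD measurableT i123 h4.1) (RintegralD measurableT i12 h3.1).
  rewrite (RintegralD measurableT h1.1 h2.1) /I.
  exact: (sum4_le h1.2 h2.2 h3.2 h4.2).
have bound x : cvnorm2 (Tdelta s Om mu delta f x) <= \sum_(j < d') 2 * G j x.
  rewrite cvnorm2_parts; apply: ler_sum => j _.
  have [-> ->] := Tdelta_parts x j d0 Lf; exact: sqr_parts_le.
have iS : intg mu (fun x => \sum_(j < d') 2 * G j x).
  by apply: intg_sum => j; exact: intgZ.
have cN : continuous (fun x => cvnorm2 (Tdelta s Om mu delta f x)).
  apply: continuous_cvnorm2 => b j; case: b.
    rewrite (_ : (fun x => _) = fun x => T (j, true) true x - T (j, false) false x).
      by apply: contB; exact: cT.
    by apply/funext => x; case: (Tdelta_parts x j d0 Lf).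
  rewrite (_ : (fun x => _) = fun x => T (j, false) true x + T (j, true) false x).
    by apply: contD; exact: cT.
  by apply/funext => x; case: (Tdelta_parts x j d0 Lf).
rewrite IE -EFinM.
apply: (@le_trans _ _ (\int[mu]_x (\sum_(j < d') 2 * G j x)%:E)%E).
  apply: ge0_le_integral => //.
  - move=> x _; rewrite lee_fin sumr_ge0// => j _; rewrite cabs2E addr_ge0 ?sqr_ge0//.
  - by apply/measurable_EFinP; exact: continuous_measurable_Rd.
  - by apply/measurable_EFinP; exact: intg_measurable iS.
  - by move=> x _; rewrite lee_fin.
rewrite -(EFin_Rintegral iS) lee_fin Rintegral_sum; last by move=> j; exact: intgZ.
apply: (@le_trans _ _ (\sum_(j < d') (4 * Lg ^+ 2 * I))).
  apply: ler_sum => j _; rewrite (RintegralZl _ measurableT (iG j)).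
  by have := IG j; move: (\int[mu]_x G j x) (Lg ^+ 2) => A B; lra.
rewrite sumr_const card_ord -[_ *+ d']mulr_natr.
have I0 : 0 <= I by apply: addr_ge0; apply: Rintegral_ge0 => x _; exact: sqr_ge0.
rewrite mulrAC ler_wpM2r//.
have h1 : 4 * Lg ^+ 2 * d'%:R <= (2 * d'%:R * Lg) ^+ 2.
  have L2 : 0 <= Lg ^+ 2 by exact: sqr_ge0.
  rewrite !exprMn (_ : 2 ^+ 2 * d'%:R ^+ 2 * Lg ^+ 2 = 4 * Lg ^+ 2 * d'%:R * d'%:R); last by ring.
  by rewrite ler_peMr// mulr_ge0// mulr_ge0.
apply: (le_trans h1); rewrite lerXn2r ?nnegrE ?(ltW LL)//; have := Lam0; lra.
Qed.

End kernel_parts.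

(** * Reflectionlessness for the complex vector kernel *)

Section complex_reflection.
Context (R : realType) (d d' : nat).
Local Notation V := 'rV[R]_d.
Local Notation X := (Rd R d).
Variables (s alpha Lam : R) (Om : V -> 'rV[R[i]]_d') (nu : bmeasure R d).
Hypotheses (OmP : CZ_Omega alpha Om) (s0 : 0 < s) (a0 : 0 < alpha) (a1 : alpha <= 1).
Hypotheses (Lam0 : 0 < Lam) (nnu : nice s Lam nu).

Lemma lip_cs_part (psi : V -> R[i]) b : lip_cs psi -> Cc (fun x => cpart b (psi x)) /\
  exists2 L0 : R, 0 <= L0 & forall y z, `|cpart b (psi y) - cpart b (psi z)| <= L0 * enorm (y - z).
Proof.
move=> [[M hM] [c [r hr]]].
have M1 : 0 < `|M| + 1 by rewrite ltr_wpDl.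
have hL y z : `|cpart b (psi y) - cpart b (psi z)| <= (`|M| + 1) * enorm (y - z).
  rewrite -cpartB; apply: (le_trans (cpart_le _ _)); apply: (le_trans (hM y z)).
  by rewrite ler_wpM2r ?enorm_ge0//; have := ler_norm M; lra.
split; last by exists (`|M| + 1) => //; exact: ltW.
split.
  apply/continuous_enormP => x e e0; exists (e / (`|M| + 1)); first by rewrite divr_gt0.
  by move=> y; rewrite ltr_pdivlMr// mulrC; exact: le_lt_trans (hL y x).
exists (r + enorm c) => x h; rewrite hr ?cpart0//.
by have := enorm_triangle c x 0; rewrite !subr0; lra.
Qed.

Lemma pairTdelta_parts (delta : R) (phi : V -> R) (psi : V -> R[i]) j :
  0 < delta -> L2r nu phi -> lip_cs psi ->
  cpart true (pairTdelta s Om nu delta (fun y => (phi y)%:C%C) psi ord0 j) =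
    Pr s (omc Om (j, true)) nu delta phi (fun x => cpart true (psi x)) -
    Pr s (omc Om (j, false)) nu delta phi (fun x => cpart false (psi x)) /\
  cpart false (pairTdelta s Om nu delta (fun y => (phi y)%:C%C) psi ord0 j) =
    Pr s (omc Om (j, false)) nu delta phi (fun x => cpart true (psi x)) +
    Pr s (omc Om (j, true)) nu delta phi (fun x => cpart false (psi x)).
Proof.
move=> d0 Lphi lpsi; rewrite /pairTdelta cvintE.
set T := Tdelta s Om nu delta (fun y => (phi y)%:C%C).
have E b b' : (fun x => cpart b (psi x) * cpart b' (T x ord0 j)) =
    (fun x => cpart b (psi x) * Tr s (omc Om (j, b')) nu delta phi x).
  by apply/funext => x; rewrite /T Tdelta_real.
have [|-> ->] := @cint_mul _ _ nu psi (fun x => T x ord0 j).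
  move=> b b'; rewrite E.
  exact: (Pr_intg s0 a0 a1 (real_CZ_omc OmP _) Lam0 nnu d0 Lphi (lip_cs_part b lpsi).1).
by rewrite !E.
Qed.

Lemma Kern_diff_part (a : R) (u v : V) j b :
  cpart b (a%:C%C * (Kern s Om u - Kern s Om v) ord0 j) =
    a * (k0 s (omc Om (j, b)) u - k0 s (omc Om (j, b)) v).
Proof.
rewrite cpart_real -(Kern_part s OmP u) -(Kern_part s OmP v) -cpartB.
by congr (a * cpart b _); move: (Kern s Om u) (Kern s Om v) => A B; rewrite !mxE.
Qed.

Lemma corr_term_parts (c z : V) (r : R) (phi : V -> R) (psi : V -> R[i]) j :
  0 < r -> eball c r z -> L2r nu phi -> (forall y, eball c (2 * r) y -> phi y = 1) ->
  (forall y, 0 <= phi y <= 1) -> lip_cs psi -> (forall u, ~ eball c r u -> psi u = 0) ->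
  let G b u := corrR s nu (omc Om (j, b)) z phi u in
  cpart true (corr_term s Om nu psi phi z ord0 j) =
    \int[nu]_u (cpart true (psi u) * G true u) - \int[nu]_u (cpart false (psi u) * G false u) /\
  cpart false (corr_term s Om nu psi phi z ord0 j) =
    \int[nu]_u (cpart true (psi u) * G false u) + \int[nu]_u (cpart false (psi u) * G true u).
Proof.
move=> r0 zc Lphi phi1 phi01 lpsi psi0 G; rewrite /corr_term cvintE.
pose F (x : V) := cvint nu (fun y => (1 - phi y)%:C%C *: (Kern s Om (x - y) - Kern s Om (z - y))).
have FE x b : cpart b (F x ord0 j) = G b x.
  rewrite /F cvintE cpart_cint; apply: eq_Rintegral => y _.
  exact: Kern_diff_part.
have E b b' : (fun x => cpart b (psi x) * cpart b' (F x ord0 j)) =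
    (fun x => cpart b (psi x) * G b' x).
  by apply/funext => x; rewrite FE.
have [|-> ->] := @cint_mul _ _ nu psi (fun x => F x ord0 j).
  move=> b b'; rewrite E.
  apply: (corr_intg s0 a0 a1 Lam0 nnu (real_CZ_omc OmP _) r0 zc Lphi phi1 phi01).
    exact: (lip_cs_part b lpsi).1.
  by move=> u /psi0 ->; rewrite cpart0.
by rewrite !E.
Qed.

Lemma normB_le2 (a b p q t u e : R) : a = p - q -> b = t - u ->
  `|p + t| <= e -> `|q + u| <= e -> `|a + b| <= 2 * e.
Proof. by move=> -> ->; rewrite !ler_norml => /andP[? ?] /andP[? ?]; apply/andP; split; lra. Qed.

Lemma normD_le2 (a b p q t u e : R) : a = p + q -> b = t + u ->
  `|p + t| <= e -> `|q + u| <= e -> `|a + b| <= 2 * e.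
Proof. by move=> -> ->; rewrite !ler_norml => /andP[? ?] /andP[? ?]; apply/andP; split; lra. Qed.

Lemma tangent_reflectionless (Lg : R) : 0 < Lg -> (1 <= d')%N ->
  (forall p (delta : R) f, 0 < delta -> L2r nu f ->
    (\int[nu]_x (Tr s (omc Om p) nu delta f x ^+ 2)%:E <=
       (Lg ^+ 2 * \int[nu]_x (f x ^+ 2))%:E)%E) ->
  (forall p (psi : V -> R) (L0 : R), Cc psi -> 0 <= L0 ->
    (forall y z, `|psi y - psi z| <= L0 * enorm (y - z)) -> \int[nu]_y psi y = 0 ->
    exists N B L : R, [/\ 1 <= N, 1 <= B, 1 <= L & forall M delta : R, 2 * N <= M -> 0 < delta ->
     `|Pr s (omc Om p) nu delta (cutoff 0 M) psi| <=
      2 * L * B * (Cnear s Lam * delta) * (Lam * (2 * M) `^ s) +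
      B * Kfar s alpha Lam N M * (Lam * N `^ s)]) ->
  reflectionless s Om nu.
Proof.
move=> Lg0 d'1 Hg Hv; split.
  exists (Lam + 2 * d'%:R * Lg); last exact: (rgood_good OmP s0 a0 a1 Lam0 nnu Lg0 d'1 Hg).
  by rewrite addr_gt0// !mulr_gt0// ltr0n.
move=> psi lpsi psiI c r z phi r0 sub /set_mem zc Lphi phi1 phi01.
have psi0 u : ~ eball c r u -> psi u = 0.
  move=> uc; apply: contrapT => /eqP h; apply: uc; apply: sub; exact: subset_closure.
have {}phi1 y : eball c (2 * r) y -> phi y = 1 by move=> h; apply: phi1; exact/mem_set.
have {}Lphi : L2r nu phi by have := L2_part true Lphi.
(* With this candidate, existence of the limit and the cancellation both amount to the smallness
   given by [reflectionless_real] for the real components. *)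
exists (- corr_term s Om nu psi phi z); split; last by rewrite addNr.
(* Two real pairings per part and [cvnorm_le] give [4 * d' * e]; the [+ 1] makes this strictly
   smaller than [eps]. *)
move=> eps e0; pose e := eps / (4 * d'%:R + 1).
have D0 : 0 < 4 * d'%:R + 1 :> R by rewrite ltr_wpDl// mulr_ge0.
have ee0 : 0 < e by rewrite divr_gt0.
pose A p b delta := Pr s (omc Om p) nu delta phi (fun x => cpart b (psi x)) +
  \int[nu]_u (cpart b (psi u) * corrR s nu (omc Om p) z phi u).
have [eta etaP] : exists eta : 'I_d' * bool * bool -> R, forall q, 0 < eta q /\
    forall delta : R, 0 < delta -> delta < eta q -> `|A q.1 q.2 delta| <= e.
  have h q : exists t : R, 0 < t /\
      forall delta : R, 0 < delta -> delta < t -> `|A q.1 q.2 delta| <= e.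
    have [Cp [L0 L00 lp]] := lip_cs_part q.2 lpsi.
    have pI : \int[nu]_y cpart q.2 (psi y) = 0 by rewrite -cpart_cint psiI cpart0.
    have p0 u : ~ eball c r u -> cpart q.2 (psi u) = 0 by move=> /psi0 ->; rewrite cpart0.
    have [t t0 ht] := reflectionless_real s0 a0 a1 Lam0 nnu (real_CZ_omc OmP q.1) r0 zc Lphi
      phi1 phi01 Cp p0 pI (Hv q.1 _ L0 Cp L00 lp pI) ee0.
    by exists t.
  by have [eta he] := choice h; exists eta.
exists (\big[Num.min/1]_q eta q).
  by apply: lt_bigmin => // q _; case: (etaP q).
move=> delta d0 dq.
have hA p b : `|A p b delta| <= e.
  have [_] := etaP (p, b); apply=> //; apply: (lt_le_trans dq); exact: bigmin_le.
apply: (@le_lt_trans _ _ (2 * d'%:R * (2 * e))).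
  apply: cvnorm_le; first by rewrite mulr_ge0// ltW.
  move=> b j; rewrite opprK.
  have [P1 P2] := pairTdelta_parts j d0 Lphi lpsi.
  have [Q1 Q2] := corr_term_parts j r0 zc Lphi phi1 phi01 lpsi psi0.
  have cD b' (u v : R[i]) : cpart b' (u + v) = cpart b' u + cpart b' v.
    by case: b'; case: u; case: v.
  rewrite mxE cD; case: b.
    exact: (normB_le2 P1 Q1 (hA (j, true) true) (hA (j, false) false)).
  exact: (normD_le2 P2 Q2 (hA (j, false) true) (hA (j, true) false)).
rewrite /e mulrA mulrA ltr_pdivrMr// mulrC ltr_pM2l//; lra.
Qed.

End complex_reflection.

(** * Choice of the point and contradiction *)

Lemma nonzero_eball (R : realType) (d : nat) (mu : bmeasure R d) : ~ is_zero_measure mu ->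
  exists n : nat, mu (eball 0 n.+1%:R) <> 0%E.
Proof.
move=> nz; apply: contrapT => /forallNP h; apply: nz => A mA; apply/eqP; rewrite -measure_le0.
have U0 : mu (\bigcup_n (eball 0 n.+1%:R : set (Rd R d))) = 0%E.
  apply: measure_bigcup0 => n; first exact: measurable_eball.
  by apply: contrapT; exact: h.
rewrite -U0; apply: le_measure; rewrite ?inE//.
  by apply: bigcup_measurable => n _; exact: measurable_eball.
move=> x _; exists (Num.truncn (enorm x)) => //; rewrite /eball/= subr0; exact: truncnS_gt.
Qed.

Theorem theorem1p1 (R : realType) (d d' : nat) (s alpha : R)
  (Om : 'rV[R]_d -> 'rV[R[i]]_d') :
  (2 <= d)%N -> (1 <= d')%N -> 0 < s -> s < d%:R -> 0 < alpha -> alpha <= 1 ->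
  CZ_Omega alpha Om ->
  (forall nu : bmeasure R d, reflectionless s Om nu -> is_zero_measure nu) ->
  forall mu : bmeasure R d,
    (exists2 Lam : R, 0 < Lam & nice s Lam mu) ->
    (hausdorff s (msupp mu) < +oo)%E ->
    (exists2 Lam : R, 0 < Lam & good s Om Lam mu) ->
    is_zero_measure mu.
Proof.
move=> _ d'1 s0 _ a0 a1 OmP Href mu [Lam Lam0 nmu] hH [Lg Lg0 gmu].
apply: contrapT => /nonzero_eball[n mun].
pose K : R := n.+1%:R.
have K10 : 0 < K + 1 by rewrite addr_gt0.
have Cchi : Cc (@cutoff R d 0 (K + 1)) by exact: cutoff_Cc.
have omP p := real_CZ_omc OmP p.
have rg p := good_rgood OmP s0 a0 a1 Lam0 nmu p gmu.
have [Z ZP] : exists Z : 'I_d' * bool -> set (Rd R d), forall p, [/\ measurable (Z p), mu (Z p) = 0%E &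
    forall x, ~ Z p x -> forall kap : R, 0 < kap -> exists2 rho : R, 0 < rho &
      forall r : R, 0 < r -> r < rho -> vanishing s mu (omc Om p) (cutoff 0 (K + 1)) x kap r].
  have h p := vanishing_ae s0 a0 a1 Lam0 nmu (omP p) (rg p) Cchi.
  by have [Z hZ] := choice h; exists Z.
have [Zd [mZd Zd0 ZdP]] := upper_density s0 Lam0 nmu hH.
(* The finitely many null sets, one per real kernel, are arranged in a sequence by [unpickle], with
   the empty set as default. *)
pose F k : set (Rd R d) := if unpickle k is Some p then Z p else set0.
have mF k : measurable (F k) by rewrite /F; case: unpickle => // p; case: (ZP p).
have F0 k : mu (F k) = 0%E.
  by rewrite /F; case: unpickle => [p|]; [case: (ZP p)|exact: measure0].
have UF0 := measure_bigcup0 mF F0.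
have mU : measurable (\bigcup_k F k) by exact: bigcup_measurable.
(* A ball of positive mass is not covered by null sets, so one point serves the density and all the
   real kernels together. *)
have [x [xK xZd xF]] : exists x, [/\ eball 0 K x, ~ Zd x & forall p, ~ Z p x].
  apply: contrapT => /forallNP h; apply: mun; apply/eqP; rewrite -measure_le0.
  apply: (@le_trans _ _ (mu (Zd `|` \bigcup_k F k))).
    apply: le_measure; rewrite ?inE; [exact: measurable_eball|exact: measurableU|].
    move=> y yK; apply: contrapT => /not_orP[yZ yF]; apply: (h y); split=> // p Zy.
    by apply: yF; exists (pickle p) => //; rewrite /F pickleK.
  have hU : (mu (Zd `|` \bigcup_k F k) <= mu Zd + mu (\bigcup_k F k))%E by exact: measureU2.
  by apply: (le_trans hU); rewrite Zd0 UF0 add0e.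
have {}xK : enorm x < K by move: xK; rewrite /eball/= subr0.
have [c c0 dens] := ZdP x xZd.
have [r_ rP] : exists r_ : nat -> R, forall j, [/\ 0 < r_ j, r_ j < j.+1%:R^-1 &
    ((c * r_ j `^ s)%:E < mu (eball x (r_ j)))%E].
  have i0 j : 0 < j.+1%:R^-1 :> R by rewrite invr_gt0.
  by have [r_ hr] := choice (fun j => dens j.+1%:R^-1 (i0 j)); exists r_.
have r0 j : 0 < r_ j by case: (rP j).
have rj j : r_ j < j.+1%:R^-1 by case: (rP j).
have [m_ mP] := choice (fun j => blowup_exists s mu x (r0 j)).
have mE j := (mP j).1; have intE j := (mP j).2.
have nm j := blowup_nice nmu (r0 j) (mE j).
have mc j : (c%:E <= m_ j (eball 0 1))%E.
  rewrite (blowup_eball (r0 j) (mE j)) scaler0 addr0 mulr1.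
  have [_ _ /ltW h] := rP j.
  apply: (@le_trans _ _ ((r_ j `^ (- s))%:E * (c * r_ j `^ s)%:E)%E).
    by rewrite -EFinM lee_fin powRN mulrC mulfK// gt_eqF// powR_gt0.
  by rewrite lee_wpmul2l// lee_fin powR_ge0.
(* The ultrafilter refines [\oo], so that [r_ j] tends to 0 along it. *)
have [U [UF ooU]] := ultraFilterLemma (F := \oo) _.
have [nu [nnu mu_nu]] := weak_limit_exists UF nm.
have zero : is_zero_measure nu.
  apply: Href; apply: (tangent_reflectionless OmP s0 a0 a1 Lam0 nnu Lg0 d'1).
    move=> p delta f d0 Lf.
    have gm j := blowup_rgood s0 a0 a1 Lam0 nmu (r0 j) (mE j) (intE j) (omP p) (rg p).
    exact: (weak_good s0 a0 a1 Lam0 (omP p) UF nm nnu mu_nu gm d0 Lf).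
  move=> p psi L0 Cpsi L00 psiL psiI; have [_ _ hv] := ZP p.
  exact: (tangent_vanishing s0 a0 a1 Lam0 nmu (omP p) xK (hv x (xF p)) r0 rj mE intE c0 mc
    UF ooU nnu mu_nu Cpsi L00 psiL psiI).
(* The bump keeps an integral of at least [c] in the limit, whereas the zero measure gives no mass
   to the ball [B(0, 2)] off which the bump vanishes. *)
have C1 : Cc (@cutoff R d 0 1) by exact: cutoff_Cc.
have f01 y : 0 <= @cutoff R d 0 1 y <= 1 by rewrite cutoff_ge0 cutoff_le1.
have f0 y : ~ eball 0 2 y -> @cutoff R d 0 1 y = 0.
  by move=> /negP; rewrite /eball/= -leNgt => h; rewrite cutoff0// mulr1.
have [_] := intg_le_indic (measurable_eball 0 2) (nice_lty nnu 0 2) (Cc_measurable C1) f01 f0.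
rewrite (zero _ (measurable_eball 0 2)) /= leNgt => /negP; apply.
exact: lt_le_trans c0 (tangent_mass nmu r0 mE mc UF mu_nu).
Qed.
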